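(* Fix natural numbers $M,N$ with $N>M$. (i) $\widehat{\otimes}_{\pi,s}^Nc_0$ is not isomorphic to any subspace of any quotient of $\widehat{\otimes}_\pi^Mc_0$. (ii) $\widehat{\otimes}_\pi^Nc_0$ is not isomorphic to any subspace of any quotient of $\widehat{\otimes}_\pi^Mc_0$. (iii) $\widehat{\otimes}_{\varepsilon,s}^N\ell_1$ is not isomorphic to any subspace of $\widehat{\otimes}_\varepsilon^M\ell_1$. (iv) $\widehat{\otimes}_\varepsilon^N\ell_1$ is not isomorphic to any subspace of $\widehat{\otimes}_\varepsilon^M\ell_1$.
   Context: Scalars are $\mathbb{R}$ or $\mathbb{C}$; subspaces are closed; ''isomorphic'' means linearly homeomorphic. $\widehat{\otimes}_\pi^NX$ and $\widehat{\otimes}_\varepsilon^NX$ are the $N$-fold completed projective and injective tensor products of $X$ with itself. For $\alpha\in\{\pi,\varepsilon\}$, the symmetric tensor product $\widehat{\otimes}_{\alpha,s}^NX$ is the range in $\widehat{\otimes}_\alpha^NX$ of the bounded symmetrization projection $S_N$ determined by $S_N(x_1\otimes\cdots\otimes x_N)=\frac1{N!}\sum_\sigma x_{\sigma(1)}\otimes\cdots\otimes x_{\sigma(N)}$ (sum over permutations of $\{1,\ldots,N\}$), endowed with a norm equivalent to the inherited one. *)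

(* Defs.v *)
From HB Require Import structures.
From mathcomp Require Import all_boot all_order all_algebra all_fingroup.
From mathcomp Require Import complex.
From mathcomp Require Import all_classical all_reals all_analysis.

Set Implicit Arguments.
Unset Strict Implicit.
Unset Printing Implicit Defensive.

Import Order.TTheory GRing.Theory Num.Theory.
Import numFieldNormedType.Exports.

Local Open Scope classical_set_scope.
Local Open Scope ring_scope.

(* Norms of normed modules over K : numFieldType take their values in K.  For
   the complex scalars they are nonnegative real elements of R[i], whose order
   only compares elements with the same imaginary part; [supremum] and
   [infimum] of sets of real elements are therefore the usual ones. *)
Variant scalar_kind := RealScalars | ComplexScalars.

Definition scalars (R : realType) (k : scalar_kind) : numFieldType :=
  match k with RealScalars => R | ComplexScalars => R[i]%C end.

Section real_elements.
Variables (R : realType) (k : scalar_kind).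
Local Notation K := (scalars R k).

Lemma scalars_supremums (A : set K) : A !=set0 ->
  (forall x, A x -> x \is Num.real) ->
  has_ubound A -> supremums A !=set0.
Proof.
case: k A => /= A [a0 Aa0] Areal [b bA].
  exists (sup A); split.
    by apply: ub_le_sup; exists b.
  by move=> c cA; apply: ge_sup => //; exists a0.
have Are x : A x -> ((complex.Re x)%:C)%C = x.
  by move=> /Areal /complex_realP[r ->].
have leRe (x y : R[i]%C) : x <= y -> complex.Re x <= complex.Re y.
  by rewrite lecE => /andP[].
have ne : [set complex.Re x | x in A] !=set0 by exists (complex.Re a0), a0.
exists ((sup [set complex.Re x | x in A])%:C)%C; split.
  move=> x Ax; rewrite -[x]Are// lecR; apply: ub_le_sup; last by exists x.
  by exists (complex.Re b) => _ [y Ay <-]; exact/leRe/bA.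
move=> c cA; have /eqP imc : complex.Im c == 0.
  have := cA _ Aa0; rewrite -(Are _ Aa0) lecE => /andP[/eqP/= -> _].
  exact/eqP.
rewrite lecE /= imc eqxx /=; apply: ge_sup => // _ [y Ay <-].
exact/leRe/cA.
Qed.

Lemma supremumP (A : set K) : A !=set0 ->
  (forall x, A x -> x \is Num.real) ->
  has_ubound A -> supremums A (supremum 0 A).
Proof.
move=> A0 Ar Ab; rewrite /supremum ifF; last by apply/negP => /eqP; exact/eqP/set0P.
by case: xgetP => // h; have [s /h] := scalars_supremums A0 Ar Ab.
Qed.

Lemma nondecreasing_bounded_cvg (u : nat -> K) (b : K) :
  {homo u : m n / (m <= n)%N >-> m <= n} -> (forall n, u n \is Num.real) ->
  (forall n, u n <= b) -> u @ \oo --> supremum 0 (range u).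
Proof.
move=> un ur ub.
have [uB Bu] : supremums (range u) (supremum 0 (range u)).
  apply: supremumP; first by exists (u 0%N), 0%N.
    by move=> _ [n _ <-].
  by exists b => _ [n _ <-].
set s := supremum _ _ in uB Bu *.
have us n : u n <= s by apply: uB; exists n.
have sr : s \is Num.real by rewrite -(ler_real (us 0%N)).
apply/cvgrPdist_le => e e0.
have [n un0] : exists n, s - e < u n.
  apply: contrapT => /forallNP h.
  have : s <= s - e.
    apply: Bu => _ [n _ <-].
    by rewrite real_leNgt ?rpredB ?(gtr0_real e0)//; exact/negP.
  by rewrite lerDl oppr_ge0 => /(lt_le_trans e0); rewrite ltxx.
near=> m; rewrite ger0_norm ?subr_ge0//.
have : u n <= u m by apply: un; near: m; exact: nbhs_infty_ge.
by move=> /(lt_le_trans un0)/ltW; rewrite lerBlDr addrC -lerBlDr.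
Unshelve. all: by end_near. Qed.

Lemma cvg_norm_bounded (u : nat -> K^o) : cvgn u ->
  exists b : K, forall n, `|u n| <= b.
Proof.
move=> /cvg_seq_bounded /pinfty_ex_gt0[b _ ub].
by exists b => n; exact: ub.
Qed.

End real_elements.

Section c0_space.
Variables (R : realType) (k : scalar_kind).
Local Notation K := (scalars R k).

Definition c0_seq : {pred nat -> K^o} :=
  fun x => `[< x @ \oo --> (0 : K^o) >].

Record c0 := C0 { c0_val :> nat -> K^o ; c0_valP : c0_val \in c0_seq }.

HB.instance Definition _ := [isSub for c0_val].
HB.instance Definition _ := [Choice of c0 by <:].

Lemma c0_submod_closed : submod_closed c0_seq.
Proof.
split; first by apply/asboolP; exact: cvg_cst.
move=> a x y /asboolP x0 /asboolP y0; apply/asboolP.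
by rewrite -[0](addr0 0) -{1}(scaler0 _ a); apply: cvgD => //; exact: cvgZr.
Qed.

HB.instance Definition _ :=
  GRing.isSubmodClosed.Build K (nat -> K^o) c0_seq c0_submod_closed.
HB.instance Definition _ := [SubChoice_isSubLmodule of c0 by <:].

Definition c0_norm (x : c0) : K := supremum 0 (range (fun n => `|x n|)).

Lemma c0_normP (x : c0) : supremums (range (fun n => `|x n|)) (c0_norm x).
Proof.
apply: supremumP; first by exists `|x 0%N|, 0%N.
  by move=> _ [n _ <-]; exact: normr_real.
have /asboolP x0 := c0_valP x.
have [b xb] := @cvg_norm_bounded R k x (cvgP _ x0).
by exists b => _ [n _ <-].
Qed.

Lemma c0_norm_ge (x : c0) n : `|x n| <= c0_norm x.
Proof. by have [+ _] := c0_normP x; apply; exists n. Qed.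

Lemma c0_norm_le (x : c0) b : (forall n, `|x n| <= b) -> c0_norm x <= b.
Proof. by move=> xb; have [_] := c0_normP x; apply => _ [n _ <-]. Qed.

Lemma c0_ler_normD (x y : c0) : c0_norm (x + y) <= c0_norm x + c0_norm y.
Proof.
apply: c0_norm_le => n; apply: le_trans (ler_normD (x n) (y n)) _.
by apply: lerD; exact: c0_norm_ge.
Qed.

Lemma c0_normrZ (a : K) (x : c0) : c0_norm (a *: x) = `|a| * c0_norm x.
Proof.
have leZ (c : K) y : c0_norm (c *: y) <= `|c| * c0_norm y.
  apply: c0_norm_le => n; rewrite [leLHS](_ : _ = `|c| * `|y n|).
    by apply: ler_wpM2l => //; exact: c0_norm_ge.
  exact: (normrM c (y n)).
apply/eqP; rewrite eq_le leZ /=; have [->|a0] := eqVneq a 0.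
  by rewrite normr0 mul0r; apply: le_trans (c0_norm_ge _ 0).
rewrite -ler_pdivlMl ?normr_gt0// -normfV -{1}[x]scale1r -(mulVf a0) -scalerA.
exact: leZ.
Qed.

Lemma c0_normr0_eq0 (x : c0) : c0_norm x = 0 -> x = 0.
Proof.
move=> x0; apply/val_inj/funext => n; apply/eqP.
by rewrite -normr_le0 -x0 c0_norm_ge.
Qed.

HB.instance Definition _ := Lmodule_isNormed.Build K c0
  c0_ler_normD c0_normrZ c0_normr0_eq0.

End c0_space.

Section l1_space.
Variables (R : realType) (k : scalar_kind).
Local Notation K := (scalars R k).

Definition l1_seq : {pred nat -> K^o} :=
  fun x => `[< cvgn (series (fun n => `|x n|) : nat -> K^o) >].

Record l1 := L1 { l1_val :> nat -> K^o ; l1_valP : l1_val \in l1_seq }.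

HB.instance Definition _ := [isSub for l1_val].
HB.instance Definition _ := [Choice of l1 by <:].

Lemma l1_seqP (x : nat -> K^o) : reflect
  (exists b : K, forall n, series (fun n => `|x n|) n <= b) (x \in l1_seq).
Proof.
have sr n : series (fun n => `|x n|) n \is Num.real.
  by apply: rpred_sum => i _; exact: normr_real.
apply: (iffP (asboolP _)).
  move=> /cvg_norm_bounded[b sb]; exists b => n.
  exact: le_trans (real_ler_norm (sr n)) (sb n).
move=> [b sb]; apply/cvg_ex; exists (supremum 0 (range (series (fun n => `|x n|)))).
apply: (nondecreasing_bounded_cvg _ sr sb) => m n mn.
by rewrite -subr_ge0 sub_series_geq//; apply: sumr_ge0.
Qed.

Lemma l1_submod_closed : submod_closed l1_seq.
Proof.
split.
  by apply/l1_seqP; exists 0 => n; rewrite seriesEnat /= big1// => i _; rewrite normr0.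
move=> a x y /l1_seqP[b xb] /l1_seqP[c yc]; apply/l1_seqP.
exists (`|a| * b + c) => n.
apply: (@le_trans _ _ (`|a| * series (fun n => `|x n|) n + series (fun n => `|y n|) n)).
  rewrite !seriesEnat /= mulr_sumr -big_split; apply: ler_sum => i _ /=.
  by apply: le_trans (ler_normD _ _) _; rewrite lerD2r (normrM a (x i)).
by apply: lerD => //; apply: ler_wpM2l.
Qed.

HB.instance Definition _ :=
  GRing.isSubmodClosed.Build K (nat -> K^o) l1_seq l1_submod_closed.
HB.instance Definition _ := [SubChoice_isSubLmodule of l1 by <:].

Definition l1_norm (x : l1) : K :=
  limn (series (fun n => `|x n|) : nat -> K^o).

Lemma l1_normP (x : l1) :
  supremums (range (series (fun n => `|x n|))) (l1_norm x).
Proof.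
have sr n : series (fun n => `|x n|) n \is Num.real.
  by apply: rpred_sum => i _; exact: normr_real.
have /l1_seqP[b xb] := l1_valP x.
have nd : {homo series (fun n => `|x n|) : m n / (m <= n)%N >-> m <= n}.
  by move=> m n mn; rewrite -subr_ge0 sub_series_geq//; apply: sumr_ge0.
have /cvg_lim := nondecreasing_bounded_cvg nd sr xb.
rewrite /l1_norm => ->; last exact: norm_hausdorff.
apply: supremumP; first by exists (series (fun n => `|x n|) 0%N), 0%N.
  by move=> _ [n _ <-].
by exists b => _ [n _ <-].
Qed.

Lemma l1_norm_ge (x : l1) n : series (fun n => `|x n|) n <= l1_norm x.
Proof. by have [+ _] := l1_normP x; apply; exists n. Qed.

Lemma l1_norm_le (x : l1) b :
  (forall n, series (fun n => `|x n|) n <= b) -> l1_norm x <= b.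
Proof. by move=> xb; have [_] := l1_normP x; apply => _ [n _ <-]. Qed.

Lemma l1_ler_normD (x y : l1) : l1_norm (x + y) <= l1_norm x + l1_norm y.
Proof.
apply: l1_norm_le => n; apply: le_trans (lerD (l1_norm_ge x n) (l1_norm_ge y n)).
rewrite !seriesEnat /= -big_split; apply: ler_sum => i _.
exact: (ler_normD (x i) (y i)).
Qed.

Lemma l1_normrZ (a : K) (x : l1) : l1_norm (a *: x) = `|a| * l1_norm x.
Proof.
have leZ (c : K) y : l1_norm (c *: y) <= `|c| * l1_norm y.
  apply: l1_norm_le => n.
  rewrite [leLHS](_ : _ = `|c| * series (fun n => `|y n|) n).
    by apply: ler_wpM2l => //; exact: l1_norm_ge.
  rewrite !seriesEnat /= mulr_sumr; apply: eq_bigr => i _.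
  exact: (normrM c (y i)).
apply/eqP; rewrite eq_le leZ /=; have [->|a0] := eqVneq a 0.
  rewrite normr0 mul0r; apply: le_trans (l1_norm_ge _ 0).
  by rewrite seriesEnat /= big_geq.
rewrite -ler_pdivlMl ?normr_gt0// -normfV -{1}[x]scale1r -(mulVf a0) -scalerA.
exact: leZ.
Qed.

Lemma l1_normr0_eq0 (x : l1) : l1_norm x = 0 -> x = 0.
Proof.
move=> x0; apply/val_inj/funext => n; apply/eqP.
rewrite -normr_le0 -x0; apply: le_trans (l1_norm_ge x n.+1).
by rewrite seriesEnat /= big_nat_recr//= lerDr; apply: sumr_ge0.
Qed.

HB.instance Definition _ := Lmodule_isNormed.Build K l1
  l1_ler_normD l1_normrZ l1_normr0_eq0.

End l1_space.

Section tensor_products.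
Variables (K : numFieldType) (X : normedModType K) (N : nat).

Definition multilinear (V : lmodType K) (phi : ('I_N -> X) -> V) : Prop :=
  forall (i : 'I_N) (x : 'I_N -> X) (a : K) (u v : X),
    phi (dfwith x i (a *: u + v)) =
    a *: phi (dfwith x i u) + phi (dfwith x i v).

(* For 0 < N every element of the algebraic tensor power is a finite sum of
   elementary tensors, so a sequence [:: x; y; ...] of N-tuples of vectors stands
   for x_1 ⊗ ... ⊗ x_N + y_1 ⊗ ... ⊗ y_N + ...  Two sequences stand for the same
   element when no multilinear map separates them. *)
Definition tensor_eq (s t : seq ('I_N -> X)) : Prop :=
  forall (V : lmodType K) (phi : ('I_N -> X) -> V), multilinear phi ->
    \sum_(x <- s) phi x = \sum_(x <- t) phi x.

Definition projective_norm (s : seq ('I_N -> X)) : K :=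
  infimum 0 [set \sum_(x <- t) \prod_(i < N) `|x i| | t in tensor_eq s].

Definition dual_unit_ball : set {scalar X} :=
  [set f | forall x, `|f x| <= `|x|].

Definition injective_norm (s : seq ('I_N -> X)) : K :=
  supremum 0 [set `|\sum_(x <- s) \prod_(i < N) f i (x i)| |
    f in [set f : 'I_N -> {scalar X} | forall i, dual_unit_ball (f i)]].

(* T, with the elementary tensors theta, is the completion of the algebraic
   tensor power for the norm nrm.  Since nrm only vanishes at 0 there, the
   norm condition makes the map induced by theta injective. *)
Definition tensor_completion (nrm : seq ('I_N -> X) -> K)
    (T : completeNormedModType K) (theta : ('I_N -> X) -> T) : Prop :=
  [/\ multilinear theta,
      forall s, `|\sum_(x <- s) theta x| = nrm s
    & dense (range (fun s : seq ('I_N -> X) => \sum_(x <- s) theta x))].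

Definition projective_tensor := tensor_completion projective_norm.
Definition injective_tensor := tensor_completion injective_norm.

Definition symmetrization (T : normedModType K) (theta : ('I_N -> X) -> T)
    (S : {linear T -> T}) : Prop :=
  continuous S /\
  forall x, S (theta x) =
    (N`!%:R)^-1 *: \sum_(sigma : 'S_N) theta (fun i => x (sigma i)).

End tensor_products.

Section isomorphisms.
Variable K : numFieldType.

Definition closed_subspace (E : normedModType K) (A : set E) : Prop :=
  submod_closed (mem A) /\ closed A.

Definition isomorphic (E F : normedModType K) (A : set E) (B : set F) : Prop :=
  exists (f : E -> F) (g : F -> E),
  [/\ set_fun A B f /\ set_fun B A g,
      {in A, cancel f g} /\ {in B, cancel g f},
      forall (a : K) (x y : E), A x -> A y -> f (a *: x + y) = a *: f x + f y
    & {within A, continuous f} /\ {within B, continuous g}].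

Definition isomorphic_to_subspace (E : normedModType K) (A : set E)
    (F : normedModType K) : Prop :=
  exists B : set F, closed_subspace B /\ isomorphic A B.

Definition quotient_map (E Q : normedModType K) (Z : set E)
    (q : {linear E -> Q}) : Prop :=
  [/\ forall x, q x = 0 <-> Z x,
      range q = [set: Q]
    & forall x, `|q x| = infimum 0 [set `|x - z| | z in Z]].

Definition isomorphic_to_subspace_of_quotient (E : normedModType K) (A : set E)
    (F : normedModType K) : Prop :=
  exists (Z : set F) (Q : normedModType K) (q : {linear F -> Q}),
  [/\ closed_subspace Z, quotient_map Z q & isomorphic_to_subspace A Q].

End isomorphisms.

(* Main.v *)
Require Import Defs.
From HB Require Import structures.
From mathcomp Require Import all_boot all_order all_algebra all_fingroup.
From mathcomp Require Import complex ring lra zify.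
From mathcomp Require Import all_classical all_reals all_analysis.

Set Implicit Arguments.
Unset Strict Implicit.
Unset Printing Implicit Defensive.

Import Order.TTheory GRing.Theory Num.Theory.
Import numFieldNormedType.Exports.

Local Open Scope classical_set_scope.
Local Open Scope ring_scope.

(** Write e_q for the unit vectors of c_0, s_q = e_0 + ... + e_(q-1), and let x_q be the
    N-fold tensor e_q ⊗ s_q ⊗ ... ⊗ s_q in the projective power of c_0.  The form
    sum_i y_0(i) prod_(t > 0) sum_j y_t(j) / (i - j) on the first n indices has norm O(n),
    by the l_p boundedness of the discrete Hilbert transform, and it shows that any sum of n
    differences of distinct terms x_(a_i) - x_(b_i), with a_i increasing, has norm at least
    c (log n)^(N-1).  Symmetrization and isomorphisms only affect the constant.

    In contrast every bounded sequence in a quotient of the M-fold power admits such sums of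
    norm O((log n)^(M-1)).  One lifts it, approximates the lifts by averages of elementary
    tensors with slots in the unit ball, and passes to a subsequence along which these
    averages stabilize on initial coordinates.  It remains to bound sums of elementary
    tensors cut at increasing places: one slot contributes disjoint blocks, and each of the
    M - 1 others costs a factor log n by dyadic decomposition and a choice of signs.

    For the injective powers of l_1 the argument is dual.  The functionals picking the index
    set k_0 = q, k_t < q are transported through the isomorphism into the M-fold power, where
    they are averages of tuples in the unit ball of l_infinity, and the same upper bound
    contradicts the same test form. *)

(** * The discrete Hilbert transform on l_p *)

Section Hilbert.
Variable F : realFieldType.
Implicit Types (y u : nat -> F) (n i j k : nat).

(** The logarithms come from truncation: the discrete Hilbert transform is bounded on l_p, but its
    kernel restricted to j < i has row sums of order log i, and each of the N - 1 slots other than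
    the first contributes one such factor. Differences are used because two terms that nearly agree
    on the earlier coordinates differ by a block of new coordinates, while the test form, read off
    at the indices a_j only, does not see the terms x_(b_i). The obstacle on the M-fold side is that
    the averages approximating different terms are unrelated. They are coupled by comparing the
    masses of finitely many cells of initial coordinates; after that a single elementary tensor can
    be followed through all the terms. Everything is done with finitely many terms and explicit
    tolerances, and L is taken so large that (L/2)^(N-1) beats a constant times L^(M-1). In the
    injective case the transported functionals live on a subspace only; instead of being extended,
    their values on finitely many vectors are approximated by a convex minimization. *)

Definition hil i j : F := (i%:R - j%:R)^-1.

Lemma hil_diag i : hil i i = 0.
Proof. by rewrite /hil subrr invr0. Qed.

Lemma hil_anti i j : hil j i = - hil i j.
Proof. by rewrite /hil -invrN opprB. Qed.

Lemma hil_shift c i j : hil (c + i) (c + j) = hil i j.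
Proof. by rewrite /hil !natrD; congr (_ ^-1); ring. Qed.

Lemma subr_nat_neq0 i j : i != j -> (i%:R - j%:R : F) != 0.
Proof. by rewrite subr_eq0 eqr_nat. Qed.

Lemma normr_hil_le1 i j : `|hil i j| <= 1.
Proof.
have [->|ij] := eqVneq i j; first by rewrite hil_diag normr0.
rewrite /hil normfV invf_le1 ?normr_gt0 ?subr_nat_neq0 //.
wlog lt_ij : i j ij / (i < j)%N => [hw|].
  have [h|h|h] := ltngtP i j; last by rewrite h eqxx in ij.
  - exact: hw.
  - by rewrite distrC; apply: hw => //; rewrite eq_sym.
rewrite distrC ger0_norm ?subr_ge0 ?ler_nat ?(ltnW lt_ij) //.
by rewrite -natrB ?(ltnW lt_ij) // ler1n subn_gt0.
Qed.

Lemma sum_shifted_line (g : F -> F) c W : (c < W)%N ->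
  \sum_(r < W) g (r%:R - c%:R) =
  \sum_(d < c) g (- d.+1%:R) + g 0 + \sum_(d < W - c.+1) g d.+1%:R.
Proof.
move=> cW; move: (subnKC cW); set m := (W - _)%N; clearbody m => WE; subst W.
rewrite big_split_ord /= big_ord_recr /= subrr {cW}.
congr (_ + _ + _).
  rewrite (reindex_inj rev_ord_inj) /=; apply: eq_bigr => d _; congr g.
  by rewrite natrB // addrAC subrr add0r.
by apply: eq_bigr => d _; congr g; rewrite addSnnS natrD; ring.
Qed.

Lemma sum_invsq m : \sum_(d < m) (d.+1%:R ^-1) ^+ 2 <= 2 :> F.
Proof.
(* The remainder 1/(m+1) makes the induction telescope, since 1/x - 1/(x+1) >= 1/(x+1)^2. *)
have h : forall m, \sum_(d < m.+1) (d.+1%:R ^-1) ^+ 2 <= 2 - m.+1%:R^-1 :> F.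
  elim=> [|k IH]; first by rewrite big_ord1 invr1; lra.
  rewrite big_ord_recr /=; apply: le_trans (lerD IH (lexx _)) _.
  have k1 : 0 < k.+1%:R :> F by rewrite ltr0n.
  have -> : k.+2%:R = k.+1%:R + 1 :> F by rewrite -[in LHS]addn1 natrD.
  move: (k.+1%:R) k1 => x x0.
  have e : x^-1 - (x + 1)^-1 - ((x + 1)^-1) ^+ 2 = (x * (x + 1) ^+ 2)^-1.
    by field; apply/andP; split; lra.
  have : 0 <= (x * (x + 1) ^+ 2)^-1.
    by rewrite invr_ge0 mulr_ge0 ?exprn_ge0 //; lra.
  lra.
case: m => [|m]; first by rewrite big_ord0; lra.
by apply: le_trans (h m) _; rewrite gerBl invr_ge0.
Qed.

Lemma sum_hilsq c W : \sum_(r < W) hil r c ^+ 2 <= 4.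
Proof.
suff H W' : (c < W')%N -> \sum_(r < W') hil r c ^+ 2 <= 4.
  apply: le_trans (H (W + c.+1)%N _); last by rewrite addnS ltnS leq_addl.
  by rewrite big_split_ord /= lerDl sumr_ge0 // => i _; rewrite sqr_ge0.
move=> cW; rewrite (sum_shifted_line (fun x => x^-1 ^+ 2) cW) invr0 expr0n addr0.
under eq_bigr do rewrite invrN sqrrN.
by have := lerD (sum_invsq c) (sum_invsq (W' - c.+1)); lra.
Qed.

Lemma sum_hilsqr i n : \sum_(j < n) hil i j ^+ 2 <= 4.
Proof. by under eq_bigr do rewrite hil_anti sqrrN; exact: sum_hilsq. Qed.

Lemma harmonic_gap R m n : (0 < R)%N -> (R <= m)%N -> (R <= n)%N ->
  `|\sum_(d < m) d.+1%:R^-1 - \sum_(d < n) d.+1%:R^-1|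
  <= ((m - n) + (n - m))%N%:R / R%:R :> F.
Proof.
move=> R0; wlog mn : m n / (n <= m)%N => [hw Rm Rn|Rm Rn].
  by have [h|/ltnW h] := leqP n m; [exact: hw|rewrite distrC addnC; exact: hw].
have /eqP -> : (n - m == 0)%N by rewrite subn_eq0.
rewrite addn0 {Rm}.
move: (subnKC mn); set e := (m - n)%N; clearbody e => mE; subst m.
rewrite big_split_ord /= addrAC subrr add0r ger0_norm; last first.
  by apply: sumr_ge0 => i _; rewrite invr_ge0.
have -> : e%:R / R%:R = \sum_(i < e) R%:R^-1 :> F.
  by rewrite sumr_const card_ord mulr_natl.
apply: ler_sum => i _; rewrite lef_pV2 ?posrE ?ltr0n // ler_nat.
by apply: leq_trans Rn _; rewrite -addnS leq_addr.
Qed.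

(** The kernel is odd about [R + s]. The window has at least R terms on either side and the two
    lengths differ by at most n, so what fails to cancel is at most n terms of size at most 1/R. *)
Lemma hil_row_small R n s : (0 < R)%N -> (s < n)%N ->
  `|\sum_(r < R + n + R) hil r (R + s)| <= n%:R / R%:R.
Proof.
move=> R0 sn.
have h : (R + s < R + n + R)%N by rewrite -addnA ltn_add2l ltn_addr.
rewrite (sum_shifted_line (fun x => x^-1) h) invr0 addr0.
under eq_bigr do rewrite invrN.
rewrite sumrN addrC; apply: le_trans (harmonic_gap R0 _ _) _.
- by rewrite subnS -addnA subnDl -subnS -addnBAC // leq_addl.
- exact: leq_addr.
rewrite ler_wpM2r ?invr_ge0 // ler_nat.
have -> : (R + n + R - (R + s).+1 = n - s.+1 + R)%N.
  by rewrite -addnA -addnS subnDl addnBAC.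
rewrite [(R + s)%N]addnC subnDr subnDr.
have [h1|h1] := leqP (n - s.+1) s.
  by rewrite (eqP (_ : n - s.+1 - s == 0)%N) // add0n (leq_trans (leq_subr _ _)) // ltnW.
rewrite (eqP (_ : s - (n - s.+1) == 0)%N) ?addn0; last by rewrite subn_eq0 ltnW.
by rewrite (leq_trans (leq_subr _ _)) // leq_subr.
Qed.

(** Partial fractions; at r = s and r = t the left side is 0 by the convention 0^-1 = 0, which the
    last summand compensates. *)
Lemma hil_mul r s t : s != t ->
  hil r s * hil r t = hil s t * (hil r s - hil r t)
    + ((r == s)%:R + (r == t)%:R) * hil s t ^+ 2.
Proof.
move=> st; have [->|rs] := eqVneq r s.
  by rewrite (negPf st) hil_diag /=; ring.
have [->|rt] := eqVneq r t.
  by rewrite hil_diag (hil_anti s t) /=; ring.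
rewrite /= addr0 mul0r addr0 /hil; field.
by rewrite !subr_nat_neq0.
Qed.

Definition hilop n y i := \sum_(j < n) hil i j * y j.

Lemma sqr_sum (I : finType) (f : I -> F) :
  (\sum_i f i) ^+ 2 = \sum_i \sum_j f i * f j.
Proof. by rewrite expr2 mulr_suml; apply: eq_bigr => i _; rewrite mulr_sumr. Qed.

(* Extending the rows to a window of radius R only increases the left-hand side and makes
   distinct columns of [hil] almost orthogonal, up to terms from [hil_mul]. *)
Lemma hilop_l2 n y :
  \sum_(i < n) hilop n y i ^+ 2 <= 13 * \sum_(i < n) y i ^+ 2.
Proof.
have [->|n0] := posnP n; first by rewrite !big_ord0 mulr0.
(* With this radius the errors n/R add up to 1/2 over n columns, which leads to the constant 4 + 2
   (4 + 1/2) = 13. *)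
pose R := (2 * n * n)%N; have R0 : (0 < R)%N by rewrite /R !muln_gt0 n0.
pose W := (R + n + R)%N.
pose S := \sum_(i < n) y i ^+ 2.
have S0 : 0 <= S by apply: sumr_ge0 => i _; rewrite sqr_ge0.
pose h s := \sum_(r < W) hil r (R + s).
have hb s : (s < n)%N -> `|h s| <= n%:R / R%:R by move=> sn; exact: hil_row_small.
pose G s t := \sum_(r < W) hil r (R + s) * hil r (R + t).
have le1 : \sum_(i < n) hilop n y i ^+ 2 <=
    \sum_(r < W) (\sum_(s < n) hil r (R + s) * y s) ^+ 2.
  rewrite /W !big_split_ord /= -addrA.
  apply: ler_wpDl; first by apply: sumr_ge0 => i _; rewrite sqr_ge0.
  apply: ler_wpDr; first by apply: sumr_ge0 => i _; rewrite sqr_ge0.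
  apply: ler_sum => i _; rewrite (_ : hilop n y i = \sum_(s < n) hil (R + i) (R + s) * y s) //.
  by apply: eq_bigr => s _; rewrite hil_shift.
apply: le_trans le1 _.
have -> : \sum_(r < W) (\sum_(s < n) hil r (R + s) * y s) ^+ 2
    = \sum_(s < n) \sum_(t < n) y s * y t * G s t.
  under eq_bigr do rewrite sqr_sum.
  rewrite exchange_big; apply: eq_bigr => s _ /=.
  rewrite exchange_big; apply: eq_bigr => t _ /=.
  by rewrite mulr_sumr; apply: eq_bigr => r _; ring.
have GE s t : s != t -> (s < n)%N -> (t < n)%N ->
    G s t = hil s t * (h s - h t) + 2 * hil s t ^+ 2.
  move=> st sn tn; rewrite /G.
  have st' : (R + s != R + t)%N by rewrite eqn_add2l.
  under eq_bigr do rewrite (hil_mul _ st') hil_shift.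
  rewrite big_split /= -mulr_sumr sumrB; congr (_ + _).
  rewrite -mulr_suml big_split /=.
  have one (w : nat) : (w < n)%N -> \sum_(r < W) (r == (R + w)%N :> nat)%:R = 1 :> F.
    move=> wn; have uW : (R + w < W)%N by rewrite /W -addnA ltn_add2l ltn_addr.
    rewrite (bigD1 (Ordinal uW)) //= eqxx big1 ?addr0 // => r.
    by rewrite -val_eqE /= => /negPf ->.
  by rewrite !one //; ring.
have Gd s : G s s <= 4.
  by rewrite /G; under eq_bigr do rewrite -expr2; exact: sum_hilsq.
have bnd : \sum_(s < n) \sum_(t < n) y s * y t * G s t <=
  \sum_(s < n) \sum_(t < n) ((s == t)%:R * (4 * y s ^+ 2)
     + (y s ^+ 2 + y t ^+ 2) * (n%:R / R%:R + hil s t ^+ 2)).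
  apply: ler_sum => s _; apply: ler_sum => t _.
  have nR : 0 <= n%:R / R%:R :> F by rewrite divr_ge0.
  have [<-|st] := eqVneq s t.
    rewrite mul1r hil_diag -expr2.
    have := ler_wpM2l (sqr_ge0 (y s)) (Gd s).
    have := mulr_ge0 (sqr_ge0 (y s)) nR; nra.
  rewrite mul0r add0r (GE s t) //.
  have h2 : `|h s - h t| <= 2 * (n%:R / R%:R).
    by apply: le_trans (ler_normB _ _) _; have := lerD (hb s (ltn_ord s)) (hb t (ltn_ord t)); lra.
  have h3 : hil s t * (h s - h t) <= 2 * (n%:R / R%:R) /\
     - (2 * (n%:R / R%:R)) <= hil s t * (h s - h t).
    apply/andP; rewrite andbC -ler_norml normrM -[leRHS]mul1r.
    by apply: ler_pM => //; exact: normr_hil_le1.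
  have h4 : 2 * (y s * y t) <= y s ^+ 2 + y t ^+ 2 by have := sqr_ge0 (y s - y t); nra.
  have h5 : - (y s ^+ 2 + y t ^+ 2) <= 2 * (y s * y t) by have := sqr_ge0 (y s + y t); nra.
  have h6 := sqr_ge0 (hil s t).
  move: h3 h4 h5 h6 => [h31 h32]; move: (hil s t * _) h31 h32 => p.
  move: (hil s t ^+ 2) (n%:R / R%:R) nR (y s ^+ 2 + y t ^+ 2) (y s * y t) => q e e0 Y z *.
  have : z * (p + 2 * q) <= Y * (e + q); last by lra.
  have [z0|z0] := lerP 0 z.
    apply: (@le_trans _ _ (z * (2 * e + 2 * q))); first by apply: ler_wpM2l => //; lra.
    have := ler_wpM2r (_ : 0 <= e + q) (_ : 2 * z <= Y); lra.
  apply: (@le_trans _ _ ((- z) * (2 * e + 2 * q))).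
    by have := @ler_wpM2l _ (- z) _ (- (p + 2 * q)) (2 * e + 2 * q) _; lra.
  have := ler_wpM2r (_ : 0 <= e + q) (_ : 2 * (- z) <= Y); lra.
apply: le_trans bnd _.
have e1 : \sum_(s < n) \sum_(t < n) (s == t)%:R * (4 * y s ^+ 2) = 4 * S.
  rewrite /S mulr_sumr; apply: eq_bigr => s _.
  rewrite (bigD1 s) //= eqxx mul1r big1 ?addr0 // => t.
  by rewrite eq_sym => /negPf ->; rewrite mul0r.
have e2 : \sum_(s < n) \sum_(t < n) (y s ^+ 2 + y t ^+ 2) * (n%:R / R%:R + hil s t ^+ 2)
    = 2 * \sum_(s < n) y s ^+ 2 * (\sum_(t < n) (n%:R / R%:R + hil s t ^+ 2)).
  transitivity (\sum_(s < n) \sum_(t < n) y s ^+ 2 * (n%:R / R%:R + hil s t ^+ 2) +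
    \sum_(s < n) \sum_(t < n) y t ^+ 2 * (n%:R / R%:R + hil s t ^+ 2)).
    rewrite -big_split /=; apply: eq_bigr => s _; rewrite -big_split /=.
    by apply: eq_bigr => t _; rewrite mulrDl.
  rewrite [X in _ + X]exchange_big /= mulr2n mulrDl mul1r; congr (_ + _).
    by apply: eq_bigr => s _; rewrite mulr_sumr.
  apply: eq_bigr => s _; rewrite mulr_sumr; apply: eq_bigr => t _.
  by rewrite hil_anti sqrrN.
under eq_bigr do rewrite big_split /=.
rewrite big_split /= e1 e2.
have : \sum_(s < n) y s ^+ 2 * (\sum_(t < n) (n%:R / R%:R + hil s t ^+ 2)) <=
   \sum_(s < n) y s ^+ 2 * (4 + 1/2).
  apply: ler_sum => s _; apply: ler_wpM2l; first exact: sqr_ge0.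
  rewrite big_split /= sumr_const card_ord -mulr_natl addrC lerD ?sum_hilsqr //.
  rewrite /R !natrM le_eqVlt; apply/orP; left; apply/eqP.
  by field; rewrite pnatr_eq0 -lt0n.
rewrite -mulr_suml -/S; lra.
Qed.

(** Convolution with the summable kernel 1/(i-j)^2, hence bounded on every l_p; it collects the
    error terms of the identity for squares. *)
Definition hilC n y i := \sum_(j < n) hil i j ^+ 2 * y j.

Lemma hil_mul3 i j k :
  hil i j * hil i k = (j == k)%:R * hil i j ^+ 2 + hil i j * hil j k
    + hil i k * hil k j + (k == i)%:R * hil i j ^+ 2
    + (j == i)%:R * hil i k ^+ 2.
Proof.
have [->|jk] := eqVneq j k.
  have [->|ki] := eqVneq k i; first by rewrite !hil_diag /=; ring.
  by rewrite !hil_diag /=; ring.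
case: (eqVneq k i) jk => [->|ki] jk.
  by rewrite (negPf jk) !hil_diag (hil_anti i j) /=; ring.
case: (eqVneq j i) jk => [->|ji] jk.
  by rewrite !hil_diag (hil_anti i k) /=; ring.
rewrite /= !mul0r addr0 add0r addr0 /hil; field.
by rewrite !subr_nat_neq0 // eq_sym.
Qed.

Lemma sum_delta n (i : nat) (g : nat -> F) : (i < n)%N ->
  \sum_(j < n) (val j == i)%:R * g j = g i.
Proof.
move=> iN; rewrite (bigD1 (Ordinal iN)) //= eqxx mul1r big1 ?addr0 // => j.
by rewrite -val_eqE /= => /negPf ->; rewrite mul0r.
Qed.

(* As for the Hilbert transform, this identity turns an l_p bound of [hilop] into an
   l_2p bound. *)
Lemma hilop_sqr n y i : (i < n)%N ->
  hilop n y i ^+ 2 = hilC n (fun j => y j ^+ 2) i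
    + 2 * hilop n (fun j => y j * hilop n y j) i + 2 * (y i * hilC n y i).
Proof.
move=> iN.
transitivity (\sum_(j < n) \sum_(k < n) (hil i j * hil i k) * (y j * y k)).
  rewrite sqr_sum; apply: eq_bigr => j _; apply: eq_bigr => k _; ring.
transitivity (\sum_(j < n) \sum_(k < n) (
   ((val k == j)%:R * (hil i j ^+ 2 * (y j * y k)) +
    hil i j * (y j * (hil j k * y k))) +
    hil i k * (y k * (hil k j * y j)) +
    ((val k == i)%:R * (hil i j ^+ 2 * (y j * y k)) +
    (val j == i)%:R * (hil i k ^+ 2 * (y j * y k))))).
  apply: eq_bigr => j _; apply: eq_bigr => k _; rewrite hil_mul3 eq_sym; ring.
have T : \sum_(j < n) \sum_(k < n) hil i j * (y j * (hil j k * y k)) =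
    hilop n (fun j => y j * hilop n y j) i.
  by rewrite /hilop; apply: eq_bigr => j _; rewrite !mulr_sumr.
have T' : \sum_(j < n) \sum_(k < n) hil i k * (y k * (hil k j * y j)) =
    hilop n (fun j => y j * hilop n y j) i by rewrite exchange_big T.
under eq_bigr do rewrite !big_split /=.
rewrite !big_split /= T T'.
have -> : \sum_(j < n) \sum_(k < n) (val k == j)%:R * (hil i j ^+ 2 * (y j * y k)) =
   hilC n (fun j => y j ^+ 2) i.
  apply: eq_bigr => j _.
  by rewrite (sum_delta (fun k => hil i j ^+ 2 * (y j * y k))).
have e1 : \sum_(j < n) \sum_(k < n) (val k == i)%:R * (hil i j ^+ 2 * (y j * y k)) =
   y i * hilC n y i.
  rewrite /hilC mulr_sumr; apply: eq_bigr => j _.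
  by rewrite (sum_delta (fun k => hil i j ^+ 2 * (y j * y k))) //; ring.
have -> : \sum_(j < n) \sum_(k < n) (val j == i)%:R * (hil i k ^+ 2 * (y j * y k)) =
   y i * hilC n y i.
  rewrite -e1 exchange_big; apply: eq_bigr => j _; apply: eq_bigr => k _.
  by rewrite [y k * _]mulrC.
by rewrite e1; ring.
Qed.

Lemma hilC_ge0 n y i : (forall j, 0 <= y j) -> 0 <= hilC n y i.
Proof. by move=> y0; apply: sumr_ge0 => j _; rewrite mulr_ge0 ?sqr_ge0. Qed.

Lemma ler_hilC n y u i : (forall j, y j <= u j) -> hilC n y i <= hilC n u i.
Proof. by move=> yu; apply: ler_sum => j _; rewrite ler_wpM2l ?sqr_ge0. Qed.

(** Cauchy-Schwarz for the weights [hil i j ^+ 2], of total mass at most 4. *)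
Lemma hilC_sqr n y i : hilC n y i ^+ 2 <= 4 * hilC n (fun j => y j ^+ 2) i.
Proof.
rewrite sqr_sum.
apply: (@le_trans _ _ (\sum_(j < n) \sum_(k < n)
   (1/2 * (hil i j ^+ 2 * y j ^+ 2 * hil i k ^+ 2) +
    1/2 * (hil i k ^+ 2 * y k ^+ 2 * hil i j ^+ 2)))).
  apply: ler_sum => j _; apply: ler_sum => k _.
  have := mulr_ge0 (mulr_ge0 (sqr_ge0 (hil i j)) (sqr_ge0 (hil i k))) (sqr_ge0 (y j - y k)).
  by move: (hil i j ^+ 2) (hil i k ^+ 2) => p q; nra.
under eq_bigr do rewrite big_split /=.
rewrite big_split /= [X in _ + X]exchange_big /=.
under eq_bigr do rewrite -mulr_sumr -mulr_sumr.
rewrite -mulr_sumr -mulr_suml -/(hilC n (fun j => y j ^+ 2) i).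
have := ler_wpM2l (hilC_ge0 n i (fun j => sqr_ge0 (y j))) (sum_hilsqr i n).
lra.
Qed.

(** Repeated Cauchy-Schwarz gives a pointwise bound by [hilC] of the powers; in the sum over i the
    order is exchanged and each column again has mass at most 4. *)
Lemma hilC_expr r : exists2 c : F, 0 <= c & forall n y, (forall j, 0 <= y j) ->
  \sum_(i < n) hilC n y i ^+ (2 ^ r) <= c * \sum_(i < n) y i ^+ (2 ^ r).
Proof.
suff [c c0 H] : exists2 c : F, 0 <= c & forall n y i, (forall j, 0 <= y j) ->
    hilC n y i ^+ (2 ^ r) <= c * hilC n (fun j => y j ^+ (2 ^ r)) i.
  exists (c * 4); first by lra.
  move=> n y y0; apply: (@le_trans _ _ (\sum_(i < n) c * hilC n (fun j => y j ^+ (2 ^ r)) i)).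
    by apply: ler_sum => i _; exact: H.
  rewrite -mulr_sumr -mulrA ler_wpM2l // exchange_big mulr_sumr /=.
  apply: ler_sum => j _; rewrite -mulr_suml ler_wpM2r ?exprn_ge0 //.
  exact: sum_hilsq.
elim: r => [|r [c c0 IH]]; first by exists 1 => // n y i y0; rewrite mul1r.
exists (c ^+ 2 * 4); first by have := sqr_ge0 c; lra.
move=> n y i y0; rewrite expnSr exprM.
apply: (@le_trans _ _ ((c * hilC n (fun j => y j ^+ (2 ^ r)) i) ^+ 2)).
  by rewrite lerXn2r ?nnegrE ?exprn_ge0 ?mulr_ge0 ?hilC_ge0 ?IH // => j; rewrite exprn_ge0.
rewrite exprMn -mulrA ler_wpM2l ?sqr_ge0 //.
apply: le_trans (hilC_sqr _ _ _) _; rewrite ler_wpM2l //.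
by apply: ler_hilC => j; rewrite -exprM.
Qed.

Lemma exprD_le p (a b : F) : 0 <= a -> 0 <= b ->
  (a + b) ^+ p <= 2 ^+ p * (a ^+ p + b ^+ p).
Proof.
wlog ab : a b / a <= b => [hw a0 b0|a0 b0].
  have [h|/ltW h] := lerP a b; first exact: hw.
  by rewrite addrC [_ ^+ p + _]addrC hw.
apply: (@le_trans _ _ ((2 * b) ^+ p)).
  by rewrite lerXn2r ?nnegrE; lra.
rewrite exprMn ler_wpM2l ?exprn_ge0 //; have := exprn_ge0 p a0; lra.
Qed.

(** The exponent is doubled at each step: [hilop_sqr] expresses the square of Hy through H(y Hy), to
    which the previous exponent applies. Powers of two suffice later, where any exponent at least p
    will do. *)
Lemma hilop_lp r : exists2 A : F, 0 <= A & forall n y,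
  \sum_(i < n) `|hilop n y i| ^+ (2 ^ r.+1) <= A * \sum_(i < n) `|y i| ^+ (2 ^ r.+1).
Proof.
elim: r => [|r [A A0 IH]].
  exists 13 => // n y; rewrite expn1.
  under eq_bigr do rewrite -normrX ger0_norm ?sqr_ge0 //.
  under [in leRHS]eq_bigr do rewrite -normrX ger0_norm ?sqr_ge0 //.
  exact: hilop_l2.
have [c c0 HC] := hilC_expr r.+1.
have [c1 c10 HC1] := hilC_expr r.+2.
rewrite expnSr in HC1; set p := (2 ^ r.+1)%N in IH HC HC1 *.
pose D : F := 4 ^+ p * 2 ^+ p.
have D0 : 0 <= D by rewrite mulr_ge0 ?exprn_ge0.
exists (2 * (D * c) + D * (1 + c1) + (D * A) ^+ 2).
  have := mulr_ge0 D0 c0; have := mulr_ge0 D0 c10; have := sqr_ge0 (D * A); lra.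
move=> n y; rewrite expnSr -/p.
pose X := \sum_(i < n) `|hilop n y i| ^+ (p * 2).
pose Y := \sum_(i < n) `|y i| ^+ (p * 2).
pose v j := `|y j|.
have v0 j : 0 <= v j by exact: normr_ge0.
have C_abs i u : `|hilC n u i| <= hilC n (fun j => `|u j|) i.
  apply: le_trans (ler_norm_sum _ _ _) _; apply: ler_sum => j _.
  by rewrite normrM ger0_norm ?sqr_ge0.
pose a i := hilC n (fun j => v j ^+ 2) i.
pose b i := `|hilop n (fun j => y j * hilop n y j) i|.
pose d i := v i * hilC n v i.
have a0 i : 0 <= a i by apply: hilC_ge0 => j; rewrite sqr_ge0.
have b0 i : 0 <= b i by exact: normr_ge0.
have d0 i : 0 <= d i by rewrite mulr_ge0 ?hilC_ge0.
have step i : (i < n)%N -> `|hilop n y i| ^+ (p * 2) <=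
    D * (a i ^+ p + b i ^+ p + d i ^+ p).
  move=> iN; rewrite mulnC exprM -normrX (hilop_sqr _ iN).
  apply: (@le_trans _ _ ((2 * (a i + b i + d i)) ^+ p)).
    rewrite lerXn2r ?nnegrE ?normr_ge0 //.
      by have := a0 i; have := b0 i; have := d0 i; lra.
    apply: le_trans (ler_normD _ _) _.
    apply: (@le_trans _ _ (a i + 2 * b i + 2 * d i)); last by have := a0 i; lra.
    apply: lerD.
      apply: le_trans (ler_normD _ _) _; rewrite normrM [`|2|]ger0_norm // lerD //.
      apply: le_trans (C_abs _ _) _; apply: ler_hilC => j.
      by rewrite normrX.
    by rewrite normrM [`|2|]ger0_norm // ler_wpM2l // normrM ler_wpM2l // C_abs.
  have S0 : 0 <= (a i + b i) ^+ p by rewrite exprn_ge0 // addr_ge0.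
  have h1 := exprD_le p (addr_ge0 (a0 i) (b0 i)) (d0 i).
  have h2 := exprD_le p (a0 i) (b0 i).
  have e4 : 2 ^+ p * 2 ^+ p = 4 ^+ p :> F by rewrite -exprMn; congr (_ ^+ _); lra.
  have k1 : 1 <= 2 ^+ p :> F by rewrite exprn_ege1 //; lra.
  have k0 : 0 <= 2 ^+ p :> F by lra.
  rewrite exprMn /D -e4; apply: le_trans (ler_wpM2l k0 h1) _.
  rewrite [leRHS](_ : _ = 2 ^+ p * (2 ^+ p * (2 ^+ p * (a i ^+ p + b i ^+ p + d i ^+ p)))); last ring.
  rewrite ler_wpM2l // ler_wpM2l // mulrDr lerD //.
  by rewrite ler_peMl // exprn_ge0.
have XY : X <= D * (\sum_(i < n) a i ^+ p + \sum_(i < n) b i ^+ p + \sum_(i < n) d i ^+ p).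
  rewrite -!big_split /= mulr_sumr; apply: ler_sum => i _; exact: step.
have Ya : \sum_(i < n) a i ^+ p <= c * Y.
  apply: le_trans (HC _ _ _) _ => [j|]; first exact: sqr_ge0.
  rewrite ler_wpM2l //; apply: ler_sum => i _.
  by rewrite /v -!exprM mulnC.
have bE : \sum_(i < n) b i ^+ p <= A * \sum_(i < n) (`|y i| ^+ p * `|hilop n y i| ^+ p).
  apply: le_trans (IH _ _) _; rewrite ler_wpM2l //; apply: ler_sum => i _.
  by rewrite normrM exprMn.
(* The inequality 2 s t <= s^2 + t^2 is weighted so that only half of X reappears on the right,
   where the final [lra] absorbs it. *)
have bY : D * A * \sum_(i < n) (`|y i| ^+ p * `|hilop n y i| ^+ p) <=
    1/2 * X + 1/2 * (D * A) ^+ 2 * Y.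
  rewrite /X /Y !mulr_sumr -big_split /=; apply: ler_sum => i _.
  rewrite ![_ ^+ (p * 2)]exprM.
  move: (`|y i| ^+ p) (`|hilop n y i| ^+ p) (D * A) => s t w.
  have := sqr_ge0 (t - w * s); nra.
have dY : \sum_(i < n) d i ^+ p <= 1/2 * (1 + c1) * Y.
  apply: (@le_trans _ _ (1/2 * Y + 1/2 * \sum_(i < n) hilC n v i ^+ (p * 2))).
    rewrite /Y !mulr_sumr -big_split /=; apply: ler_sum => i _.
    rewrite ![_ ^+ (p * 2)]exprM /d exprMn /v.
    move: (`|y i| ^+ p) (hilC n _ i ^+ p) => s t.
    by have := sqr_ge0 (s - t); nra.
  have : \sum_(i < n) hilC n v i ^+ (p * 2) <= c1 * Y by apply: HC1.
  lra.
have Y0 : 0 <= Y by apply: sumr_ge0 => i _; rewrite exprn_ge0.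
have DA0 : 0 <= D * A by rewrite mulr_ge0.
have := ler_wpM2l D0 Ya; have := ler_wpM2l D0 dY; have := ler_wpM2l D0 bE.
rewrite -/X -/Y; lra.
Qed.

Lemma harmonic_ge L m : (2 ^ L <= m)%N -> L%:R / 2 <= \sum_(d < m) d.+1%:R^-1 :> F.
Proof.
elim: L m => [|L IH] m Lm; first by rewrite mul0r sumr_ge0 // => i _; rewrite invr_ge0.
have e : (m = 2 ^ L + (m - 2 ^ L))%N by rewrite subnKC // (leq_trans _ Lm) // leq_exp2l.
have L2 : (2 ^ L <= m - 2 ^ L)%N.
  rewrite leq_subRL -?addnn -?e ?addnn -?mul2n -?expnS // (leq_trans _ Lm) //.
  by rewrite leq_exp2l.
move: (m - 2 ^ L)%N L2 e => m' L2 ->.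
rewrite big_split_ord /= -addn1 natrD mulrDl lerD ?IH //.
move: (subnKC L2); move: (m' - _)%N => m'' <-.
rewrite big_split_ord /=; apply: ler_wpDr; first by apply: sumr_ge0 => i _; rewrite invr_ge0.
apply: (@le_trans _ _ (\sum_(i < 2 ^ L) (2 ^ L.+1)%:R^-1)).
  rewrite sumr_const card_ord -mulr_natl expnSr natrM le_eqVlt; apply/orP; left.
  by apply/eqP; field; rewrite pnatr_eq0 -lt0n expn_gt0.
apply: ler_sum => i _; rewrite lef_pV2 ?posrE ?ltr0n ?expn_gt0 // ler_nat.
by rewrite expnS mul2n -addnn -addnS leq_add2l.
Qed.

(** The truncated row sum is a harmonic number, at least L/2 for each i in the upper half of the
    range; the lower half is dropped. *)
Lemma hil_triangle q L :
  (2 ^ L)%:R * (L%:R / 2) ^+ q <=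
  \sum_(i < 2 ^ L.+1) (\sum_(j < i) hil i j) ^+ q.
Proof.
have E i : \sum_(j < i) hil i j = \sum_(d < i) d.+1%:R^-1.
  rewrite (reindex_inj rev_ord_inj) /=; apply: eq_bigr => d _.
  by rewrite /hil natrB // opprB addrC subrK.
under eq_bigr do rewrite E.
rewrite expnS mul2n -addnn big_split_ord /= ler_wpDl ?sumr_ge0 //.
  by move=> i _; rewrite exprn_ge0 // sumr_ge0 // => d _; rewrite invr_ge0.
apply: (@le_trans _ _ (\sum_(i < 2 ^ L) (L%:R / 2) ^+ q)).
  by rewrite sumr_const card_ord mulr_natl.
apply: ler_sum => i _; rewrite lerXn2r ?nnegrE ?divr_ge0 //.
  by rewrite sumr_ge0 // => d _; rewrite invr_ge0.
by apply: harmonic_ge; rewrite leq_addr.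
Qed.

End Hilbert.

(** * Real and complex scalars, real-valued norms *)

Section scalars_theory.
Variables (R : realType) (k : scalar_kind).
Local Notation K := (scalars R k).

Definition ofR : R -> K :=
  match k return R -> scalars R k with
  | RealScalars => fun x => x | ComplexScalars => fun x => (x%:C)%C end.

Definition reS : K -> R :=
  match k return scalars R k -> R with
  | RealScalars => fun x => x | ComplexScalars => fun x => complex.Re x end.

Definition imS : K -> R :=
  match k return scalars R k -> R with
  | RealScalars => fun x => 0 | ComplexScalars => fun x => complex.Im x end.

Definition conjS : K -> K :=
  match k return scalars R k -> scalars R k with
  | RealScalars => fun x => x | ComplexScalars => fun x => conjc x end.

Lemma ofR_is_zmod : zmod_morphism ofR.
Proof. by rewrite /ofR; case: k => //= x y; rewrite rmorphB. Qed.
HB.instance Definition _ := GRing.isZmodMorphism.Build R K ofR ofR_is_zmod.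
Lemma ofR_is_monoid : monoid_morphism ofR.
Proof. by rewrite /ofR; case: k => //=; split=> // x y; rewrite rmorphM. Qed.
HB.instance Definition _ := GRing.isMonoidMorphism.Build R K ofR ofR_is_monoid.

Lemma ofRD x y : ofR (x + y) = ofR x + ofR y. Proof. exact: raddfD. Qed.
Lemma ofRM x y : ofR (x * y) = ofR x * ofR y. Proof. exact: rmorphM. Qed.
Lemma ofR0 : ofR 0 = 0. Proof. exact: raddf0. Qed.
Lemma ofR1 : ofR 1 = 1. Proof. exact: rmorph1. Qed.

Lemma ler_ofR x y : (ofR x <= ofR y) = (x <= y).
Proof. by rewrite /ofR; case: k => //=; rewrite lecR. Qed.

Lemma ofRK : cancel ofR reS.
Proof. by rewrite /ofR /reS; case: k. Qed.

Lemma ltr_ofR x y : (ofR x < ofR y) = (x < y).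
Proof. by rewrite !lt_def ler_ofR (inj_eq (can_inj ofRK)). Qed.

Lemma normr_ofR x : `|ofR x| = ofR `|x|.
Proof. by rewrite /ofR; case: k => //=; rewrite normc_def /= expr0n addr0 sqrtr_sqr. Qed.

Lemma reS_is_zmod : zmod_morphism reS.
Proof. by rewrite /reS; case: k => //= -[a b] [c d]. Qed.
HB.instance Definition _ := GRing.isZmodMorphism.Build K R reS reS_is_zmod.
Lemma imS_is_zmod : zmod_morphism imS.
Proof. by rewrite /imS; case: k => //= [x y|[a b] [c d]//]; rewrite subr0. Qed.
HB.instance Definition _ := GRing.isZmodMorphism.Build K R imS imS_is_zmod.

Lemma reS_ofRM a z : reS (ofR a * z) = a * reS z.
Proof. by move: z; rewrite /ofR /reS; case: k => //= -[x y] /=; ring. Qed.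
Lemma imS_ofRM a z : imS (ofR a * z) = a * imS z.
Proof. by move: z; rewrite /ofR /imS; case: k => //= [_|[x y] /=]; ring. Qed.

Lemma ofR_reS z : z \is Num.real -> ofR (reS z) = z.
Proof. by move: z; rewrite /ofR /reS; case: k => //= z /complex_realP[x ->]. Qed.

Lemma conjSE z : reS (conjS z * z) = reS z ^+ 2 + imS z ^+ 2.
Proof. by move: z; rewrite /conjS /reS /imS; case: k => /= [z|[a b] /=]; ring. Qed.

(* Norms take their values in K, which is not totally ordered when K is R[i]; [rn] is the
   norm with values in R. *)
Definition rn (V : normedZmodType K) (v : V) : R := reS `|v|.

Lemma rnE (V : normedZmodType K) (v : V) : `|v| = ofR (rn v).
Proof. by rewrite /rn ofR_reS // normr_real. Qed.

Lemma rn_le (V W : normedZmodType K) (v : V) (w : W) :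
  (`|v| <= `|w|) = (rn v <= rn w).
Proof. by rewrite !rnE ler_ofR. Qed.

Lemma rn_ge0 (V : normedZmodType K) (v : V) : 0 <= rn v.
Proof. by rewrite -ler_ofR -rnE ofR0 normr_ge0. Qed.
#[local] Hint Resolve rn_ge0 : core.

Lemma rnD (V : normedZmodType K) (v w : V) : rn (v + w) <= rn v + rn w.
Proof. by rewrite -ler_ofR ofRD -!rnE ler_normD. Qed.

Lemma rnN (V : normedZmodType K) (v : V) : rn (- v) = rn v.
Proof. by rewrite /rn normrN. Qed.

Lemma rnB (V : normedZmodType K) (v w : V) : rn (v - w) <= rn v + rn w.
Proof. by rewrite -(rnN w) rnD. Qed.

Lemma rn0 (V : normedZmodType K) : rn (0 : V) = 0.
Proof. by rewrite /rn normr0 raddf0. Qed.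

Lemma rn_sum (V : normedZmodType K) I (r : seq I) (P : pred I) (f : I -> V) :
  rn (\sum_(i <- r | P i) f i) <= \sum_(i <- r | P i) rn (f i).
Proof.
elim/big_ind2: _ => [|x a y b xa yb|//]; first by rewrite rn0.
by apply: le_trans (rnD _ _) _; exact: lerD.
Qed.

Lemma rnZ (V : normedModType K) (a : K) (v : V) : rn (a *: v) = rn a * rn v.
Proof. by apply: (can_inj ofRK); rewrite ofRM -!rnE normrZ. Qed.

Lemma rnM (a b : K) : rn (a * b) = rn a * rn b.
Proof. by apply: (can_inj ofRK); rewrite ofRM -!rnE normrM. Qed.

Lemma rn1 : rn (1 : K) = 1.
Proof. by apply: (can_inj ofRK); rewrite -rnE normr1 ofR1. Qed.

Lemma rn_prod I (r : seq I) (P : pred I) (f : I -> K) :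
  rn (\prod_(i <- r | P i) f i) = \prod_(i <- r | P i) rn (f i).
Proof. by elim/big_ind2: _ => [|x a y b <- <-|//]; rewrite ?rn1 ?rnM. Qed.

Lemma rn_ofR a : rn (ofR a) = `|a|.
Proof. by rewrite /rn normr_ofR ofRK. Qed.

Lemma rn_real (a : K) : 0 <= a -> a = ofR (rn a).
Proof. by move=> a0; rewrite -rnE ger0_norm. Qed.

Lemma rn_sqr (z : K) : rn z ^+ 2 = reS z ^+ 2 + imS z ^+ 2.
Proof.
apply: (can_inj ofRK); rewrite rmorphXn /= -rnE; move: z.
rewrite /ofR /reS /imS; case: k => /= z; first by rewrite real_normK ?num_real // expr0n addr0.
by rewrite normc_def -rmorphXn /= sqr_sqrtr // addr_ge0 ?sqr_ge0.
Qed.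

Lemma rn_conjS z : rn (conjS z) = rn z.
Proof.
apply/eqP; rewrite -(@eqrXn2 _ 2) // !rn_sqr; apply/eqP; move: z.
by rewrite /conjS /reS /imS; case: k => //= -[a b] /=; rewrite sqrrN.
Qed.

Lemma reS_le_rn z : reS z <= rn z.
Proof.
have := rn_sqr z; have := rn_ge0 z; have := sqr_ge0 (imS z); nra.
Qed.

Lemma normr_reS z : `|reS z| <= rn z.
Proof. by rewrite ler_norml reS_le_rn andbT lerNl -raddfN -(rnN z) reS_le_rn. Qed.

Lemma normr_imS z : `|imS z| <= rn z.
Proof.
rewrite ler_norml; have := rn_sqr z; have := rn_ge0 z; have := sqr_ge0 (reS z).
by move=> *; apply/andP; split; nra.
Qed.

Lemma rn_le_reim z : rn z <= `|reS z| + `|imS z|.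
Proof.
have := rn_sqr z; have := rn_ge0 z.
rewrite -(real_normK (num_real (reS z))) -(real_normK (num_real (imS z))).
have := normr_ge0 (reS z); have := normr_ge0 (imS z); nra.
Qed.

Lemma rn0_eq0 (V : normedModType K) (v : V) : rn v = 0 -> v = 0.
Proof. by move=> v0; apply/eqP; rewrite -normr_eq0 rnE v0 ofR0. Qed.

(** A sign change reduces this to suprema of bounded sets of real elements, whose existence holds
    although the order of R[i] is partial. *)
Lemma infimumP (A : set K) : A !=set0 -> (forall x, A x -> 0 <= x) ->
  infimums A (infimum 0 A).
Proof.
move=> A0 Age; rewrite /infimum ifF; last by apply/negP => /eqP; exact/eqP/set0P.
have [s [sub ssup]] : supremums [set - x | x in A] !=set0.
  apply: scalars_supremums; first by have [x Ax] := A0; exists (- x), x.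
  - by move=> _ [x Ax <-]; rewrite rpredN ger0_real // Age.
  - by exists 0 => _ [x Ax <-]; rewrite oppr_le0 Age.
case: xgetP => // /(_ (- s)) []; split.
  by move=> x Ax; rewrite lerNl; apply: sub; exists x.
by move=> y yA; rewrite lerNr; apply: ssup => _ [x Ax <-]; rewrite lerN2 yA.
Qed.

End scalars_theory.
#[export] Hint Resolve rn_ge0 : core.

(** * Multilinear maps on tuples *)

Section multilinear_maps.
Variables (K : pzRingType) (X V : lmodType K) (M : nat).

(** The condition [multilinear] for an arbitrary left module as source, so that it also applies to
    maps on the module of all scalar sequences. *)
Definition mlin (th : ('I_M -> X) -> V) : Prop :=
  forall (i : 'I_M) (x : 'I_M -> X) (a : K) (u v : X),
    th (dfwith x i (a *: u + v)) = a *: th (dfwith x i u) + th (dfwith x i v).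

Variable th : ('I_M -> X) -> V.
Hypothesis thl : mlin th.

Lemma mlinD i x (u v : X) :
  th (dfwith x i (u + v)) = th (dfwith x i u) + th (dfwith x i v).
Proof. by rewrite -[u in LHS]scale1r thl scale1r. Qed.

Lemma mlin0 i x : th (dfwith x i (0 : X)) = 0.
Proof. by apply: (@addrI _ (th (dfwith x i (0 : X)))); rewrite -mlinD !addr0. Qed.

Lemma mlinZ i x a (u : X) : th (dfwith x i (a *: u)) = a *: th (dfwith x i u).
Proof. by rewrite -[a *: u]addr0 thl mlin0 addr0. Qed.

Lemma mlinN i x (u : X) : th (dfwith x i (- u)) = - th (dfwith x i u).
Proof. by rewrite -scaleN1r mlinZ scaleN1r. Qed.

Lemma mlin_sum i x I (r : seq I) (P : pred I) (a : I -> K) (u : I -> X) :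
  th (dfwith x i (\sum_(j <- r | P j) a j *: u j)) =
  \sum_(j <- r | P j) a j *: th (dfwith x i (u j)).
Proof.
elim: r => [|j r IH]; first by rewrite !big_nil mlin0.
by rewrite !big_cons; case: ifP => // _; rewrite mlinD mlinZ IH.
Qed.

Lemma mlin_sum1 i x I (r : seq I) (P : pred I) (u : I -> X) :
  th (dfwith x i (\sum_(j <- r | P j) u j)) =
  \sum_(j <- r | P j) th (dfwith x i (u j)).
Proof.
elim: r => [|j r IH]; first by rewrite !big_nil mlin0.
by rewrite !big_cons; case: ifP => // _; rewrite mlinD IH.
Qed.

Lemma dfwith_self (x : 'I_M -> X) i : dfwith x i (x i) = x.
Proof. by apply/funext => j; case: dfwithP. Qed.

(** The slots are changed one at a time: in the s-th term those before s are already new and those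
    after s still old. *)
Lemma mlin_telescope (x y : 'I_M -> X) :
  th (fun t => x t + y t) - th x = \sum_(s < M)
    th (dfwith (fun t : 'I_M => if (t < s)%N then x t + y t else x t) s (y s)).
Proof.
pose h s := th (fun t : 'I_M => if (t < s)%N then x t + y t else x t).
have -> : th (fun t => x t + y t) = h M.
  by congr th; apply/funext => t; rewrite ltn_ord.
have -> : th x = h 0%N by [].
rewrite -(telescope_sumr h (leq0n M)) big_mkord; apply: eq_bigr => s _.
apply/eqP; rewrite subr_eq addrC; apply/eqP.
pose hs := fun t : 'I_M => if (t < s)%N then x t + y t else x t.
have -> : h s = th (dfwith hs s (x s)).
  by congr th; rewrite -[LHS](dfwith_self hs s) /hs ltnn.
rewrite -mlinD; congr th; apply/funext => t; case: dfwithP => [|j].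
  by rewrite ltnSn.
by rewrite /hs ltnS eq_sym leq_eqVlt -val_eqE /= => /negPf ->.
Qed.

End multilinear_maps.

(** * Choice of signs and triangular sums of elementary tensors *)

Section triangular_sums.
Variables (R : realType) (k : scalar_kind).
Local Notation K := (scalars R k).
Local Notation vec := (nat -> K^o).
Implicit Types (a w W : vec).

Definition bnd1 a := forall j, rn (a j : K) <= 1.

Definition cutv (m : nat) a : vec := fun j => if (j < m)%N then a j else 0.

Lemma bnd1_cutv m a : bnd1 a -> bnd1 (cutv m a).
Proof. by move=> a1 j; rewrite /cutv; case: ifP => // _; rewrite rn0. Qed.

Definition disjoint_family (q : nat) (w : nat -> vec) :=
  forall x i j, (i < q)%N -> (j < q)%N -> w i x != 0 -> w j x != 0 -> i = j.

Lemma sum_vecE I (r : seq I) (P : pred I) (f : I -> vec) x :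
  (\sum_(i <- r | P i) f i) x = \sum_(i <- r | P i) f i x.
Proof. by elim/big_rec2: _ => // i y1 y2 _ <-. Qed.

Lemma bnd1_disjoint_sum q (w : nat -> vec) (c : nat -> K) :
  disjoint_family q w -> (forall i, (i < q)%N -> bnd1 (w i)) ->
  (forall i, (i < q)%N -> rn (c i) <= 1) -> bnd1 (\sum_(i < q) c i *: w i).
Proof.
move=> dw w1 c1 x; rewrite sum_vecE.
have [[i wi0]|h] := pselect (exists i : 'I_q, w i x != 0).
  rewrite (bigD1 i) //= big1 ?addr0 => [|j ji].
    have := rnM (c i) (w i x); rewrite -[_ * _]/((c i *: w i) x) => ->.
    by rewrite mulr_ile1 ?rn_ge0 //; [exact: c1|exact: w1].
  have [wj|wj] := eqVneq (w j x) 0.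
    by rewrite -[LHS]/(c j * w j x) wj mulr0.
  by move: ji; rewrite -val_eqE /= (dw x j i) ?eqxx.
rewrite big1 ?rn0 // => i _; have [wi|wi] := eqVneq (w i x) 0.
  by rewrite -[LHS]/(c i * w i x) wi mulr0.
by exfalso; apply: h; exists i.
Qed.

Section signs.
Variable V : normedModType K.

Lemma rn_double (x y : V) : exists2 s : K, s = 1 \/ s = -1 & rn x <= rn (x + s *: y).
Proof.
have [h|h] := lerP (rn x) (rn (x + y)).
  by exists 1; [left|rewrite scale1r].
exists (-1); first by right.
rewrite scaleN1r; have : rn (x *+ 2) <= rn (x + y) + rn (x - y).
  by apply: le_trans (rnD _ _); rewrite addrACA subrr addr0 mulr2n.
rewrite -scaler_nat rnZ.
have -> : rn (2 : K) = 2 by rewrite -[2](rmorph_nat (@ofR R k)) rn_ofR ger0_norm.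
lra.
Qed.

(** Averaging over random signs would kill the off-diagonal terms, so some choice loses nothing.
    Here the signs are fixed one at a time with [rn_double]; the offset [v] carries the diagonal
    terms, on which signs have no effect because their squares are 1. *)
Lemma sign_select_shift (q : nat) (G : nat -> nat -> V) (v : V) : exists2 s : nat -> K,
  (forall j, s j = 1 \/ s j = -1) &
  rn (v + \sum_(j < q) G j j) <=
  rn (v + \sum_(i < q) \sum_(j < q) (s i * s j) *: G i j).
Proof.
elim: q v => [|q IH] v.
  by exists (fun=> 1); [left|rewrite !big_ord0].
have [s s1 sP] := IH (v + G q q).
pose X := v + G q q + \sum_(i < q) \sum_(j < q) (s i * s j) *: G i j.
pose Y := \sum_(i < q) s i *: (G i q + G q i).
have [e e1 eP] := rn_double X Y.
pose s' j := if j == q then e else s j.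
have s'E (i : 'I_q) : s' i = s i by rewrite /s' ltn_eqF.
have s'q : s' q = e by rewrite /s' eqxx.
exists s'; first by move=> j; rewrite /s'; case: ifP.
rewrite big_ord_recr /= [_ + G q q]addrC addrA.
apply: le_trans sP _; apply: le_trans eP _; rewrite le_eqVlt; apply/orP; left.
apply/eqP; congr rn; rewrite /X -!addrA; congr (_ + _).
rewrite [in RHS]big_ord_recr /=.
under [X in _ = X + _]eq_bigr do rewrite big_ord_recr /= s'q s'E.
rewrite big_split /= big_ord_recr /= s'q.
have -> : e * e = 1 by case: e1 => ->; rewrite ?mulr1 ?mulrNN ?mulr1.
rewrite scale1r addrC -!addrA; congr (_ + _).
  by apply: eq_bigr => i _; apply: eq_bigr => j _; rewrite !s'E.
rewrite addrA; congr (_ + _); rewrite /Y scaler_sumr -big_split /=.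
apply: eq_bigr => i _; rewrite s'E scalerA scalerDr.
by rewrite [s i * e]mulrC.
Qed.

Lemma sign_select (q : nat) (G : nat -> nat -> V) : exists2 s : nat -> K,
  (forall j, s j = 1 \/ s j = -1) &
  rn (\sum_(j < q) G j j) <= rn (\sum_(i < q) \sum_(j < q) (s i * s j) *: G i j).
Proof.
have [s s1] := sign_select_shift q G 0; rewrite !add0r.
by exists s.
Qed.

End signs.

End triangular_sums.

Section triangular_bound.
Variables (R : realType) (k : scalar_kind).
Local Notation K := (scalars R k).
Local Notation vec := (nat -> K^o).
Variables (V : normedModType K) (M : nat) (th : ('I_M -> vec) -> V) (beta : R).
Hypotheses (thl : mlin th)
  (thb : forall a, (forall t, bnd1 (a t)) -> rn (th a) <= beta).
Implicit Types (a w W : vec) (u : nat -> 'I_M -> vec).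

Lemma rn_sign (s : K) : s = 1 \/ s = -1 -> rn s = 1.
Proof. by case=> ->; rewrite ?rnN rn1. Qed.

(* Random signs: for a suitable choice of signs s, replacing every w_j by sum_j s_j w_j, which
   no longer depends on the summand, does not decrease the norm. *)
Lemma slot_freeze n u t q (w : nat -> vec) (kap : nat -> nat) (c : nat -> K) :
  disjoint_family q w -> (forall i, (i < q)%N -> bnd1 (w i)) ->
  (forall i, (i < n)%N -> (kap i < q)%N) ->
  exists W (c' : nat -> K), [/\ bnd1 W, forall i, rn (c' i) = rn (c i) &
   rn (\sum_(i < n) c i *: th (dfwith (u i) t (w (kap i)))) <=
   rn (\sum_(i < n) c' i *: th (dfwith (u i) t W))].
Proof.
move=> dw w1 kq.
(* The summands of class j with w_j' put into the slot: the diagonal is the given sum, and the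
   signed double sum is the sum with the slot frozen. *)
pose G j j' := \sum_(i < n | kap i == j) c i *: th (dfwith (u i) t (w j')).
have [s s1 sP] := sign_select q G.
exists (\sum_(j < q) s j *: w j), (fun i => c i * s (kap i)); split.
- by apply: bnd1_disjoint_sum => // i iq; rewrite rn_sign.
- by move=> i; rewrite rnM (rn_sign (s1 _)) mulr1.
have part (f : 'I_n -> V) : \sum_(j < q) \sum_(i < n | kap i == j) f i = \sum_(i < n) f i.
  have kb (i : 'I_n) : (kap i < q)%N by exact: kq.
  rewrite [RHS](partition_big (fun i : 'I_n => Ordinal (kb i)) xpredT) //=.
have E1 : \sum_(j < q) G j j = \sum_(i < n) c i *: th (dfwith (u i) t (w (kap i))).
  by rewrite -part; apply: eq_bigr => j _; apply: eq_bigr => i /eqP ->.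
rewrite -E1; apply: le_trans sP _; rewrite le_eqVlt; apply/orP; left.
apply/eqP; congr rn; rewrite -[RHS]part; apply: eq_bigr => j _.
under eq_bigr do rewrite /G scaler_sumr.
rewrite exchange_big; apply: eq_bigr => i /eqP kj /=.
rewrite (mlin_sum thl) scaler_sumr; apply: eq_bigr => j' _.
by rewrite !scalerA kj; congr (_ *: _); ring.
Qed.

(** Each v_i is a sum of T pieces, the l-th one picked from a disjoint family in the unit ball. This
    is the shape to which [slot_freeze] applies, T being the price of freezing one slot. *)
Definition decomposable n T (v : nat -> vec) :=
  exists (w : nat -> nat -> vec) (kap : nat -> nat -> nat) (q : nat),
  [/\ forall l, disjoint_family q (w l), forall l i, (i < q)%N -> bnd1 (w l i),
      forall l i, (i < n)%N -> (kap l i < q)%N &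
      forall i, (i < n)%N -> v i = \sum_(l < T) w l (kap l i)].

(** Each slot in S is split into its T pieces and frozen piece by piece, at the cost of a factor T.
    Once only [t0] depends on i, multilinearity moves the whole sum into that slot, where
    disjointness keeps it in the unit ball; hence no factor n. *)
Lemma triangular_sum n T (S : seq 'I_M) (t0 : 'I_M) u (c : nat -> K) :
  uniq S -> t0 \notin S -> (forall i, (i < n)%N -> rn (c i) <= 1) ->
  (forall i t, (i < n)%N -> bnd1 (u i t)) ->
  (forall t i j, t != t0 -> t \notin S -> (i < n)%N -> (j < n)%N -> u i t = u j t) ->
  disjoint_family n (fun i => u i t0) ->
  (forall t, t \in S -> decomposable n T (fun i => u i t)) ->
  rn (\sum_(i < n) c i *: th (u i)) <= beta * T%:R ^+ size S.
Proof.
have b0 : 0 <= beta.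
  by apply: le_trans (thb (a := fun _ _ => 0) _); rewrite ?rn_ge0 // => t j; rewrite rn0.
elim: S u c => [|t S IH] u c uniqS t0S c1 u1 uc ud uS.
  have [->|n0] := posnP n; first by rewrite big_ord0 rn0 mulr1.
  rewrite mulr1 [X in rn X](_ : _ = th (dfwith (u 0%N) t0 (\sum_(i < n) c i *: u i t0))).
    apply: thb => t; case: dfwithP => [|j _]; last exact: u1.
    by apply: (@bnd1_disjoint_sum _ _ n (fun i => u i t0)) => // i iN; apply: u1.
  rewrite (mlin_sum thl); apply: eq_bigr => i _; congr (_ *: th _).
  apply/funext => t; case: dfwithP => // j j0; apply: uc => //.
  by rewrite eq_sym.
move: t0S uniqS; rewrite inE negb_or => /andP[t0t t0S] /= /andP[tS uniqS].
have [w [kap [q [dw w1 kq uE]]]] := uS t (mem_head _ _).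
have -> : \sum_(i < n) c i *: th (u i) =
    \sum_(l < T) \sum_(i < n) c i *: th (dfwith (u i) t (w l (kap l i))).
  rewrite exchange_big; apply: eq_bigr => i _ /=; rewrite -scaler_sumr.
  by congr (_ *: _); rewrite -{1}(dfwith_self (u i) t) uE // (mlin_sum1 thl).
apply: le_trans (rn_sum _ _ _) _.
have -> : beta * T%:R ^+ (size (t :: S)) = \sum_(l < T) beta * T%:R ^+ size S.
  by rewrite sumr_const card_ord -[RHS]mulr_natl /= exprS [LHS]mulrCA.
apply: ler_sum => l _.
have [W [c' [W1 c'1 le1]]] := @slot_freeze n u t q (w l) (kap l) c (dw l) (w1 l) (kq l).
apply: le_trans le1 _; apply: (IH (fun i => dfwith (u i) t W) c') => //.
- by move=> i iN; rewrite c'1 c1.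
- by move=> i t' iN; case: dfwithP => // j _; apply: u1.
- move=> t' i j t't0 t'S iN jN; case: (eqVneq t t') => [<-|tt']; first by rewrite !dfwithin.
  by rewrite !dfwithout //; apply: uc; rewrite // inE negb_or eq_sym tt'.
- have E i : dfwith (u i) t W t0 = u i t0 by rewrite dfwithout // eq_sym.
  by move=> x i j iN jN; rewrite !E; exact: ud.
- move=> t' t'S; have tt' : t != t' by apply: contraNneq tS => ->.
  rewrite [X in decomposable _ _ X](_ : _ = fun i => u i t').
    by apply: uS; rewrite inE t'S orbT.
  by apply/funext => i; rewrite dfwithout.
Qed.

Lemma disjoint_family0 q : disjoint_family q (fun _ => (0 : vec)).
Proof. by move=> x i j _ _; rewrite eqxx. Qed.

Lemma bnd1_0 : @bnd1 R k (0 : vec).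
Proof. by move=> x; rewrite rn0. Qed.

Lemma decomposableD n T v d : decomposable n T v ->
  disjoint_family n d -> (forall i, (i < n)%N -> bnd1 (d i)) ->
  decomposable n T.+1 (fun i => v i + d i).
Proof.
move=> [w [kap [q [dw w1 kq vE]]]] dd d1.
pose d' i : vec := if (i < n)%N then d i else 0.
exists (fun l i => if (l < T)%N then (if (i < q)%N then w l i else 0) else d' i),
  (fun l i => if (l < T)%N then kap l i else i), (maxn q n); split.
- move=> l x i j _ _; case: ifP => _.
    by case: ifP => iq; case: ifP => jq; rewrite ?eqxx //; exact: dw.
  by rewrite /d'; case: ifP => iN; case: ifP => jN; rewrite ?eqxx //; exact: dd.
- move=> l i _; case: ifP => _; [case: ifP => iq|rewrite /d'; case: ifP => iN].
  + exact: w1.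
  + exact: bnd1_0.
  + exact: d1.
  + exact: bnd1_0.
- by move=> l i iN; case: ifP => _; rewrite leq_max ?kq // iN orbT.
- move=> i iN; rewrite big_ord_recr /= ltnn /d' iN vE //; congr (_ + _).
  by apply: eq_bigr => l _; rewrite ltn_ord kq.
Qed.

Lemma decomposableS n T v : decomposable n T v -> decomposable n T.+1 v.
Proof.
move=> h; rewrite [v](_ : _ = fun i => v i + (0 : vec)).
  apply: decomposableD => //; first exact: disjoint_family0.
  by move=> i _; exact: bnd1_0.
by apply/funext => i; rewrite addr0.
Qed.

Lemma cutvB_neq0 m m' a x : cutv m a x - cutv m' a x != 0 ->
  ((m' <= x) && (x < m) || (m <= x) && (x < m'))%N.
Proof.
rewrite /cutv; have [h|h] := ltnP x m; have [h'|h'] := ltnP x m';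
  by rewrite ?subrr ?eqxx.
Qed.

Lemma bnd1_cutvB m m' a : bnd1 a -> bnd1 (cutv m a - cutv m' a : vec).
Proof.
move=> a1 x; rewrite -[X in rn X]/(cutv m a x - cutv m' a x) /cutv.
case: ifP; case: ifP; rewrite ?subrr ?subr0 ?sub0r ?rnN ?rn0 // => _ _; exact: a1.
Qed.

(* Dyadic telescoping: the l-th piece compares the cuts at i with its last l, respectively
   l + 1, binary digits erased. *)
Lemma decomposable_cutv L (lo : nat -> nat) a :
  {homo lo : i j / (i <= j)%N} -> bnd1 a ->
  decomposable (2 ^ L) L.+1 (fun i => cutv (lo i) a).
Proof.
move=> lom a1.
exists (fun l q => if (l < L)%N then
    cutv (lo (q * 2 ^ l)%N) a - cutv (lo (q %/ 2 * 2 ^ l.+1)%N) a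
    else if q == 0%N then cutv (lo 0%N) a else 0),
  (fun l i => if (l < L)%N then (i %/ 2 ^ l)%N else 0%N), (2 ^ L)%N; split.
- move=> l x i j _ _; case: ifP => _; last first.
    by case: (i =P 0%N) => [->|_]; case: (j =P 0%N) => [->|_]; rewrite ?eqxx.
  rewrite -![(_ - _) x]/(cutv _ a x - cutv _ a x) => /cutvB_neq0 hi /cutvB_neq0 hj.
  have bnd q : (q %/ 2 * 2 ^ l.+1 <= q * 2 ^ l)%N.
    by rewrite expnS mulnA leq_mul2r leq_trunc_div orbT.
  (* For even q the piece is 0, since then q %/ 2 * 2 = q; for odd q it is supported between the
     cuts at q - 1 and q, and such intervals do not meet. *)
  have key q : ((lo (q %/ 2 * 2 ^ l.+1) <= x) && (x < lo (q * 2 ^ l)) ||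
      (lo (q * 2 ^ l) <= x) && (x < lo (q %/ 2 * 2 ^ l.+1)))%N ->
      (lo (q.-1 * 2 ^ l) <= x)%N && (x < lo (q * 2 ^ l))%N.
    case/orP => /andP[h1 h2]; last first.
      by have := leq_ltn_trans h1 (leq_trans h2 (lom _ _ (bnd q))); rewrite ltnn.
    rewrite h2 andbT; move: h1; rewrite expnS mulnA.
    have [|] := boolP (odd q) => oq.
      suff -> : (q %/ 2 * 2 = q.-1)%N by [].
      by rewrite divn2 muln2; have := odd_double_half q; rewrite oq; lia.
    have -> : (q %/ 2 * 2 = q)%N.
      by rewrite divn2 muln2; have := odd_double_half q; rewrite (negPf oq); lia.
    by move=> h1; have := leq_ltn_trans h1 h2; rewrite ltnn.
  move: (key _ hi) (key _ hj) => /andP[i1 i2] /andP[j1 j2].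
  apply/eqP; rewrite eqn_leq; apply/andP; split; rewrite leqNgt; apply/negP => ij.
    have ij' : (j * 2 ^ l <= i.-1 * 2 ^ l)%N by rewrite leq_mul2r; lia.
    by have := leq_ltn_trans (leq_trans (lom _ _ ij') i1) j2; rewrite ltnn.
  have ij' : (i * 2 ^ l <= j.-1 * 2 ^ l)%N by rewrite leq_mul2r; lia.
  by have := leq_ltn_trans (leq_trans (lom _ _ ij') j1) i2; rewrite ltnn.
- move=> l i _; case: ifP => _; first exact: bnd1_cutvB.
  by case: ifP => _; [exact: bnd1_cutv|exact: bnd1_0].
- move=> l i iL; case: ifP => _; last by rewrite expn_gt0.
  exact: leq_ltn_trans (leq_div _ _) iL.
- move=> i iL; rewrite big_ord_recr /= ltnn eqxx.
  pose f l : vec := cutv (lo (i %/ 2 ^ l * 2 ^ l)%N) a.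
  rewrite (eq_bigr (fun l : 'I_L => - (f l.+1 - f l))); last first.
    move=> l _; rewrite ltn_ord opprB /f; congr (_ - cutv (lo _) _).
    by rewrite expnSr -divnMA.
  rewrite sumrN -(big_mkord xpredT (fun l => f l.+1 - f l)) telescope_sumr //.
  rewrite opprB /f divn1 muln1 (divn_small iL) mul0n.
  by apply/funext => x; rewrite -[RHS]/(cutv _ a x - cutv _ a x + cutv _ a x) subrK.
Qed.

(** Only the initial part [a] is common to the summands; the new blocks may come from a different
    b_i each time. After telescoping over the slots, slot s holds the disjoint new blocks, and each
    of the M - 1 others is a cut, costing L + 1 pieces, possibly with one further piece for its new
    block. *)
Lemma step_sum L (lo : nat -> nat) (a : 'I_M -> vec) (b : nat -> 'I_M -> vec)
    (c : nat -> K) :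
  {homo lo : i j / (i <= j)%N} -> (forall t, bnd1 (a t)) ->
  (forall i t, (i < 2 ^ L)%N -> bnd1 (b i t)) ->
  (forall i, (i < 2 ^ L)%N -> rn (c i) <= 1) ->
  rn (\sum_(i < 2 ^ L) c i *:
    (th (fun t => cutv (lo i) (a t) + (cutv (lo i.+1) (b i t) - cutv (lo i) (b i t)))
     - th (fun t => cutv (lo i) (a t)))) <= M%:R * (beta * L.+2%:R ^+ M.-1).
Proof.
move=> lom a1 b1 c1.
under eq_bigr do rewrite mlin_telescope // scaler_sumr.
rewrite exchange_big; apply: le_trans (rn_sum _ _ _) _.
have -> : M%:R * (beta * L.+2%:R ^+ M.-1) = \sum_(s < M) (beta * L.+2%:R ^+ M.-1).
  by rewrite sumr_const card_ord mulr_natl.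
apply: ler_sum => s _.
pose P i t := cutv (lo i) (a t).
pose Q i t : vec := cutv (lo i.+1) (b i t) - cutv (lo i) (b i t).
have Q1 i t : (i < 2 ^ L)%N -> bnd1 (Q i t) by move=> iL; apply: bnd1_cutvB; apply: b1.
have P1 i t : bnd1 (P i t) by apply: bnd1_cutv; apply: a1.
have Qs i t x : Q i t x != 0 -> (lo i <= x)%N && (x < lo i.+1)%N.
  move=> /cutvB_neq0 /orP[//|/andP[h1 h2]].
  by have := leq_ltn_trans h1 (leq_trans h2 (lom _ _ (leqnSn i))); rewrite ltnn.
have PQ1 i t : (i < 2 ^ L)%N -> bnd1 (P i t + Q i t).
  move=> iL x; rewrite -[X in rn X]/(P i t x + Q i t x).
  have [->|/Qs/andP[h _]] := eqVneq (Q i t x) 0; first by rewrite addr0; apply: P1.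
  by rewrite {1}/P /cutv ltnNge h /= add0r; apply: Q1.
have Qd t : disjoint_family (2 ^ L) (fun i => Q i t).
  move=> x i j _ _ /Qs/andP[i1 i2] /Qs/andP[j1 j2].
  apply/eqP; rewrite eqn_leq; apply/andP; split; rewrite leqNgt; apply/negP => ij.
    by have := leq_ltn_trans (leq_trans (lom _ _ ij) i1) j2; rewrite ltnn.
  by have := leq_ltn_trans (leq_trans (lom _ _ ij) j1) i2; rewrite ltnn.
have := @triangular_sum (2 ^ L) L.+2 [seq t <- enum 'I_M | t != s] s
  (fun i => dfwith (fun t : 'I_M => if (t < s)%N then P i t + Q i t else P i t) s (Q i s)) c.
have -> : size [seq t <- enum 'I_M | t != s] = M.-1.
  have := count_predC (pred1 s) (enum 'I_M).
  rewrite size_enum_ord (count_uniq_mem _ (enum_uniq _)) mem_enum add1n => E.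
  by apply: succn_inj; rewrite prednK ?(leq_ltn_trans _ (ltn_ord s)) // -[RHS]E size_filter.
apply.
- exact/filter_uniq/enum_uniq.
- by rewrite mem_filter eqxx.
- exact: c1.
- move=> i t iL; case: dfwithP => [|t' _]; first exact: Q1.
  by case: ifP => _; [exact: PQ1|exact: P1].
- by move=> t i j ts; rewrite mem_filter ts mem_enum.
- by move=> x i j iL jL; rewrite !dfwithin; exact: Qd.
- move=> t; rewrite mem_filter => /andP[ts _].
  have E i : dfwith (fun t : 'I_M => if (t < s)%N then P i t + Q i t else P i t) s (Q i s) t
    = if (t < s)%N then P i t + Q i t else P i t by rewrite dfwithout // eq_sym.
  have [h|h] := ltnP t s.
    rewrite [X in decomposable _ _ X](_ : _ = fun i => P i t + Q i t); last first.
      by apply/funext => i; rewrite E h.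
    apply: decomposableD => // [|i iL]; last exact: Q1.
    exact: decomposable_cutv.
  rewrite [X in decomposable _ _ X](_ : _ = fun i => P i t); last first.
    by apply/funext => i; rewrite E ltnNge h.
  by apply: decomposableS; exact: decomposable_cutv.
Qed.

Lemma mlin_lipschitz (a a' : 'I_M -> vec) (eta : R) : 0 <= beta -> 0 < eta ->
  (forall t, bnd1 (a t)) -> (forall t, bnd1 (a' t)) ->
  (forall t x, rn (a t x - a' t x : K) <= eta) ->
  rn (th a - th a') <= M%:R * (beta * eta).
Proof.
move=> b0 e0 a1 a'1 aa'.
have -> : th a = th (fun t => a' t + (a t - a' t)).
  by congr th; apply/funext => t; rewrite addrC subrK.
rewrite mlin_telescope //; apply: le_trans (rn_sum _ _ _) _.
have -> : M%:R * (beta * eta) = \sum_(s < M) beta * eta.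
  by rewrite sumr_const card_ord mulr_natl.
apply: ler_sum => s _.
have -> : a s - a' s = ofR k eta *: (ofR k eta^-1 *: (a s - a' s) : vec).
  by rewrite scalerA -ofRM divff ?gt_eqF // ofR1 scale1r.
rewrite mlinZ // rnZ rn_ofR (ger0_norm (ltW e0)) mulrC ler_wpM2r ?(ltW e0) //.
apply: thb => t; case: dfwithP => [|t' _] x; last first.
  by case: ifP => _; [rewrite addrC subrK; apply: a1|exact: a'1].
have := rnM (ofR k eta^-1) (a s x - a' s x).
rewrite -[_ * _]/((ofR k eta^-1 *: (a s - a' s) : vec) x) => ->.
rewrite rn_ofR ger0_norm ?invr_ge0 ?(ltW e0) // ler_pdivrMl // mulr1.
exact: aa'.
Qed.

End triangular_bound.

(** * Pigeonhole selection and convex hulls *)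

Definition infin (P : nat -> Prop) := forall n, exists2 k, (n <= k)%N & P k.

Lemma infin_pigeonhole (P : nat -> Prop) (T : finType) (f : nat -> T) :
  infin P -> exists c, infin (fun k => P k /\ f k = c).
Proof.
move=> Pinf; apply: contrapT => /forallNP h.
have {}h c : exists N, forall k, (N <= k)%N -> ~ (P k /\ f k = c).
  apply: contrapT => /forallNP hc; apply: (h c) => n.
  by have /existsNP[k /not_implyP[nk /contrapT kc]] := hc n; exists k.
have [N hN] := choice h.
have [k kn Pk] := Pinf (\max_c N c).
apply: (hN (f k) k); last by split.
exact: leq_trans (leq_bigmax _) kn.
Qed.

Section selection.
Variables (R : realType) (k : scalar_kind).
Local Notation K := (scalars R k).

Lemma cell_real (B e : R) : 0 < e -> exists (D : nat) (cell : R -> 'I_D.+1),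
  forall x y, `|x| <= B -> `|y| <= B -> cell x = cell y -> `|x - y| <= e.
Proof.
move=> e0; pose D := Num.truncn ((B + B) / e).
exists D, (fun x => inord (Num.truncn ((x + B) / e))) => x y xB yB.
have pos z : `|z| <= B -> 0 <= (z + B) / e.
  by rewrite ler_norml => /andP[h _]; rewrite divr_ge0 ?(ltW e0) //; lra.
have lt z : `|z| <= B -> (Num.truncn ((z + B) / e) < D.+1)%N.
  move=> zB; rewrite ltnS le_truncn // ler_wpM2r ?invr_ge0 ?(ltW e0) // lerD2r.
  by move: zB; rewrite ler_norml => /andP[].
move=> /(congr1 (@nat_of_ord _)); rewrite !inordK ?lt // => xy.
have /andP[x1 x2] := truncn_itv (pos x xB).
have /andP[y1 y2] := truncn_itv (pos y yB).
rewrite xy in x1 x2; move: x1 x2 y1 y2; set t := Num.truncn _ => x1 x2 y1 y2.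
have : `|(x + B) / e - (y + B) / e| <= 1.
  by rewrite ler_norml -natr1 in x2 y2 *; apply/andP; split; lra.
have -> : (x + B) / e - (y + B) / e = (x - y) / e by field; rewrite gt_eqF.
by rewrite normrM [`|e^-1|]gtr0_norm ?invr_gt0 // ler_pdivrMr // mul1r.
Qed.

Lemma cell_scalars (B e : R) : 0 < e -> exists (T : finType) (cell : K -> T),
  forall x y, rn x <= B -> rn y <= B -> cell x = cell y -> rn (x - y) <= e.
Proof.
move=> e0; have [D [cell H]] := @cell_real B (e / 2) ltac:(lra).
exists ('I_D.+1 * 'I_D.+1)%type, (fun z => (cell (reS z), cell (imS z))).
move=> x y xB yB [h1 h2]; apply: le_trans (rn_le_reim _) _.
rewrite !raddfB /=.
have := H _ _ (le_trans (normr_reS _) xB) (le_trans (normr_reS _) yB) h1.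
have := H _ _ (le_trans (normr_imS _) xB) (le_trans (normr_imS _) yB) h2.
lra.
Qed.

(** Finitely many bounded coordinates fall into finitely many cells, so one cell occurs infinitely
    often; this takes the place of passing to convergent subsequences. *)
Lemma infin_close (T : finType) (P : nat -> Prop) (g : nat -> T -> K) (B e : R) :
  0 < e -> infin P -> (forall i c, rn (g i c) <= B) ->
  exists Q : nat -> Prop, [/\ infin Q, forall i, Q i -> P i &
    forall i j c, Q i -> Q j -> rn (g i c - g j c) <= e].
Proof.
move=> e0 Pinf gB; have [U [cell H]] := cell_scalars B e0.
have [c cinf] := infin_pigeonhole (fun i => [ffun t => cell (g i t)]) Pinf.
exists (fun i => P i /\ [ffun t => cell (g i t)] = c); split => //.
  by move=> i [].
move=> i j t [_ ic] [_ jc]; apply: H => //.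
by have := congr1 (fun f : {ffun T -> U} => f t) (etrans ic (esym jc)); rewrite !ffunE.
Qed.

Section hull.
Variable V : normedModType K.

(* Membership in the closed convex hull of [S], phrased through the norms it controls. *)
Definition hull (S : V -> Prop) (y : V) :=
  forall z B, (forall v, S v -> rn (z + v) <= B) -> rn (z + y) <= B.

Lemma hull_incl S y : S y -> hull S y.
Proof. by move=> Sy z B; apply. Qed.

Lemma hull_mean S (n : nat) (Q : pred 'I_n) (p : 'I_n -> R) (v : 'I_n -> V) :
  (forall i, Q i -> 0 <= p i) -> \sum_(i < n | Q i) p i = 1 ->
  (forall i, Q i -> S (v i)) ->
  hull S (\sum_(i < n | Q i) ofR k (p i) *: v i).
Proof.
move=> p0 p1 Sv z B zB.
have -> : z + \sum_(i < n | Q i) ofR k (p i) *: v i =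
    \sum_(i < n | Q i) ofR k (p i) *: (z + v i).
  under [RHS]eq_bigr do rewrite scalerDr.
  by rewrite big_split /= -scaler_suml -raddf_sum /= p1 ofR1 scale1r.
apply: le_trans (rn_sum _ _ _) _.
apply: (@le_trans _ _ (\sum_(i < n | Q i) p i * B)).
  apply: ler_sum => i Qi; rewrite rnZ rn_ofR ger0_norm ?p0 // ler_wpM2l ?p0 //.
  exact/zB/Sv.
by rewrite -mulr_suml p1 mul1r.
Qed.

(** The norm is convex in each summand separately, so the summands can be replaced one after another
    by members of their sets; the offset [z] carries those already replaced. *)
Lemma hull_sum (n : nat) (S : nat -> V -> Prop) (y : nat -> V) z B :
  (forall i, (i < n)%N -> hull (S i) (y i)) ->
  (forall v : nat -> V, (forall i, (i < n)%N -> S i (v i)) ->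
     rn (z + \sum_(i < n) v i) <= B) ->
  rn (z + \sum_(i < n) y i) <= B.
Proof.
elim: n z => [|n IH] z hy hv.
  have := hv (fun=> 0); rewrite !big_ord0; exact.
rewrite big_ord_recr /= addrA; apply: (hy n (ltnSn _)) => v Sv.
rewrite addrAC; apply: IH => [i iN|v' Sv'].
  by apply: hy; rewrite ltnS ltnW.
pose f i := if i == n then v else v' i.
have -> : z + v + \sum_(i < n) v' i = z + \sum_(i < n.+1) f i.
  rewrite big_ord_recr /= /f eqxx -addrA [v + _]addrC; congr (_ + (_ + _)).
  by apply: eq_bigr => i _; rewrite ltn_eqF.
apply: hv => i; rewrite ltnS leq_eqVlt /f.
by case: (eqVneq i n) => [->|_] //=; exact: Sv'.
Qed.

End hull.
End selection.

(** * Averages of elementary tensors along a subsequence *)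

Section spreading.
Variables (R : realType) (k : scalar_kind) (M : nat).
Local Notation K := (scalars R k).
Local Notation vec := (nat -> K^o).

(* Finitely supported probability measures on the M-tuples of sequences in the unit ball
   of l_infinity; [mint] is the integral. *)
Record pmeasure := PMeasure {
  msize : nat;
  mwt : nat -> R;
  mpt : nat -> 'I_M -> vec;
  mwt_ge0 : forall l, (l < msize)%N -> 0 <= mwt l;
  mwt_sum : \sum_(l < msize) mwt l = 1;
  mpt_bnd1 : forall l t, (l < msize)%N -> bnd1 (mpt l t) }.

Definition mint (V : lmodType K) (mu : pmeasure) (F : ('I_M -> vec) -> V) : V :=
  \sum_(l < msize mu) ofR k (mwt mu l) *: F (mpt mu l).

Lemma rn_mint (V : normedModType K) mu (F : ('I_M -> vec) -> V) B :
  (forall a, (forall t, bnd1 (a t)) -> rn (F a) <= B) -> rn (mint mu F) <= B.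
Proof.
move=> FB; apply: le_trans (rn_sum _ _ _) _; rewrite -[B]mul1r -(mwt_sum mu) mulr_suml.
apply: ler_sum => l _; rewrite rnZ rn_ofR ger0_norm ?mwt_ge0 //.
by rewrite ler_wpM2l ?mwt_ge0 // FB // => t; apply: mpt_bnd1.
Qed.

Section cells.
Variables (T : finType) (cell : K -> T).

Definition cellf m (a : 'I_M -> vec) : {ffun 'I_M * 'I_m -> T} :=
  [ffun x : 'I_M * 'I_m => cell (a x.1 x.2)].

Definition cweight mu m c : R := \sum_(l < msize mu | cellf m (mpt mu l) == c) mwt mu l.

Arguments cweight : clear implicits.

Lemma cweight_ge0 mu m c : 0 <= cweight mu m c.
Proof. by apply: sumr_ge0 => l _; exact: mwt_ge0. Qed.

Lemma cweight_le1 mu m c : cweight mu m c <= 1.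
Proof.
rewrite -(mwt_sum mu) [leRHS](bigID (fun l : 'I_(msize mu) => cellf m (mpt mu l) == c)) /=.
by rewrite lerDl sumr_ge0 // => l _; exact: mwt_ge0.
Qed.

(** After s_n is chosen, the remaining candidates are thinned out until the masses of all cells on
    the first m (s_n) coordinates nearly agree; later indices are taken from what is left. *)
Lemma select_indices (mu : nat -> pmeasure) (m : nat -> nat) (del : nat -> R) n :
  (forall i, 0 < del i) ->
  exists s : nat -> nat, (forall i, (i < n)%N -> (s i < s i.+1)%N) /\
  forall i j j' c, (i < n)%N -> (i < j <= n)%N -> (i < j' <= n)%N ->
    `|cweight (mu (s j)) (m (s i)) c - cweight (mu (s j')) (m (s i)) c| <= del (m (s i)).
Proof.
move=> del0.
(* The induction keeps an infinite set P of possible continuations, and the estimate covers both P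
   and the indices already chosen, so that thinning P preserves it. *)
suff [s [P [Pinf sinc H]]] : exists (s : nat -> nat) (P : nat -> Prop),
    [/\ infin P, forall i, (i < n)%N -> (s i < s i.+1)%N &
     forall i, (i < n)%N ->
     let good x := P x \/ exists2 j, (i < j <= n)%N & x = s j in
     forall x y c, good x -> good y ->
     `|cweight (mu x) (m (s i)) c - cweight (mu y) (m (s i)) c| <= del (m (s i))].
  exists s; split => // i j j' c iN ij ij'.
  by apply: (H i iN); right; [exists j|exists j'].
elim: n => [|n [s [P [Pinf sinc H]]]].
  exists id, (fun _ => True); split => // x; first by exists x.
pose g x c := ofR RealScalars (cweight (mu x) (m (s n)) c).
have gB x c : rn (g x c) <= 1.
  by rewrite rn_ofR ger0_norm ?cweight_ge0 // cweight_le1.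
have [Q [Qinf QP Qclose]] := infin_close (del0 (m (s n))) Pinf gB.
have [x xs Qx] := Qinf (s n).+1.
pose s' i := if i == n.+1 then x else s i.
exists s', Q; split => //.
  move=> i; rewrite ltnS /s' eqSS => iN; rewrite ltn_eqF // .
  by case: (eqVneq i n) => [->//|ni]; apply: sinc; rewrite ltn_neqAle ni.
move=> i iN /=; have s'i : s' i = s i by rewrite /s' ltn_eqF.
rewrite s'i; have [->|ni] := eqVneq i n.
  have toQ w : Q w \/ (exists2 j, (n < j <= n.+1)%N & w = s' j) -> Q w.
    case=> // -[j /andP[nj jn] ->]; suff -> : j = n.+1 by rewrite /s' eqxx.
    by apply/eqP; rewrite eqn_leq jn nj.
  by move=> y z c /toQ Qy /toQ Qz; have := Qclose y z c Qy Qz; rewrite /g -rmorphB rn_ofR.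
have iN' : (i < n)%N by rewrite ltn_neqAle ni.
have toP w : Q w \/ (exists2 j, (i < j <= n.+1)%N & w = s' j) ->
    P w \/ (exists2 j, (i < j <= n)%N & w = s j).
  case=> [/QP ?|[j /andP[ij jn] ->]]; first by left.
  rewrite /s'; case: (eqVneq j n.+1) => [_|jn']; first by left; exact: QP.
  by right; exists j => //; rewrite ij /= -ltnS ltn_neqAle jn'.
by move=> y z c /toP gy /toP gz; exact: (H i iN').
Qed.

End cells.

Arguments cweight {T} cell mu m c.

(* The measures are coupled through the cells of the first m (s i) coordinates: their masses
   nearly agree along s, so [mu (s i.+1)] may be replaced by the means over the cells taken
   with the masses of [mu (s n)].  For each point a in the support of [mu (s n)] the means
   lie in the hull of points that agree with a on those coordinates, and [step_sum] applies. *)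
Theorem spreading_bound (mu : nat -> pmeasure) (m : nat -> nat) (L : nat) :
  {homo m : i j / (i <= j)%N} ->
  exists s : nat -> nat, (forall i, (i < 2 ^ L)%N -> (s i < s i.+1)%N) /\
  forall (V : normedModType K) (th : ('I_M -> vec) -> V) (beta : R),
    mlin th -> (forall a, (forall t, bnd1 (a t)) -> rn (th a) <= beta) ->
    rn (\sum_(i < 2 ^ L) mint (mu (s i.+1)) (fun a =>
       th (fun t => cutv (m (s i.+1)) (a t)) - th (fun t => cutv (m (s i)) (a t))))
    <= beta * (M%:R * L.+2%:R ^+ M.-1 + 1).
Proof.
move=> mm; set n := (2 ^ L)%N.
have n0 : 0 < n%:R :> R by rewrite ltr0n expn_gt0.
(* Two errors of beta/2 in total are allowed. [eta] makes the replacement of coordinates within a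
   cell cost at most beta/(2n) per summand, and [del] does the same for the mismatch of cell masses,
   where [D] has norm up to 2 beta. *)
pose eta : R := (4 * n%:R * M.+1%:R)^-1.
have eta0 : 0 < eta by rewrite invr_gt0 !mulr_gt0 // ltr0n.
have [T [cell cellP]] := @cell_scalars R k 1 eta eta0.
pose cells x := #|{ffun 'I_M * 'I_x -> T}|.
pose del x : R := (4 * n%:R * (cells x).+1%:R)^-1.
have del0 x : 0 < del x by rewrite invr_gt0 !mulr_gt0 // ltr0n.
have [s [sinc sP]] := @select_indices T cell mu m del n del0.
exists s; split => // V th beta thl thb.
have b0 : 0 <= beta.
  by apply: le_trans (thb (fun _ _ => 0) _); rewrite ?rn_ge0 // => t j; rewrite rn0.
(* Stopping at n makes [lo] monotone everywhere, while s is known to increase only up to n. *)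
pose lo i := m (s (minn i n)).
have smono : {homo (fun i => s (minn i n)) : i j / (i <= j)%N}.
  apply: homo_leq => [//|y x z|i]; first exact: leq_trans.
  have [h|] := boolP (n <= i)%N; last rewrite -ltnNge => h.
    by rewrite (minn_idPr h) (minn_idPr (leq_trans h (leqnSn _))).
  by rewrite (minn_idPl h) (minn_idPl (ltnW h)) ltnW // sinc.
have lom : {homo lo : i j / (i <= j)%N} by move=> i j ij; apply/mm/smono.
have loE i : (i <= n)%N -> lo i = m (s i) by move=> h; rewrite /lo (minn_idPl h).
pose D i a := th (fun t => cutv (lo i.+1) (a t)) - th (fun t => cutv (lo i) (a t)).
have -> : \sum_(i < n) mint (mu (s i.+1)) (fun a =>
     th (fun t => cutv (m (s i.+1)) (a t)) - th (fun t => cutv (m (s i)) (a t)))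
   = \sum_(i < n) mint (mu (s i.+1)) (D i).
  by apply: eq_bigr => i _; rewrite /D !loE // ltnW.
have D2 i a : (forall t, bnd1 (a t)) -> rn (D i a) <= 2 * beta.
  move=> a1; apply: le_trans (rnB _ _) _.
  have := lerD (thb (fun t => cutv (lo i.+1) (a t)) _) (thb (fun t => cutv (lo i) (a t)) _).
  by rewrite mulr2n mulrDl mul1r; apply => t; exact: bnd1_cutv.
pose W i c := cweight cell (mu (s i.+1)) (m (s i)) c.
pose W' i c := cweight cell (mu (s n)) (m (s i)) c.
(* The conditional mean of [D i] on the cell c, with default 0 on a null cell. *)
pose Y i c : V := if W i c == 0 then 0 else
  \sum_(l < msize (mu (s i.+1)) | cellf cell (m (s i)) (mpt (mu (s i.+1)) l) == c)
    ofR k (mwt (mu (s i.+1)) l / W i c) *: D i (mpt (mu (s i.+1)) l).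
have YE i : mint (mu (s i.+1)) (D i) = \sum_c ofR k (W i c) *: Y i c.
  rewrite /mint (partition_big (fun l : 'I__ => cellf cell (m (s i)) (mpt (mu (s i.+1)) l)) xpredT) //=.
  apply: eq_bigr => c _; rewrite /Y; have [W0|W0] := eqVneq (W i c) 0.
    rewrite scaler0 big1 // => l lc.
    have /eqP := W0; rewrite psumr_eq0 => [/allP/(_ l)|l' _]; last exact: mwt_ge0.
    by rewrite mem_index_enum lc => /(_ isT)/eqP ->; rewrite ofR0 scale0r.
  rewrite scaler_sumr; apply: eq_bigr => l _; rewrite scalerA -ofRM.
  by rewrite mulrCA divff // mulr1.
(* The flag [e] accommodates null cells: when it is false, b need not lie in the cell and the vector
   is 0, the default mean. *)
pose S i c (v : V) := exists (e : bool) (b : 'I_M -> vec),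
  [/\ forall t, bnd1 (b t), e -> cellf cell (m (s i)) b = c & v = (e%:R : K) *: D i b].
have Yh i c : hull (S i c) (Y i c).
  rewrite /Y; have [W0|W0] := eqVneq (W i c) 0.
    apply: hull_incl; exists false, (fun _ _ => 0); split => //; last by rewrite scale0r.
    by move=> t x; rewrite rn0.
  apply: hull_mean.
  - by move=> l _; rewrite divr_ge0 ?mwt_ge0 ?cweight_ge0.
  - by rewrite -mulr_suml divff.
  - move=> l /eqP lc; exists true, (mpt (mu (s i.+1)) l); split => //; last by rewrite scale1r.
    by move=> t; exact: mpt_bnd1.
have Y2 i c : rn (Y i c) <= 2 * beta.
  rewrite -[Y i c]add0r; apply: Yh => v [e [b [b1 _ ->]]]; rewrite add0r rnZ.
  case: e; first by rewrite rn1 mul1r D2.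
  by rewrite rn0 mul0r mulr_ge0.
pose err := \sum_(i < n) \sum_c ofR k (W i c - W' i c) *: Y i c.
pose main := \sum_(i < n) \sum_c ofR k (W' i c) *: Y i c.
have -> : \sum_(i < n) mint (mu (s i.+1)) (D i) = main + err.
  rewrite -big_split; apply: eq_bigr => i _ /=; rewrite YE -big_split /=.
  by apply: eq_bigr => c _; rewrite -scalerDl -ofRD addrC subrK.
have errB : rn err <= beta / 2.
  apply: le_trans (rn_sum _ _ _) _.
  have -> : beta / 2 = \sum_(i < n) beta / 2 / n%:R.
    by rewrite sumr_const card_ord -[RHS]mulr_natl [RHS]mulrC divfK // gt_eqF.
  apply: ler_sum => i _; apply: le_trans (rn_sum _ _ _) _.
  apply: (@le_trans _ _ (\sum_(c : {ffun 'I_M * 'I_(m (s i)) -> T}) del (m (s i)) * (2 * beta))).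
    apply: ler_sum => c _; rewrite rnZ rn_ofR ler_pM // ?rn_ge0 //.
    by apply: sP => //; rewrite ?ltnSn ?leqnn ?ltn_ord.
  rewrite sumr_const -/(cells _) -[leLHS]mulr_natl /del.
  have c0 : 0 < (cells (m (s i))).+1%:R :> R by rewrite ltr0n.
  have cle : (cells (m (s i)))%:R <= (cells (m (s i))).+1%:R :> R by rewrite ler_nat.
  move: (cells _)%:R (cells _).+1%:R c0 cle => x y y0 xy.
  have -> : beta / 2 / n%:R = y * ((4 * n%:R * y)^-1 * (2 * beta)).
    by field; rewrite !gt_eqF.
  by rewrite ler_wpM2r // mulr_ge0 ?mulr_ge0 // invr_ge0 !mulr_ge0 // ltW.
suff mainB : rn main <= beta * (M%:R * L.+2%:R ^+ M.-1) + beta / 2.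
  by apply: le_trans (rnD _ _) _; move: mainB errB; rewrite mulrDr mulr1; lra.
(* All masses now come from [mu (s n)]. A point a of that measure determines its cell at every level
   i at once, so the sums over cells merge into one integral and a can be fixed. *)
have -> : main = mint (mu (s n)) (fun a => \sum_(i < n) Y i (cellf cell (m (s i)) a)).
  rewrite /mint; under [RHS]eq_bigr do rewrite scaler_sumr.
  rewrite exchange_big; apply: eq_bigr => i _ /=.
  rewrite [RHS](partition_big (fun l : 'I__ => cellf cell (m (s i)) (mpt (mu (s n)) l)) xpredT) //=.
  apply: eq_bigr => c _; rewrite /W' /cweight raddf_sum /= scaler_suml.
  by apply: eq_bigr => l /eqP ->.
apply: rn_mint => a a1; rewrite -[X in rn X]add0r.
apply: (@hull_sum _ _ _ _ (fun i => S i (cellf cell (m (s i)) a))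
  (fun i => Y i (cellf cell (m (s i)) a))) => [i _|v Sv]; first exact: Yh.
have /choice[e /choice[b eb]] : forall i, exists (e : bool) (b : 'I_M -> vec), (i < n)%N ->
   [/\ forall t, bnd1 (b t), e -> cellf cell (m (s i)) b = cellf cell (m (s i)) a
     & v i = ((e : bool)%:R : K) *: D i b].
  move=> i; have [h|h] := ltnP i n.
    by have [e [b H]] := Sv i h; exists e, b.
  by exists true, a.
rewrite add0r.
(* The increment of b_i with its first [lo i] coordinates replaced by those of a, which lie in the
   same cells: the common initial part that [step_sum] requires. *)
pose E i := th (fun t => cutv (lo i) (a t) + (cutv (lo i.+1) (b i t) - cutv (lo i) (b i t)))
     - th (fun t => cutv (lo i) (a t)).
have close i t x : (i < n)%N -> e i -> (x < lo i)%N -> rn (b i t x - a t x : K) <= eta.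
  move=> iN ei xlo; have [b1 /(_ ei) bc _] := eb i iN.
  apply: cellP; [exact: b1|exact: a1|].
  move: xlo; rewrite loE ?(ltnW iN) // => xlo.
  by have := congr1 (fun f : {ffun 'I_M * 'I_(m (s i)) -> T} => f (t, Ordinal xlo)) bc; rewrite !ffunE.
have DE i : (i < n)%N -> e i -> rn (D i (b i) - E i) <= beta / 2 / n%:R.
  move=> iN ei; have [b1 _ _] := eb i iN.
  have lle : (lo i <= lo i.+1)%N by apply: lom.
  pose h t := cutv (lo i) (a t) + (cutv (lo i.+1) (b i t) - cutv (lo i) (b i t)) : vec.
  have -> : D i (b i) - E i = (th (fun t => cutv (lo i.+1) (b i t)) - th h) +
      (th (fun t => cutv (lo i) (a t)) - th (fun t => cutv (lo i) (b i t))).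
    by rewrite /D /E opprB [X in _ + X]addrC addrACA; congr (_ + _); rewrite addrC.
  have hE t x : h t x = if (x < lo i)%N then a t x else cutv (lo i.+1) (b i t) x.
    rewrite -[LHS]/(cutv (lo i) (a t) x + (cutv (lo i.+1) (b i t) x - cutv (lo i) (b i t) x)).
    rewrite /cutv; have [xl|xl] := ltnP x (lo i); last by rewrite add0r subr0.
    by rewrite (leq_trans xl lle) subrr addr0.
  have h1 t : bnd1 (h t).
    move=> x; rewrite hE; case: ifP => _; first exact: a1.
    exact: bnd1_cutv.
  have d1 : rn (th (fun t => cutv (lo i.+1) (b i t)) - th h) <= M%:R * (beta * eta).
    apply: (mlin_lipschitz thl thb b0 eta0) => // [t|t x]; first exact: bnd1_cutv.
    rewrite hE; have [xl|xl] := ltnP x (lo i); last by rewrite subrr rn0 ltW.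
    by rewrite /cutv (leq_trans xl lle) close.
  have d2 : rn (th (fun t => cutv (lo i) (a t)) - th (fun t => cutv (lo i) (b i t))) <= M%:R * (beta * eta).
    apply: (mlin_lipschitz thl thb b0 eta0) => [t|t|t x]; try exact: bnd1_cutv.
    rewrite /cutv; case: ifP => xl; last by rewrite subrr rn0 ltW.
    by rewrite -rnN opprB close.
  apply: le_trans (rnD _ _) _; apply: le_trans (lerD d1 d2) _.
  have M0 : 0 < M.+1%:R :> R by rewrite ltr0n.
  have -> : beta / 2 / n%:R = M.+1%:R * (beta * eta) + M.+1%:R * (beta * eta).
    by rewrite /eta; field; rewrite !gt_eqF.
  by apply: lerD; rewrite ler_wpM2r ?mulr_ge0 ?(ltW eta0) // ler_nat.
have -> : \sum_(i < n) v i = \sum_(i < n) ((e i)%:R : K) *: E i +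
    \sum_(i < n) ((e i)%:R : K) *: (D i (b i) - E i).
  rewrite -big_split; apply: eq_bigr => i _ /=.
  by have [_ _ ->] := eb i (ltn_ord i); rewrite -scalerDr addrC subrK.
apply: le_trans (rnD _ _) _; apply: lerD.
  have H := @step_sum R k V M th beta thl thb L lo a b (fun i => (e i)%:R) lom a1.
  rewrite mulrCA; apply: H => [i t iN|i iN]; first by have [] := eb i iN.
  by case: (e i); rewrite ?rn1 ?rn0.
apply: le_trans (rn_sum _ _ _) _.
have -> : beta / 2 = \sum_(i < n) beta / 2 / n%:R.
  by rewrite sumr_const card_ord -[RHS]mulr_natl [RHS]mulrC divfK // gt_eqF.
apply: ler_sum => i _; rewrite rnZ; case ei: (e i); last first.
  by rewrite rn0 mul0r !divr_ge0.
by rewrite rn1 mul1r DE.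
Qed.

End spreading.

(** * The multilinear Hilbert form *)

Section hilbert_form.
Variables (R : realType) (k : scalar_kind) (p : nat).
Local Notation K := (scalars R k).

(** The index of slot 0 is kept apart because, once it is fixed, the form is a product over the
    other slots ([hformE]). *)
Definition midx n := ('I_n * {ffun 'I_p -> 'I_n})%type.

Definition ix n (I : midx n) (t : 'I_p.+1) : 'I_n :=
  if unlift ord0 t is Some t' then I.2 t' else I.1.

Lemma ix0 n (I : midx n) : ix I ord0 = I.1.
Proof. by rewrite /ix unlift_none. Qed.

Lemma ix_lift n (I : midx n) t : ix I (lift ord0 t) = I.2 t.
Proof. by rewrite /ix liftK. Qed.

Definition hcoef n (I : midx n) : K := ofR k (\prod_(t < p) hil R I.1 (I.2 t)).

Definition hform n (y : 'I_p.+1 -> nat -> K) : K :=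
  \sum_(I : midx n) hcoef I * \prod_t y t (ix I t).

Lemma rn_hcoef n (I : midx n) : rn (hcoef I) <= 1.
Proof.
rewrite rn_ofR normr_prod; apply: prodr_ile1 => t _.
by rewrite normr_ge0 normr_hil_le1.
Qed.

Lemma hformE n (y : 'I_p.+1 -> nat -> K) :
  hform n y = \sum_(i < n) y ord0 i *
    \prod_(t < p) \sum_(j < n) ofR k (hil R i j) * y (lift ord0 t) j.
Proof.
rewrite /hform; under [RHS]eq_bigr do rewrite bigA_distr_bigA mulr_sumr.
rewrite pair_big /=; apply: eq_bigr => I _.
rewrite /hcoef rmorph_prod big_ord_recl /= ix0 mulrCA; congr (_ * _).
by rewrite -big_split /=; apply: eq_bigr => t _; rewrite ix_lift.
Qed.

(** Either all factors are at most 1, or the P-th power of the largest one dominates. *)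
Lemma prod_le_powsum q P (x : 'I_q -> R) : (q <= P)%N -> (forall t, 0 <= x t) ->
  \prod_t x t <= 1 + \sum_t x t ^+ P.
Proof.
move=> qP x0.
have S0 (Q : pred 'I_q) : 0 <= \sum_(t | Q t) x t ^+ P by apply: sumr_ge0 => t _; rewrite exprn_ge0.
have [[t0 t01]|h] := pselect (exists t, 1 < x t); last first.
  apply: (@le_trans _ _ 1); last by rewrite lerDl.
  apply: prodr_ile1 => t _; rewrite x0 leNgt /=; apply/negP => xt; apply: h; by exists t.
case: (@arg_maxP _ _ _ t0 xpredT x isT) => tm _ tmax.
have xm1 : 1 <= x tm by apply: le_trans (ltW t01) (tmax _ _).
apply: (@le_trans _ _ (\prod_(t < q) x tm)).
  by apply: ler_prod => t _; rewrite x0 /=; exact: tmax.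
rewrite prodr_const card_ord (bigD1 tm) //=.
apply: (@le_trans _ _ (x tm ^+ P)); first by rewrite ler_weXn2l.
by rewrite addrA [1 + _]addrC -addrA lerDl addr_ge0.
Qed.

(** For a fixed index in slot 0 the form is a product of p Hilbert transforms, dominated by their
    P-th powers with P = 2^(p+1) >= p. A sequence bounded by 1 on n indices has P-th power sum at
    most n, so [hilop_lp], applied to real and imaginary parts, gives O(n) in total. *)
Lemma hform_bound : exists2 A : R, 0 <= A & forall n (y : 'I_p.+1 -> nat -> K),
  (forall t j, (j < n)%N -> rn (y t j) <= 1) -> rn (hform n y) <= A * n%:R.
Proof.
have [A A0 HA] := @hilop_lp R p; set P := (2 ^ p.+1)%N in HA.
exists (1 + p%:R * (2 ^+ P * (A + A))).
  by rewrite addr_ge0 // mulr_ge0 // mulr_ge0 ?exprn_ge0 // addr_ge0.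
move=> n y y1.
pose xr t i := `|hilop n (fun j => reS (y (lift ord0 t) j)) i|.
pose xi t i := `|hilop n (fun j => imS (y (lift ord0 t) j)) i|.
have ev t i : rn (\sum_(j < n) ofR k (hil R i j) * y (lift ord0 t) j) <= xr t i + xi t i.
  apply: le_trans (rn_le_reim _) _; rewrite !raddf_sum /= /xr /xi /hilop.
  by under eq_bigr do rewrite reS_ofRM; under [X in _ + `|X|]eq_bigr do rewrite imS_ofRM.
have x0 t i : 0 <= xr t i + xi t i by rewrite addr_ge0 /xr /xi.
rewrite hformE; apply: le_trans (rn_sum _ _ _) _.
apply: (@le_trans _ _ (\sum_(i < n) (1 + \sum_(t < p) 2 ^+ P * (xr t i ^+ P + xi t i ^+ P)))).
  apply: ler_sum => i _; rewrite rnM rn_prod.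
  apply: (@le_trans _ _ (1 * \prod_(t < p) (xr t i + xi t i))).
    apply: ler_pM => //; [exact: rn_ge0|by apply: prodr_ge0 => t _; exact: rn_ge0|exact: y1|].
    by apply: ler_prod => t _; rewrite rn_ge0 ev.
  rewrite mul1r; apply: le_trans (@prod_le_powsum p P _ _ _) _ => [|t|] //.
    by rewrite (leq_trans (ltnW (ltn_expl p (ltnSn 1)))) // leq_exp2l.
  rewrite lerD2l; apply: ler_sum => t _; apply: exprD_le; exact: normr_ge0.
rewrite big_split /= sumr_const card_ord exchange_big /= mulrDl mul1r lerD2l.
have -> : p%:R * (2 ^+ P * (A + A)) * n%:R = \sum_(t < p) 2 ^+ P * (A * n%:R + A * n%:R).
  by rewrite sumr_const card_ord -[RHS]mulr_natl -mulrDl -!mulrA.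
apply: ler_sum => t _; rewrite -mulr_sumr ler_wpM2l ?exprn_ge0 // big_split /=.
have part (z : nat -> R) : (forall j, (j < n)%N -> `|z j| <= 1) ->
    \sum_(i < n) `|hilop n z i| ^+ P <= A * n%:R.
  move=> z1; apply: le_trans (HA n z) _; rewrite ler_wpM2l //.
  rewrite -[n%:R]mulr1 -[X in X%:R](card_ord n) mulr_natl -sumr_const.
  apply: ler_sum => j _; apply: exprn_ile1; [exact: normr_ge0|exact: z1].
apply: lerD; apply: part => j jn.
  exact: le_trans (normr_reS _) (y1 _ _ jn).
exact: le_trans (normr_imS _) (y1 _ _ jn).
Qed.

Lemma hform_triangle n i : (i < n)%N ->
  hform n (fun t j => ((if t == ord0 then j == i else j < i)%N)%:R) =
  ofR k ((\sum_(j < i) hil R i j) ^+ p).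
Proof.
move=> iN; rewrite hformE (bigD1 (Ordinal iN)) //= eqxx mul1r [X in _ + X]big1 ?addr0; last first.
  move=> j ji; have -> : (j == i :> nat) = false.
    by apply: contraNF ji => /eqP ji; apply/eqP/val_inj.
  by rewrite mul0r.
rewrite rmorphXn /= -[X in _ = _ ^+ X]card_ord -prodr_const; apply: eq_bigr => t _.
rewrite raddf_sum /= (big_ord_widen n (fun j => ofR k (hil R i j)) (ltnW iN)).
rewrite [RHS]big_mkcond; apply: eq_bigr => j _.
by case: ifP; rewrite ?mulr1 ?mulr0.
Qed.

End hilbert_form.

(** * Estimates for the projective and injective norms *)

Section tensor_norms.
Variables (R : realType) (k : scalar_kind).
Local Notation K := (scalars R k).

Lemma dense_approx (T : normedModType K) (D : set T) (z : T) (e : R) :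
  dense D -> 0 < e -> exists2 d, D d & rn (z - d) <= e.
Proof.
move=> Dd e0; have eK : 0 < ofR k e by rewrite -(ofR0 R k) ltr_ofR.
have [] := Dd (ball z (ofR k e)).
- by exists z; exact: ballxx.
- exact: ball_open.
move=> d [zd Dd']; exists d => //.
by rewrite -(@ler_ofR R k) -rnE ltW //; move: zd; rewrite -ball_normE.
Qed.

Variables (X : normedModType K) (N : nat).

Section projective.
Variables (T : completeNormedModType K) (th : ('I_N -> X) -> T).
Hypothesis thP : projective_tensor th.

Let pnorm_ge0 (s : seq ('I_N -> X)) (x : K) :
  [set \sum_(x <- t) \prod_(i < N) `|x i| | t in tensor_eq s] x -> 0 <= x.
Proof. by move=> [t _ <-]; apply: sumr_ge0 => y _; apply: prodr_ge0. Qed.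

Let pnormP (s : seq ('I_N -> X)) : infimums
  [set \sum_(x <- t) \prod_(i < N) `|x i| | t in tensor_eq s] (projective_norm s).
Proof.
apply: infimumP; first by exists (\sum_(x <- s) \prod_(i < N) `|x i|), s.
exact: pnorm_ge0.
Qed.

Let prodE (x : 'I_N -> X) : \prod_(i < N) `|x i| = ofR k (\prod_(i < N) rn (x i)).
Proof. by rewrite rmorph_prod; apply: eq_bigr => i _; rewrite rnE. Qed.

Lemma projective_elementary x : rn (th x) <= \prod_(i < N) rn (x i).
Proof.
have [_ nrm _] := thP; have := nrm [:: x]; rewrite big_seq1 -(@ler_ofR R k) -rnE => ->.
have [lb _] := pnormP [:: x]; apply: lb; exists [:: x] => //.
by rewrite big_seq1 prodE.
Qed.

(** The sum of Phi is the same for all representatives of a tensor, and the norm is the infimum over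
    representatives. Dividing by B is what singles out the case B = 0. *)
Lemma projective_form (Phi : ('I_N -> X) -> K^o) (B : R) s : 0 <= B ->
  mlin Phi -> (forall x, rn (Phi x : K) <= B * \prod_(i < N) rn (x i)) ->
  rn (\sum_(x <- s) Phi x : K) <= B * rn (\sum_(x <- s) th x).
Proof.
move=> B0 Pm PB; have [_ nrm _] := thP; have [_ ub] := pnormP s.
have bound t : tensor_eq s t ->
    rn (\sum_(x <- s) Phi x : K) <= B * \sum_(x <- t) \prod_(i < N) rn (x i).
  move=> st; have -> : \sum_(x <- s) Phi x = \sum_(x <- t) Phi x by exact: st.
  apply: le_trans (rn_sum _ _ _) _; rewrite mulr_sumr.
  by apply: ler_sum => x _; exact: PB.
have [B00|Bn0] := eqVneq B 0.
  by have := bound s (fun _ _ _ => erefl); rewrite B00 !mul0r.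
have Bp : 0 < B by rewrite lt_def Bn0.
rewrite -ler_pdivrMl // -(@ler_ofR R k) -rnE nrm; apply: ub => _ [t st <-].
under [leRHS]eq_bigr do rewrite prodE; rewrite -raddf_sum /= ler_ofR ler_pdivrMl //.
exact: bound.
Qed.

(** One e is lost to density, the other to the choice of a nearly optimal representative. *)
Lemma projective_approx z e : 0 < e -> exists s : seq ('I_N -> X),
  rn (z - \sum_(x <- s) th x) <= e /\
  \sum_(x <- s) \prod_(i < N) rn (x i) <= rn z + 2 * e.
Proof.
move=> e0; have [thl nrm dn] := thP.
have [_ [s _ <-] sz] := dense_approx z dn e0.
have [lb ub] := pnormP s.
have [t st tB] : exists2 t, tensor_eq s t &
    \sum_(x <- t) \prod_(i < N) rn (x i) <= rn z + 2 * e.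
  apply: contrapT => /forall2NP h.
  have : ofR k (rn z + 2 * e) <= projective_norm s.
    apply: ub => _ [t st <-]; under [leRHS]eq_bigr do rewrite prodE.
    rewrite -raddf_sum /= ler_ofR; have [//|/negP] := h t.
    by rewrite -ltNge => /ltW.
  rewrite -nrm rnE ler_ofR.
  have : rn (\sum_(x <- s) th x) <= rn z + e.
    rewrite -[\sum_(x <- s) th x](subKr z); apply: le_trans (rnB _ _) _.
    by rewrite lerD2l.
  by move=> h1 h2; lra.
by exists t; split => //; rewrite -(st T th thl).
Qed.

End projective.

Section injective.
Variables (T : completeNormedModType K) (th : ('I_N -> X) -> T).
Hypothesis thP : injective_tensor th.

Let inormP (s : seq ('I_N -> X)) : supremums
  [set `|\sum_(x <- s) \prod_(i < N) f i (x i)| |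
    f in [set f : 'I_N -> {scalar X} | forall i, dual_unit_ball (f i)]]
  (injective_norm s).
Proof.
apply: supremumP.
- exists `|\sum_(x <- s) \prod_(i < N) (\0%R : {scalar X}) (x i)|, (fun _ => (\0%R : {scalar X})) => //.
  by move=> i x /=; rewrite normr0 normr_ge0.
- by move=> _ [f _ <-]; exact: normr_real.
exists (\sum_(x <- s) \prod_(i < N) `|x i|) => _ [f fb <-].
apply: le_trans (ler_norm_sum _ _ _) _; apply: ler_sum => x _.
rewrite normr_prod; apply: ler_prod => i _; rewrite normr_ge0; exact: fb.
Qed.

Lemma injective_norm_le s B :
  (forall f : 'I_N -> {scalar X}, (forall i, dual_unit_ball (f i)) ->
     rn (\sum_(x <- s) \prod_(i < N) f i (x i)) <= B) ->
  rn (\sum_(x <- s) th x) <= B.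
Proof.
move=> H; have [_ nrm _] := thP; rewrite -(@ler_ofR R k) -rnE nrm.
have [_ lub] := inormP s; apply: lub => _ [f fb <-].
by rewrite rnE ler_ofR H.
Qed.

Lemma injective_norm_ge s (f : 'I_N -> {scalar X}) : (forall i, dual_unit_ball (f i)) ->
  rn (\sum_(x <- s) \prod_(i < N) f i (x i)) <= rn (\sum_(x <- s) th x).
Proof.
move=> fb; have [_ nrm _] := thP; rewrite -(@ler_ofR R k) -!rnE nrm.
by have [ub _] := inormP s; apply: ub; exists f.
Qed.

End injective.
End tensor_norms.

(** * Bounded maps, coordinate expansion, growth and truncation *)

Section utilities.
Variables (R : realType) (k : scalar_kind).
Local Notation K := (scalars R k).
Local Notation vec := (nat -> K^o).

Lemma within_continuous_bounded (E F : normedModType K) (A : set E) (f : E -> F) :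
  A 0 -> f 0 = 0 -> {within A, continuous f} ->
  (forall (a : K) x, A x -> A (a *: x) /\ f (a *: x) = a *: f x) ->
  exists2 C : R, 0 < C & forall x, A x -> rn (f x) <= C * rn x.
Proof.
move=> A0 f0 fc fZ.
have := fc (0 : E); rewrite /continuous_at /=.
move=> /(_ (ball (f 0) 1)); rewrite /nbhs /= => /(_ (nbhsx_ballx _ _ ltr01)).
rewrite -(nbhs_subspace_in A0) => /nbhs_ballP[e /= e0 eP].
pose d := rn e; have eE : e = ofR k d by apply: rn_real; exact: ltW.
have d0 : 0 < d by rewrite -(@ltr_ofR R k) ofR0 -eE.
exists (2 / d); first by rewrite divr_gt0.
move=> x Ax; have [x0|x0] := eqVneq (rn x) 0.
  by rewrite (rn0_eq0 x0) f0 !rn0 mulr0.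
have xp : 0 < rn x by rewrite lt_def x0 rn_ge0.
(* This scales x to norm d/2, strictly inside the open ball given by continuity at 0. *)
pose t : R := d / (2 * rn x); have t0 : 0 < t by rewrite divr_gt0 // mulr_gt0.
have [Atx ftx] := fZ (ofR k t) x Ax.
have : ball (f 0) 1 (f (ofR k t *: x)).
  apply: eP => //; rewrite -ball_normE /= sub0r normrN eE rnE ltr_ofR.
  rewrite rnZ rn_ofR gtr0_norm // /t invfM mulrA mulfVK //; lra.
rewrite f0 -ball_normE /= sub0r normrN rnE -(ofR1 R k) ltr_ofR ftx rnZ rn_ofR gtr0_norm //.
move=> h; have : rn (f x) <= t^-1 by rewrite -[t^-1]mulr1 ler_pdivlMl // ltW.
by rewrite /t invf_div => /le_trans; apply; rewrite mulrAC.
Qed.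

Lemma mlin_scale_all (X V : lmodType K) M (th : ('I_M -> X) -> V) (c : 'I_M -> K) (b : 'I_M -> X) :
  mlin th -> th (fun t => c t *: b t) = (\prod_t c t) *: th b.
Proof.
move=> thl.
suff H (r : seq 'I_M) : uniq r ->
    th (fun t => if t \in r then c t *: b t else b t) = (\prod_(t <- r) c t) *: th b.
  rewrite -H ?index_enum_uniq //; congr th; apply/funext => t.
  by rewrite mem_index_enum.
elim: r => [_|t r IH /= /andP[tr ur]].
  by rewrite big_nil scale1r; congr th.
rewrite big_cons -scalerA -IH //.
pose g := fun t' => if t' \in r then c t' *: b t' else b t'.
rewrite -/g; have -> : th g = th (dfwith g t (b t)).
  by congr th; rewrite -[LHS](dfwith_self g t) {2}/g (negPf tr).
rewrite -mlinZ //; congr th; apply/funext => t'; case: dfwithP => [|j tj].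
  by rewrite inE eqxx.
by rewrite inE eq_sym (negPf tj).
Qed.

Definition evec (j : nat) : vec := fun x => (x == j)%:R.

Lemma bnd1_evec j : bnd1 (evec j).
Proof. by move=> x; rewrite /evec; case: eqP => _; rewrite ?rn1 ?rn0. Qed.

Lemma cutvE m (a : vec) : cutv m a = \sum_(j < m) a j *: evec j.
Proof.
apply/funext => x; rewrite sum_vecE /cutv.
have E (j : 'I_m) : (a j *: evec j) x = a j * (x == j)%:R by [].
under eq_bigr do rewrite E.
case: ltnP => xm.
  rewrite (bigD1 (Ordinal xm)) //= eqxx mulr1 big1 ?addr0 // => j.
  by rewrite -val_eqE /= eq_sym => /negPf ->; rewrite mulr0.
rewrite big1 // => j _; rewrite (_ : (x == j) = false) ?mulr0 //.
by apply/negbTE; rewrite neq_ltn (leq_trans (ltn_ord j) xm) orbT.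
Qed.

(** Expanding every slot gives m^M coordinate tuples. The coefficients are summed over the list
    before norms are taken: in the applications it is the cancellation between list entries that
    makes them small. *)
Lemma mlin_coordinates_bound (V : normedModType K) M (th : ('I_M -> vec) -> V) m
    (s : seq ('I_M -> vec)) (del : R) :
  mlin th -> (forall g : 'I_M -> nat, (forall t, (g t < m)%N) ->
     rn ((\sum_(a <- s) \prod_t a t (g t)) *: th (fun t => evec (g t))) <= del) ->
  rn (\sum_(a <- s) th (fun t => cutv m (a t))) <= del * m%:R ^+ M.
Proof.
move=> thl H.
suff IH (r : seq 'I_M) : uniq r -> forall g : 'I_M -> nat,
    (forall t, t \notin r -> (g t < m)%N) ->
    rn (\sum_(a <- s) (\prod_(t | t \notin r) a t (g t)) *:
      th (fun t => if t \in r then cutv m (a t) else evec (g t))) <= del * m%:R ^+ size r.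
  have := IH (index_enum 'I_M) (index_enum_uniq _) (fun=> 0%N).
  have -> : size (index_enum 'I_M) = M.
    by rewrite -[RHS]card_ord cardT /index_enum -enumT.
  rewrite (eq_bigr (fun a => th (fun t => cutv m (a t)))) => [|a _].
    by apply => t; rewrite mem_index_enum.
  rewrite big1 ?scale1r => [|t]; last by rewrite mem_index_enum.
  by congr th; apply/funext => t; rewrite mem_index_enum.
elim: r => [_ g gm|t r IH /= /andP[tr ur] g gm].
  rewrite mulr1; have := H g (fun t => gm t isT); rewrite scaler_suml.
  by congr (rn _ <= _); apply: eq_bigr => a _; congr (_ *: _).
rewrite exprS mulrCA.
pose gj j t' := if t' == t then j else g t'.
have -> : \sum_(a <- s) (\prod_(t' | t' \notin t :: r) a t' (g t')) *:
      th (fun t' => if t' \in t :: r then cutv m (a t') else evec (g t')) =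
   \sum_(j < m) \sum_(a <- s) (\prod_(t' | t' \notin r) a t' (gj j t')) *:
      th (fun t' => if t' \in r then cutv m (a t') else evec (gj j t')).
  rewrite exchange_big; apply: eq_bigr => a _ /=.
  pose h t' := if t' \in r then cutv m (a t') else evec (g t').
  have -> : (fun t' => if t' \in t :: r then cutv m (a t') else evec (g t')) =
      dfwith h t (\sum_(j < m) a t j *: evec j).
    apply/funext => t'; case: dfwithP => [|j tj]; first by rewrite mem_head cutvE.
    by rewrite inE eq_sym (negPf tj).
  rewrite mlin_sum // scaler_sumr; apply: eq_bigr => j _.
  rewrite scalerA; congr (_ *: th _).
    rewrite [RHS](bigD1 t) //= /gj eqxx mulrC; congr (_ * _).
    apply: eq_big => [t'|t']; first by rewrite inE negb_or andbC.
    by rewrite inE negb_or => /andP[/negPf -> _].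
  apply/funext => t'; case: dfwithP => [|t'' tt''].
    by rewrite (negPf tr) /gj eqxx.
  by rewrite /h /gj eq_sym (negPf tt'').
apply: le_trans (rn_sum _ _ _) _.
have -> : m%:R * (del * m%:R ^+ size r) = \sum_(j < m) del * m%:R ^+ size r.
  by rewrite sumr_const card_ord -[RHS]mulr_natl.
apply: ler_sum => j _; apply: IH => // t' t'r; rewrite /gj.
by case: eqP => [_//|/eqP t't]; apply: gm; rewrite inE negb_or t't.
Qed.

(** The right side has degree p >= M in L, the left only M - 1. The 8 comes from L + 3 <= 8 (L/2),
    and L + 3 from using the upper bound with 2^(L+1) terms. *)
Lemma growth (M p : nat) (C : R) : (0 < M)%N -> (M <= p)%N -> 0 <= C -> exists L : nat,
  C * (M%:R * L.+3%:R ^+ M.-1 + 1) < (L%:R / 2) ^+ p.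
Proof.
move=> M0 Mp C0.
pose D : R := C * (M%:R * 8 ^+ M.-1 + 1).
have D0 : 0 <= D by rewrite mulr_ge0 // addr_ge0 ?mulr_ge0 ?exprn_ge0.
pose L := (Num.truncn D).+1.*2.+2.
have LD : D < L%:R / 2.
  have /andP[_ h] := truncn_itv D0; apply: lt_trans h _.
  by rewrite /L -addn2 -muln2 natrD natrM; lra.
have L1 : 1 <= L%:R / 2 :> R.
  rewrite /L -addn2 natrD; have : 0 <= ((Num.truncn D).+1.*2)%:R :> R by []; lra.
exists L; apply: (@lt_le_trans _ _ ((L%:R / 2) ^+ M)); last by rewrite ler_weXn2l.
rewrite -[in ltRHS](prednK M0) exprS.
have e1 : L.+3%:R ^+ M.-1 <= 8 ^+ M.-1 * (L%:R / 2) ^+ M.-1 :> R.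
  rewrite -exprMn lerXn2r ?nnegrE //.
  by rewrite -addn3 natrD; lra.
have e2 : 1 <= (L%:R / 2) ^+ M.-1 :> R by rewrite exprn_ege1.
apply: (@le_lt_trans _ _ (D * (L%:R / 2) ^+ M.-1)).
  rewrite /D -mulrA ler_wpM2l // mulrDl mul1r lerD // -mulrA ler_wpM2l //.
by rewrite ltr_pM2r // (lt_le_trans ltr01).
Qed.

Section cut_approximation.
Variables (X T : normedModType K) (M : nat) (th : ('I_M -> X) -> T) (cut : nat -> X -> X).
Hypotheses (thl : mlin th) (thb : forall x, rn (th x) <= \prod_t rn (x t)).
Hypotheses (cut_le : forall m x, rn (cut m x) <= rn x)
  (cut_cvg : forall x e, 0 < e -> exists m0, forall m, (m0 <= m)%N -> rn (x - cut m x) <= e).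

Lemma mlin_cut_approx (x : 'I_M -> X) e : 0 < e -> exists m0, forall m,
  (m0 <= m)%N -> rn (th x - th (fun t => cut m (x t))) <= e.
Proof.
move=> e0.
pose B := 1 + \sum_t rn (x t).
have B1 : 1 <= B by rewrite lerDl; apply: sumr_ge0 => t _; exact: rn_ge0.
have xB t : rn (x t) <= B.
  rewrite /B (bigD1 t) //= addrCA lerDl addr_ge0 //.
  by apply: sumr_ge0 => t' _; exact: rn_ge0.
have BM : 0 < B ^+ M by rewrite exprn_gt0 // (lt_le_trans ltr01).
pose d := e / (M.+1%:R * B ^+ M).
have d0 : 0 < d by rewrite divr_gt0 // mulr_gt0.
have /choice[m1 Hm1] : forall t, exists m0, forall m, (m0 <= m)%N -> rn (x t - cut m (x t)) <= d.
  by move=> t; exact: cut_cvg.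
exists (\max_t m1 t) => m mm.
have -> : th x = th (fun t => cut m (x t) + (x t - cut m (x t))).
  by congr th; apply/funext => t; rewrite addrC subrK.
rewrite mlin_telescope //; apply: le_trans (rn_sum _ _ _) _.
apply: (@le_trans _ _ (\sum_(s < M) d * B ^+ M)); last first.
  rewrite sumr_const card_ord -[leLHS]mulr_natl /d.
  have M0 : 0 < M.+1%:R :> R by rewrite ltr0n.
  rewrite (_ : M%:R * _ = e * (M%:R / M.+1%:R)); last by field; rewrite !gt_eqF.
  by rewrite ler_piMr ?(ltW e0) // ler_pdivrMr // mul1r ler_nat.
apply: ler_sum => s _; apply: le_trans (thb _) _.
rewrite (bigD1 s) //= dfwithin; apply: ler_pM.
- exact: rn_ge0.
- by apply: prodr_ge0 => t _; exact: rn_ge0.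
- by apply: Hm1; rewrite (leq_trans _ mm) // leq_bigmax.
apply: (@le_trans _ _ (\prod_(t < M | t != s) B)).
  apply: ler_prod => t ts; rewrite rn_ge0 dfwithout 1?eq_sym //=.
  case: ifP => _; first by rewrite addrC subrK.
  exact: le_trans (cut_le _ _) (xB t).
rewrite prodr_const; apply: ler_weXn2l => //.
by rewrite -[leqRHS](card_ord M) max_card.
Qed.

Lemma mlin_list_approx (s : seq ('I_M -> X)) e : 0 < e -> exists m0, forall m,
  (m0 <= m)%N -> rn (\sum_(x <- s) th x - \sum_(x <- s) th (fun t => cut m (x t))) <= e.
Proof.
elim: s e => [|x s IH] e e0.
  by exists 0%N => m _; rewrite !big_nil subrr rn0 ltW.
have e2 : 0 < e / 2 by lra.
have [m1 H1] := mlin_cut_approx x e2; have [m2 H2] := IH _ e2.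
exists (maxn m1 m2) => m; rewrite geq_max => /andP[/H1 h1 /H2 h2].
rewrite !big_cons opprD addrACA; apply: le_trans (rnD _ _) _.
by apply: le_trans (lerD h1 h2) _; lra.
Qed.

End cut_approximation.

End utilities.

(** * Truncation in c_0 and measures from lists of tuples *)

Section null_sequences.
Variables (R : realType) (k : scalar_kind).
Local Notation K := (scalars R k).
Local Notation vec := (nat -> K^o).

Lemma c0cut_subproof m (a : vec) : cutv m a \in @c0_seq R k.
Proof.
apply/asboolP; apply: cvg_near_cst; exists m => // n /= mn.
by rewrite /cutv ltnNge mn.
Qed.

Definition c0cut m a : c0 R k := C0 (c0cut_subproof m a).

Lemma c0E (x : K) (u v : c0 R k) j : (x *: u + v) j = x * u j + v j.
Proof. by []. Qed.

Lemma c0cut_linear m (x : K) (a b : vec) : c0cut m (x *: a + b) = x *: c0cut m a + c0cut m b.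
Proof.
apply/val_inj/funext => j; rewrite [RHS]c0E /= /cutv.
by case: ifP => // _; rewrite mulr0 addr0.
Qed.

Lemma mlin_c0cut (V : lmodType K) M m (th : ('I_M -> c0 R k) -> V) :
  mlin th -> mlin (fun a : 'I_M -> vec => th (fun t => c0cut m (a t))).
Proof.
move=> thl i x a u v.
have E w : (fun t => c0cut m (dfwith x i w t)) = dfwith (fun t => c0cut m (x t)) i (c0cut m w).
  by apply/funext => t; case: dfwithP => [|j ij]; rewrite ?dfwithin // dfwithout.
by rewrite !E c0cut_linear thl.
Qed.

Lemma mlin_cutv (V : lmodType K) M m (th : ('I_M -> vec) -> V) :
  mlin th -> mlin (fun a : 'I_M -> vec => th (fun t => cutv m (a t))).
Proof.
move=> thl i x a u v.
have E w : (fun t => cutv m (dfwith x i w t)) = dfwith (fun t => cutv m (x t)) i (cutv m w).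
  by apply/funext => t; case: dfwithP => [|j ij]; rewrite ?dfwithin // dfwithout.
rewrite !E -thl; congr (th (dfwith _ _ _)); apply/funext => j.
rewrite -[RHS]/(a * cutv m u j + cutv m v j) /cutv.
by case: ifP => // _; rewrite mulr0 addr0.
Qed.

Lemma rn_c0_le (x : c0 R k) B : (forall j, rn (x j : K) <= B) -> rn x <= B.
Proof.
move=> xB; rewrite -(@ler_ofR R k) -rnE; apply: c0_norm_le => j.
by rewrite (rnE (x j : K)) ler_ofR.
Qed.

Lemma rn_c0_ge (x : c0 R k) j : rn (x j : K) <= rn x.
Proof. by rewrite -(@ler_ofR R k) -!rnE; exact: c0_norm_ge. Qed.

Lemma c0cut_bnd1 m a : bnd1 a -> rn (c0cut m a) <= 1.
Proof. by move=> a1; apply: rn_c0_le => j; exact: bnd1_cutv. Qed.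

Lemma c0cut_approx (x : c0 R k) e : 0 < e -> exists m0, forall m, (m0 <= m)%N ->
  rn (x - c0cut m x) <= e.
Proof.
move=> e0; have eK : 0 < ofR k e by rewrite -(ofR0 R k) ltr_ofR.
have /asboolP x0 := c0_valP x.
have /cvgrPdist_le /(_ _ eK) [m0 _ H] := x0.
exists m0 => m m0m; apply: rn_c0_le => j.
rewrite -[(x - c0cut m x) j]/(x j - cutv m x j) /cutv.
have [jm|mj] := ltnP j m; first by rewrite subrr rn0 ltW.
rewrite subr0 -(@ler_ofR R k) -rnE.
by have := H j (leq_trans m0m mj); rewrite /= sub0r normrN.
Qed.

Lemma c0cut_cutv m m' a : (m <= m')%N -> c0cut m' (cutv m a) = c0cut m a.
Proof.
move=> mm'; apply/val_inj/funext => j /=; rewrite /cutv.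
by case: ltnP => // jm'; case: ltnP => // jm; have := leq_trans jm mm'; rewrite ltnNge jm'.
Qed.

Lemma rn_c0cut_le m x : rn (c0cut m (c0_val x)) <= rn x.
Proof.
apply: rn_c0_le => j /=; rewrite /cutv; case: ifP => _; first exact: rn_c0_ge.
by rewrite rn0 rn_ge0.
Qed.

Section approximation.
Variables (M : nat) (T : completeNormedModType K) (th : ('I_M -> c0 R k) -> T).
Hypothesis thP : projective_tensor th.

Lemma c0_tensor_approx z e : 0 < e -> exists m (s : seq ('I_M -> vec)),
  rn (z - \sum_(a <- s) th (fun t => c0cut m (a t))) <= e /\
  \sum_(a <- s) \prod_t rn (c0cut m (a t)) <= rn z + e.
Proof.
move=> e0; have e2 : 0 < e / 2 by lra.
have [s [s1 s2]] := projective_approx thP z e2.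
have [thl _ _] := thP.
have [m /(_ m (leqnn m)) H] := mlin_list_approx thl (projective_elementary thP)
  (cut := fun m (x : c0 R k) => c0cut m (c0_val x)) rn_c0cut_le c0cut_approx s e2.
exists m, [seq (fun t => c0_val (x t)) | x <- s]; rewrite !big_map; split.
  have -> : z - \sum_(j <- s) th (fun t => c0cut m (j t)) =
    (z - \sum_(x <- s) th x) + (\sum_(x <- s) th x - \sum_(x <- s) th (fun t => c0cut m (x t))).
    by rewrite addrA subrK.
  by apply: le_trans (rnD _ _) _; apply: le_trans (lerD s1 H) _; lra.
apply: (@le_trans _ _ (\sum_(x <- s) \prod_(i < M) rn (x i))).
  apply: ler_sum => x _; apply: ler_prod => t _; rewrite rn_ge0; exact: rn_c0cut_le.
by apply: le_trans s2 _; lra.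
Qed.

End approximation.

(** Each slot is divided by its norm and the product of the norms becomes a weight, relative to C.
    The missing mass sits on the zero tuple, where a multilinear map in M > 0 slots vanishes. *)
Lemma measure_of_list M (s : seq ('I_M -> vec)) m (C : R) : (0 < M)%N -> 0 < C ->
  \sum_(a <- s) \prod_t rn (c0cut m (a t)) <= C ->
  exists mu : pmeasure R k M, forall (V : normedModType K) (F : ('I_M -> vec) -> V),
    mlin F -> \sum_(a <- s) F (fun t => cutv m (a t)) = ofR k C *: mint mu F.
Proof.
move=> M0 C0 sC.
pose N a : R := \prod_(t < M) rn (c0cut m (a t)).
pose a_ l := nth (fun _ _ => 0) s l.
pose wt l := if (l < size s)%N then N (a_ l) / C else 1 - \sum_(l < size s) N (a_ l) / C.
pose pt l t : vec := if (l < size s)%N then ofR k (rn (c0cut m (a_ l t)))^-1 *: cutv m (a_ l t) else 0.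
have N0 a : 0 <= N a by apply: prodr_ge0 => t _; exact: rn_ge0.
have sE (W : zmodType) (G : ('I_M -> vec) -> W) : \sum_(a <- s) G a = \sum_(l < size s) G (a_ l).
  by rewrite (big_nth (fun _ _ => 0)) big_mkord.
have wt0 l : (l < (size s).+1)%N -> 0 <= wt l.
  move=> _; rewrite /wt; case: ifP => _; first by rewrite divr_ge0 // ltW.
  by rewrite subr_ge0 -mulr_suml ler_pdivrMr // mul1r; move: sC; rewrite sE.
have wt1 : \sum_(l < (size s).+1) wt l = 1.
  rewrite big_ord_recr /= {2}/wt ltnn; under eq_bigr do rewrite /wt ltn_ord.
  by rewrite addrC subrK.
have pt1 l t : (l < (size s).+1)%N -> bnd1 (pt l t).
  move=> _ j; rewrite /pt; case: ifP => _; last by rewrite rn0.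
  have := rnM (ofR k (rn (c0cut m (a_ l t)))^-1) (cutv m (a_ l t) j).
  rewrite -[_ * _]/((_ *: cutv m (a_ l t)) j) => ->; rewrite rn_ofR ger0_norm ?invr_ge0 ?rn_ge0 //.
  have := rn_c0_ge (c0cut m (a_ l t)) j; rewrite -[c0cut m (a_ l t) j]/(cutv m (a_ l t) j).
  have := rn_ge0 (c0cut m (a_ l t)); move: (rn _) => r; rewrite le_eqVlt => /predU1P[<-|r0] h.
    by rewrite invr0 mul0r.
  by rewrite ler_pdivrMl // mulr1.
exists (PMeasure wt0 wt1 pt1) => V F Fl; rewrite /mint /= big_ord_recr /=.
have F0 (b : 'I_M -> vec) : (forall t, b t = 0) -> F b = 0.
  move=> b0; rewrite -(dfwith_self b (Ordinal M0)) b0; exact: mlin0.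
rewrite F0 ?scaler0 ?addr0; last by move=> t; rewrite /pt ltnn.
rewrite scaler_sumr sE; apply: eq_bigr => l _.
rewrite scalerA -ofRM /wt ltn_ord mulrC divfK ?gt_eqF //.
have -> : (fun t => cutv m (a_ l t)) = fun t => ofR k (rn (c0cut m (a_ l t))) *: pt l t.
  apply/funext => t; rewrite /pt ltn_ord scalerA -ofRM.
  have [r0|r0] := eqVneq (rn (c0cut m (a_ l t))) 0; last by rewrite divff // ofR1 scale1r.
  by rewrite r0 mul0r ofR0 scale0r; have /(congr1 (@c0_val R k)) := rn0_eq0 r0.
by rewrite (mlin_scale_all _ _ Fl) -rmorph_prod.
Qed.

End null_sequences.

(** * Sequences of nearly agreeing pairs, and test vectors *)

Section pairs.
Variables (R : realType) (k : scalar_kind).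
Local Notation K := (scalars R k).

(** The tests for the i-th pair may depend on [p i], which exceeds every index chosen before; thus a
    pair can be made to agree nearly on all coordinates that earlier pairs occupy. *)
Lemma pair_sequence (T_ : nat -> nat -> finType) (P : nat -> nat -> Prop)
    (g_ : forall i q, nat -> T_ i q -> K) (C e : nat -> nat -> R) :
  (forall i, infin (P i)) -> (forall i q x c, rn (g_ i q x c) <= C i q) ->
  (forall i q, 0 < e i q) ->
  exists p a b : nat -> nat, forall i, [/\ (p i <= a i < b i)%N /\ (b i < p i.+1)%N,
    P i (a i), P i (b i) &
    forall c, rn (g_ i (p i) (a i) c - g_ i (p i) (b i) c) <= e i (p i)].
Proof.
move=> Pinf gC e0.
have H (iq : nat * nat) : exists ab : nat * nat, [/\ (iq.2 <= ab.1 < ab.2)%N,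
    P iq.1 ab.1, P iq.1 ab.2 &
    forall c, rn (g_ iq.1 iq.2 ab.1 c - g_ iq.1 iq.2 ab.2 c) <= e iq.1 iq.2].
  case: iq => i q /=.
  have [Q [Qinf QP Qe]] := infin_close (e0 i q) (Pinf i) (gC i q).
  have [x qx Qx] := Qinf q; have [y xy Qy] := Qinf x.+1.
  exists (x, y) => /=; split; rewrite ?qx //; [exact: QP|exact: QP|].
  by move=> c; exact: Qe.
have [f fP] := choice H.
pose p := fix p i := if i is j.+1 then (f (j, p j)).2.+1 else 0%N.
exists p, (fun i => (f (i, p i)).1), (fun i => (f (i, p i)).2) => i.
by have [? ? ? ?] := fP (i, p i); split.
Qed.

Variable p : nat.

Lemma mlin_hform (X : lmodType K) n (phi : 'I_p.+1 -> nat -> X -> K) :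
  (forall t j x u v, phi t j (x *: u + v) = x * phi t j u + phi t j v) ->
  mlin (fun x : 'I_p.+1 -> X => hform n (fun t j => phi t j (x t)) : K^o).
Proof.
move=> phil i x c u v.
have E0 (z : K^o) : c *: z = c * z by [].
rewrite E0 /hform mulr_sumr -big_split; apply: eq_bigr => I _ /=.
have E w : \prod_t phi t (ix I t) (dfwith x i w t) =
    phi i (ix I i) w * \prod_(t | t != i) phi t (ix I t) (x t).
  rewrite (bigD1 i) //= dfwithin; congr (_ * _); apply: eq_bigr => t ti.
  by rewrite dfwithout // eq_sym.
by rewrite !E phil; ring.
Qed.

Lemma hform_norm_bound (A : R) n (x : 'I_p.+1 -> c0 R k) (pos : 'I_p.+1 -> nat -> nat) :
  (forall y : 'I_p.+1 -> nat -> K, (forall t j, (j < n)%N -> rn (y t j) <= 1) ->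
     rn (hform n y) <= A) ->
  rn (hform n (fun t j => x t (pos t j))) <= A * \prod_t rn (x t).
Proof.
move=> HA; pose u t : c0 R k := ofR k (rn (x t))^-1 *: x t.
have ul : mlin (fun x : 'I_p.+1 -> c0 R k =>
    hform n (fun t j => (x t : c0 R k) (pos t j) : K) : K^o).
  by apply: (@mlin_hform _ n (fun t j (y : c0 R k) => y (pos t j))).
have xu : x = fun t => ofR k (rn (x t)) *: u t.
  apply/funext => t; rewrite /u scalerA -ofRM.
  have [r0|r0] := eqVneq (rn (x t)) 0; last by rewrite divff // ofR1 scale1r.
  by rewrite r0 mul0r ofR0 scale0r (rn0_eq0 r0).
have -> : hform n (fun t j => x t (pos t j)) =
    (\prod_t ofR k (rn (x t))) * hform n (fun t j => u t (pos t j)).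
  by rewrite {1}xu; exact: (mlin_scale_all (fun t => ofR k (rn (x t))) u ul).
rewrite rnM -rmorph_prod /= rn_ofR ger0_norm; last by apply: prodr_ge0 => t _; exact: rn_ge0.
rewrite mulrC ler_wpM2r //; first by apply: prodr_ge0 => t _; exact: rn_ge0.
apply: HA => t j _; apply: le_trans (rn_c0_ge (u t) (pos t j)) _.
rewrite /u rnZ rn_ofR ger0_norm ?invr_ge0 ?rn_ge0 //.
have := rn_ge0 (x t); move: (rn _) => r; rewrite le_eqVlt => /predU1P[<-|r0].
  by rewrite invr0 mul0r.
by rewrite mulVf // gt_eqF.
Qed.

(* [tri q] is e_q ⊗ s_q ⊗ ... ⊗ s_q with s_q = e_0 + ... + e_(q-1), where slot t lives on
   the residue class of t modulo p + 1, so that permuting the slots can be detected. *)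
Definition tri (q : nat) (t : 'I_p.+1) : c0 R k :=
  if t == ord0 then c0cut (p.+1 * q).+1 (evec R k (p.+1 * q))
  else c0cut (p.+1 * q) (fun x => ((x %% p.+1)%N == t)%:R).

Lemma rn_tri q t : rn (tri q t) <= 1.
Proof.
rewrite /tri; case: ifP => _; apply: c0cut_bnd1; first exact: bnd1_evec.
by move=> x; case: eqP => _; rewrite ?rn1 ?rn0.
Qed.

Lemma tri_eval q (t t' : 'I_p.+1) c : tri q t' (p.+1 * c + t)%N =
  ((t == t') && (if t == ord0 then c == q else c < q)%N)%:R.
Proof.
have m1 : ((p.+1 * c + t) %% p.+1 = t)%N by rewrite mulnC modnMDl modn_small.
have d1 : ((p.+1 * c + t) %/ p.+1 = c)%N by rewrite mulnC divnMDl // divn_small ?addn0.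
rewrite /tri; have [->|t'0] := eqVneq t' ord0; rewrite /= /cutv.
  rewrite /evec; have [->|t0] := eqVneq t ord0.
    rewrite /= addn0 eqn_pmul2l // ltnS leq_pmul2l //.
    by case: eqP => [->|_]; rewrite ?leqnn //; case: ifP.
  have /negbTE -> : (p.+1 * c + t != p.+1 * q)%N.
    apply: contra t0 => /eqP E; apply/eqP/val_inj; rewrite /= -m1 E.
    by rewrite modnMr.
  by case: ifP.
rewrite m1 -val_eqE /=; have [tt|tt] := eqVneq (t : nat) t'; last by case: ifP.
have -> : (t == ord0) = false.
  by apply/negbTE; apply: contra t'0 => /eqP t0; apply/eqP/val_inj; rewrite /= -tt t0.
have -> : (p.+1 * c + t < p.+1 * q)%N = (c < q)%N.
  rewrite -{2}d1 ltn_divLR // [(q * _)%N]mulnC //.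
by case: ifP.
Qed.

End pairs.

(** * Quantitative isomorphisms, quotients and weighted sums *)

Section isomorphism_bounds.
Variables (R : realType) (k : scalar_kind).
Local Notation K := (scalars R k).

(** The inverse [g] inherits homogeneity from [f], so both bounds come from
    [within_continuous_bounded]. *)
Lemma submod_isomorphism_bounds (E F : normedModType K) (A : set E) (B : set F)
    (f : E -> F) (g : F -> E) :
  A 0 -> (forall (c : K) x y, A x -> A y -> A (c *: x + y)) ->
  set_fun A B f -> set_fun B A g ->
  {in A, cancel f g} -> {in B, cancel g f} ->
  (forall (c : K) (x y : E), A x -> A y -> f (c *: x + y) = c *: f x + f y) ->
  {within A, continuous f} -> {within B, continuous g} ->
  exists2 C : R, 0 < C &
    forall x, A x -> rn (f x) <= C * rn x /\ rn x <= C * rn (f x).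
Proof.
move=> A0 Alin fAB gBA fK gK flin fc gc.
have f0 : f 0 = 0.
  have := flin 1 0 0 A0 A0; rewrite scaler0 addr0 scale1r => h.
  by apply: (@addrI _ (f 0)); rewrite -h addr0.
have AZ c x : A x -> A (c *: x) by move=> Ax; have := Alin c x 0 Ax A0; rewrite addr0.
have fZ c x : A x -> f (c *: x) = c *: f x.
  by move=> Ax; have := flin c x 0 Ax A0; rewrite f0 !addr0.
have [C C0 HC] := within_continuous_bounded A0 f0 fc
  (fun c x Ax => conj (AZ c x Ax) (fZ c x Ax)).
have B0 : B 0 by rewrite -f0; exact: fAB.
have g0 : g 0 = 0 by rewrite -f0 fK // inE.
have gZ c y : B y -> B (c *: y) /\ g (c *: y) = c *: g y.
  move=> By; have Ag := gBA _ By; have -> : c *: y = f (c *: g y).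
    by rewrite fZ // gK // inE.
  by split; [apply/fAB/AZ|rewrite fK // inE; exact: AZ].
have [C' C'0 HC'] := within_continuous_bounded B0 g0 gc gZ.
exists (C + C'); first by rewrite addr_gt0.
move=> x Ax; split.
  by apply: le_trans (HC x Ax) _; rewrite ler_wpM2r ?rn_ge0 // lerDl ltW.
rewrite -[x in leLHS]fK ?inE //; apply: le_trans (HC' _ (fAB _ Ax)) _.
by rewrite ler_wpM2r ?rn_ge0 // lerDr ltW.
Qed.

Lemma additive_on_sum (E F : normedModType K) (A : set E) (f : E -> F) (I : Type)
    (r : seq I) (c : I -> K) (x : I -> E) :
  A 0 -> (forall (c : K) x y, A x -> A y -> A (c *: x + y)) ->
  (forall (c : K) (x y : E), A x -> A y -> f (c *: x + y) = c *: f x + f y) ->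
  (forall i, A (x i)) ->
  A (\sum_(i <- r) c i *: x i) /\
  f (\sum_(i <- r) c i *: x i) = \sum_(i <- r) c i *: f (x i).
Proof.
move=> A0 Alin flin Ax.
have f0 : f 0 = 0.
  have := flin 1 0 0 A0 A0; rewrite scaler0 addr0 scale1r => h.
  by apply: (@addrI _ (f 0)); rewrite -h addr0.
elim: r => [|i r [IHA IHf]]; first by rewrite !big_nil.
rewrite !big_cons; split; first exact: Alin.
by rewrite flin // IHf.
Qed.

(** Sequences of tuples carry no coefficients; each coefficient is moved into slot 0, which exists
    because N > 0. *)
Lemma projective_form_weighted (X : normedModType K) N (T : completeNormedModType K)
    (th : ('I_N -> X) -> T) (Phi : ('I_N -> X) -> K^o) (B : R)
    (I : Type) (r : seq I) (c : I -> K) (x : I -> 'I_N -> X) :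
  (0 < N)%N -> projective_tensor th -> 0 <= B ->
  mlin Phi -> (forall x, rn (Phi x : K) <= B * \prod_(i < N) rn (x i)) ->
  rn (\sum_(i <- r) c i * Phi (x i)) <= B * rn (\sum_(i <- r) c i *: th (x i)).
Proof.
move=> N0 thP B0 Phil PB; have [thl _ _] := thP.
pose t0 := Ordinal N0; pose y i := dfwith (x i) t0 (c i *: x i t0).
have := projective_form thP [seq y i | i <- r] B0 Phil PB; rewrite !big_map /y.
have e1 i : th (dfwith (x i) t0 (c i *: x i t0)) = c i *: th (x i).
  by rewrite mlinZ // dfwith_self.
have e2 i : Phi (dfwith (x i) t0 (c i *: x i t0)) = c i * Phi (x i).
  by rewrite mlinZ // dfwith_self.
under [X in rn X <= _ -> _]eq_bigr do rewrite e2.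
by under [X in _ <= _ * rn X -> _]eq_bigr do rewrite e1.
Qed.

Lemma quotient_lift (E Q : normedModType K) (Z : set E) (q : {linear E -> Q}) (y : Q) :
  quotient_map Z q ->
  (forall x, rn (q x) <= rn x) /\ exists2 z, q z = y & rn z <= rn y + 1.
Proof.
move=> [qker qsurj qnorm].
have Z0 : Z 0 by apply/qker; rewrite linear0.
have infP x : infimums [set `|x - z| | z in Z] `|q x|.
  by rewrite qnorm; apply: infimumP => [|_ [z _ <-]//]; exists `|x - 0|, 0.
split=> [x|].
  by rewrite -rn_le; have [lb _] := infP x; apply: lb; exists 0 => //; rewrite subr0.
have : range q y by rewrite qsurj.
move=> [z0 _ qz0]; apply: contrapT => /forall2NP h.
have [_ ub] := infP z0.
have : ofR k (rn y + 1) <= `|q z0|.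
  apply: ub => _ [z Zz <-]; rewrite rnE ler_ofR leNgt; apply/negP => lt.
  have [|/negP] := h (z0 - z); first by rewrite linearB /= (qker z).2 // subr0.
  by rewrite ltW.
rewrite rnE ler_ofR qz0; lra.
Qed.

Lemma hform_ext p n (y y' : 'I_p.+1 -> nat -> K) :
  (forall t j, (j < n)%N -> y t j = y' t j) -> hform n y = hform n y'.
Proof.
move=> yy'; apply: eq_bigr => I _; congr (_ * _); apply: eq_bigr => t _; exact: yy'.
Qed.

Lemma hform_zero p n (y : 'I_p.+1 -> nat -> K) t0 : (forall j, y t0 j = 0) -> hform n y = 0.
Proof.
move=> y0; rewrite /hform big1 // => I _.
by rewrite (bigD1 t0) //= y0 mul0r mulr0.
Qed.

Lemma mlin_coordinate M (g : 'I_M -> nat) :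
  mlin (fun a : 'I_M -> nat -> K^o => (\prod_t (a t (g t) : K)) : K^o).
Proof.
move=> i x c u v.
have E0 (z : K^o) : c *: z = c * z by [].
have E w : \prod_t (dfwith x i w t (g t) : K) = w (g i) * \prod_(t | t != i) (x t (g t) : K).
  rewrite (bigD1 i) //= dfwithin; congr (_ * _); apply: eq_bigr => t ti.
  by rewrite dfwithout // eq_sym.
by rewrite E0 !E mulrA -mulrDl.
Qed.

Lemma mlinB_fun (X V : lmodType K) M (F G : ('I_M -> X) -> V) :
  mlin F -> mlin G -> mlin (fun a => F a - G a).
Proof.
by move=> Fl Gl i x c u v; rewrite Fl Gl opprD addrACA -scalerBr.
Qed.

Lemma increasing_upto (s : nat -> nat) n : (forall i, (i < n)%N -> (s i < s i.+1)%N) ->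
  forall i j, (i < j)%N -> (j <= n)%N -> (s i < s j)%N.
Proof.
move=> sinc i; elim=> // j IH; rewrite ltnS leq_eqVlt => /predU1P[->|ij] jn; first exact: sinc.
exact: ltn_trans (IH ij (ltnW jn)) (sinc _ jn).
Qed.

End isomorphism_bounds.

(** * Upper bound for bounded sequences in projective powers of c_0 *)

Section projective_case.
Variables (R : realType) (k : scalar_kind) (M p : nat).
Local Notation K := (scalars R k).
Local Notation vec := (nat -> K^o).

Section bounded_sequence.
Variables (TM : completeNormedModType K) (th : ('I_M -> c0 R k) -> TM).
Hypotheses (thP : projective_tensor th) (M0 : (0 < M)%N).

(* The terms of each pair nearly agree on the coordinates used by the earlier pairs, so
   that, up to a small error, z (a i) - z (b i) is a difference of two cuts. *)
Lemma differences_bound (C : R) (z : nat -> TM) (L : nat) : 0 <= C ->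
  (forall q, rn (z q) <= C) ->
  exists a b : nat -> nat,
    (forall i j, (i < j)%N -> (j < 2 ^ L)%N -> (a i < a j)%N) /\
    (forall i j, (i < 2 ^ L)%N -> (j < 2 ^ L)%N -> a i != b j) /\
    rn (\sum_(i < 2 ^ L) (z (a i) - z (b i))) <=
      (2 * (C + 1) + 3) * (M%:R * L.+2%:R ^+ M.-1 + 1).
Proof.
move=> C0 zC; have [thl _ _] := thP.
set n := (2 ^ L)%N; have n0 : 0 < n%:R :> R by rewrite ltr0n expn_gt0.
have n1 : 1 <= n%:R :> R by rewrite ler1n expn_gt0.
pose e : R := n%:R^-1; have e0 : 0 < e by rewrite invr_gt0.
have e1 : e <= 1 by rewrite invf_le1.
pose C1 := C + 1; have C10 : 0 < C1 by rewrite /C1; lra.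
have /choice[m_ /choice[s_ sP]] : forall q, exists m (s : seq ('I_M -> vec)),
    rn (z q - \sum_(a <- s) th (fun t => c0cut m (a t))) <= e /\
    \sum_(a <- s) \prod_t rn (c0cut m (a t)) <= C1.
  move=> q; have [m [s [s1 s2]]] := c0_tensor_approx thP (z q) e0.
  by exists m, s; split => //; apply: le_trans s2 _; rewrite /C1 lerD.
pose mm q := (\max_(j < q) m_ j)%N.
have mm_mono : {homo mm : i j / (i <= j)%N}.
  move=> i j ij; apply/bigmax_leqP => l _.
  exact: (leq_bigmax (Ordinal (leq_trans (ltn_ord l) ij))).
have mm_ge q j : (j < q)%N -> (m_ j <= mm q)%N by move=> jq; exact: (leq_bigmax (Ordinal jq)).
(* The coefficient at g of the approximant of [z q]. It is bounded by C1 for every g, so that pairs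
   can be selected by pigeonhole. *)
pose zc q (g : 'I_M -> nat) : K := \sum_(a <- s_ q) \prod_t cutv (m_ q) (a t) (g t).
have zcC q g : rn (zc q g) <= C1.
  have [_ h] := sP q; apply: le_trans h; apply: le_trans (rn_sum _ _ _) _.
  apply: ler_sum => a _; rewrite rn_prod; apply: ler_prod => t _; rewrite rn_ge0 /=.
  exact: (rn_c0_ge (c0cut (m_ q) (a t))).
(* The tolerance e is shared among the (mm q)^M coordinate tuples below [mm q]; the 1 keeps the
   denominator positive. *)
have del0 q : 0 < e / ((mm q)%:R ^+ M + 1).
  by rewrite divr_gt0 // ltr_wpDl // exprn_ge0.
have [ps [a [b abP]]] := @pair_sequence R k (fun _ q => {ffun 'I_M -> 'I_(mm q)})
  (fun _ _ => True) (fun _ q x c => zc x (fun t => c t)) (fun _ _ => C1)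
  (fun _ q => e / ((mm q)%:R ^+ M + 1))
  (fun _ n => ex_intro2 _ _ n (leqnn n) I) (fun _ q x c => zcC x _) (fun _ q => del0 q).
have a_ltp i : (a i < ps i.+1)%N.
  by have [[/andP[_ h1] h2] _ _ _] := abP i; exact: ltn_trans h1 h2.
have b_ltp i : (b i < ps i.+1)%N by have [[_ h] _ _ _] := abP i.
have a_ltb i : (a i < b i)%N by have [[/andP[_ h1] h2] _ _ _] := abP i.
have p_lea i : (ps i <= a i)%N by have [[/andP[h _] _] _ _ _] := abP i.
have ps_mono : {homo ps : i j / (i <= j)%N}.
  apply: homo_leq => [//|y x w|i]; first exact: leq_trans.
  exact: leq_trans (p_lea i) (ltnW (a_ltp i)).
pose mcut i := mm (ps i.+1).
have mcut_mono : {homo mcut : i j / (i <= j)%N} by move=> i j ij; apply/mm_mono/ps_mono.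
have ma i : (m_ (a i) <= mcut i)%N by apply: mm_ge.
have mb i : (m_ (b i) <= mcut i)%N by apply: mm_ge.
pose t0 := Ordinal M0.
pose xa q (x : 'I_M -> vec) t := cutv (m_ q) (x t).
(* The sign goes into slot [t0], so that a difference of two approximants is again a plain list of
   tuples, of total size at most 2 C1. *)
pose xn q (x : 'I_M -> vec) := dfwith (xa q x) t0 (- xa q x t0).
pose DL i := [seq xa (a i) x | x <- s_ (a i)] ++ [seq xn (b i) x | x <- s_ (b i)].
have DLsum (V : lmodType K) (F : ('I_M -> vec) -> V) i : mlin F ->
    \sum_(d <- DL i) F d = \sum_(x <- s_ (a i)) F (xa (a i) x) - \sum_(x <- s_ (b i)) F (xa (b i) x).
  move=> Fl; rewrite big_cat !big_map /= -sumrN; congr (_ + _).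
  by apply: eq_bigr => x _; rewrite /xn (mlinN Fl) dfwith_self.
have c0cutN q (v : vec) : c0cut q (- v) = - c0cut q v.
  apply/val_inj/funext => j; rewrite -[RHS]/(- cutv q v j) /= /cutv.
  by case: ifP; rewrite ?oppr0.
have DLC i : \sum_(d <- DL i) \prod_t rn (c0cut (mcut i) (d t)) <= 2 * C1.
  have part q : (m_ q <= mcut i)%N ->
      \sum_(x <- s_ q) \prod_t rn (c0cut (mcut i) (xa q x t)) <= C1.
    move=> mq; have [_ h] := sP q; apply: le_trans h.
    by apply: ler_sum => x _; apply: ler_prod => t _; rewrite rn_ge0 /xa c0cut_cutv // lexx.
  rewrite big_cat !big_map /= mulr2n mulrDl mul1r; apply: lerD; first exact: part.
  apply: le_trans (part (b i) (mb i)); apply: ler_sum => x _; apply: ler_prod => t _.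
  rewrite rn_ge0 /=; rewrite /xn; case: dfwithP => [|t' _] //.
  by rewrite c0cutN rnN.
have C20 : 0 < 2 * C1 by rewrite mulr_gt0.
have /choice[nu nuP] : forall i, exists mu : pmeasure R k M,
    forall (V : normedModType K) (F : ('I_M -> vec) -> V),
    mlin F -> \sum_(d <- DL i) F (fun t => cutv (mcut i) (d t)) = ofR k (2 * C1) *: mint mu F.
  by move=> i; exact: measure_of_list.
have [s [sinc sU]] := spreading_bound nu L mcut_mono.
have slt := increasing_upto sinc.
exists (fun i => a (s i.+1)), (fun i => b (s i.+1)).
have a_mono i j : (i < j)%N -> (b i < a j)%N.
  by move=> ij; apply: leq_trans (b_ltp i) (leq_trans (ps_mono _ _ ij) (p_lea j)).
split; last split.
- by move=> i j ij jn; apply: ltn_trans (a_ltb _) (a_mono _ _ _); exact: slt.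
- move=> i j iN jn; have [h|h|h] := ltngtP i j.
  + by rewrite neq_ltn (ltn_trans (ltn_trans (a_ltb _) (a_mono _ _ _)) (a_ltb _)) // slt.
  + by rewrite neq_ltn orbC a_mono // slt.
  + by rewrite h neq_ltn a_ltb.
pose mS := mcut (s n).
pose thv (x : 'I_M -> vec) := th (fun t => c0cut mS (x t)).
have thvl : mlin thv by exact: mlin_c0cut.
have thvb x : (forall t, bnd1 (x t)) -> rn (thv x) <= 1.
  move=> x1; apply: le_trans (projective_elementary thP _) _.
  by apply: prodr_ile1 => t _; rewrite rn_ge0 c0cut_bnd1.
have := sU TM thv 1 thvl thvb; rewrite mul1r; set G := (_ + 1) => GU.
pose zt q := \sum_(x <- s_ q) th (fun t => c0cut (m_ q) (x t)).
(* The cut at [mcut (s i.+1)] keeps both members of the pair whole. The cut at [mcut (s i)] sees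
   only coordinates in use before the pair was chosen, where its members cancel up to e; the
   increment between the cuts is therefore nearly the difference. *)
have main (i : 'I_n) : rn (zt (a (s i.+1)) - zt (b (s i.+1)) - ofR k (2 * C1) *:
    mint (nu (s i.+1)) (fun x => thv (fun t => cutv (mcut (s i.+1)) (x t)) -
      thv (fun t => cutv (mcut (s i)) (x t)))) <= e.
  set j := s i.+1; have ij : (s i < j)%N by apply: sinc.
  have jS : (mcut j <= mS)%N.
    apply: mcut_mono; have := ltn_ord i; rewrite leq_eqVlt => /predU1P[h|h].
      by rewrite /j h.
    by apply: ltnW; apply: slt.
  have mij : (mcut (s i) <= mcut j)%N by apply: mcut_mono; exact: ltnW.
  have cc m m' (x : vec) : (m <= m')%N -> cutv m (cutv m' x) = cutv m x.
    move=> mm'; apply/funext => y; rewrite /cutv; case: ifP => // ym.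
    by rewrite (leq_trans ym mm').
  have cc' m m' (x : vec) : (m <= m')%N -> cutv m' (cutv m x) = cutv m x.
    move=> mm'; apply/funext => y; rewrite /cutv; case: ifP => //.
    by case: ifP => // ym; rewrite (leq_trans ym mm').
  rewrite -nuP; last by apply: mlinB_fun; exact: mlin_cutv.
  rewrite sumrB opprB.
  have -> : \sum_(d <- DL j) thv (fun t => cutv (mcut j) (cutv (mcut j) (d t))) =
      zt (a j) - zt (b j).
    rewrite (DLsum _ (fun d => thv (fun t => cutv (mcut j) (cutv (mcut j) (d t))))).
      congr (_ - _); apply: eq_bigr => x _; rewrite /thv; congr th; apply/funext => t.
        by rewrite !(cc' _ _ _ (ma j)) c0cut_cutv // (leq_trans (ma j)).
      by rewrite !(cc' _ _ _ (mb j)) c0cut_cutv // (leq_trans (mb j)).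
    exact: (mlin_cutv (mcut j) (mlin_cutv (mcut j) thvl)).
  rewrite [X in rn X](_ : _ =
      \sum_(d <- DL j) thv (fun t => cutv (mcut (s i)) (cutv (mcut j) (d t)))); last first.
    by rewrite addrC subrK.
  under eq_bigr => d _.
    rewrite (_ : (fun t => cutv (mcut (s i)) (cutv (mcut j) (d t))) =
      fun t => cutv (mcut (s i)) (d t)); last first.
      by apply/funext => t; rewrite cc.
  over.
  have mle : (mcut (s i) <= mm (ps j))%N by apply/mm_mono/ps_mono.
  apply: (@le_trans _ _ (e / ((mm (ps j))%:R ^+ M + 1) * (mcut (s i))%:R ^+ M)); last first.
    rewrite -mulrA ler_piMr ?(ltW e0) // mulrC ler_pdivrMr ?mul1r ?ltr_wpDl ?exprn_ge0 //.
    rewrite ler_wpDr // lerXn2r ?nnegrE // ler_nat //.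
  apply: mlin_coordinates_bound => // g gm.
  rewrite rnZ -[leRHS]mulr1; apply: ler_pM; rewrite ?rn_ge0 //; last first.
    by apply: thvb => t; exact: bnd1_evec.
  rewrite (DLsum _ _ _ (mlin_coordinate g)).
  have [_ _ _ H] := abP j.
  pose c := [ffun t => Ordinal (leq_trans (gm t) mle)] : {ffun 'I_M -> 'I_(mm (ps j))}.
  have := H c; rewrite (_ : (fun t => nat_of_ord (c t)) = g) //.
  by apply/funext => t; rewrite ffunE.
pose W (i : 'I_n) := mint (nu (s i.+1)) (fun x => thv (fun t => cutv (mcut (s i.+1)) (x t)) -
      thv (fun t => cutv (mcut (s i)) (x t))).
have G1 : 1 <= G by rewrite /G lerDr mulr_ge0 // exprn_ge0.
(* Besides the main term there are three errors, one from the cancellation and two from the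
   approximants. Each is at most n e = 1 and together they give the 3 in the constant, as G >= 1. *)
have -> : \sum_(i < n) (z (a (s i.+1)) - z (b (s i.+1))) =
    ofR k (2 * C1) *: \sum_(i < n) W i +
    (\sum_(i < n) (zt (a (s i.+1)) - zt (b (s i.+1)) - ofR k (2 * C1) *: W i) +
     \sum_(i < n) (z (a (s i.+1)) - zt (a (s i.+1))) -
     \sum_(i < n) (z (b (s i.+1)) - zt (b (s i.+1)))).
  rewrite scaler_sumr -sumrN -!big_split /=; apply: eq_bigr => i _.
  rewrite [X in _ = _ + X](_ : _ = z (a (s i.+1)) - z (b (s i.+1)) - ofR k (2 * C1) *: W i).
    by rewrite [RHS]addrC subrK.
  rewrite opprB !addrA (ACl (4 * 7 * 3 * (1 * 5) * (6 * 2)))%AC /=.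
  by rewrite !subrr !addr0.
apply: le_trans (rnD _ _) _; rewrite rnZ rn_ofR gtr0_norm //.
have sumn (x : R) : \sum_(i < n) x = n%:R * x by rewrite sumr_const card_ord -[LHS]mulr_natl.
have ne : n%:R * e = 1 by rewrite divff // gt_eqF.
have r1 : rn (\sum_(i < n) (zt (a (s i.+1)) - zt (b (s i.+1)) - ofR k (2 * C1) *: W i)) <= 1.
  apply: le_trans (rn_sum _ _ _) _; rewrite -[leRHS]ne -sumn; apply: ler_sum => i _; exact: main.
have zt1 (x : nat -> nat) : rn (\sum_(i < n) (z (x i) - zt (x i))) <= 1.
  apply: le_trans (rn_sum _ _ _) _; rewrite -[leRHS]ne -sumn; apply: ler_sum => i _.
  by have [] := sP (x i).
have := rnB (\sum_(i < n) (zt (a (s i.+1)) - zt (b (s i.+1)) - ofR k (2 * C1) *: W i) +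
     \sum_(i < n) (z (a (s i.+1)) - zt (a (s i.+1))))
     (\sum_(i < n) (z (b (s i.+1)) - zt (b (s i.+1)))).
have := rnD (\sum_(i < n) (zt (a (s i.+1)) - zt (b (s i.+1)) - ofR k (2 * C1) *: W i))
     (\sum_(i < n) (z (a (s i.+1)) - zt (a (s i.+1)))).
have := zt1 (fun i => a (s i.+1)); have := zt1 (fun i => b (s i.+1)).
have := ler_wpM2l (ltW C20) (GU : rn (\sum_(i < n) W i) <= G).
have -> : (2 * (C + 1) + 3) * G = 2 * C1 * G + 3 * G by rewrite mulrDl.
move: r1; lra.
Qed.

End bounded_sequence.
End projective_case.

(** * The obstruction for projective powers of c_0 *)

Section projective_obstruction.
Variables (R : realType) (k : scalar_kind) (M p : nat).
Local Notation K := (scalars R k).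
Local Notation tri_ := (@tri R k p).

Lemma range_linear_submod (E : normedModType K) (S : {linear E -> E}) :
  range S 0 /\ forall (c : K) x y, range S x -> range S y -> range S (c *: x + y).
Proof.
split; first by exists 0 => //; exact: linear0.
by move=> c _ _ [x _ <-] [y _ <-]; exists (c *: x + y) => //; exact: linearP.
Qed.

Lemma continuous_linear_rn_bound (E : normedModType K) (S : {linear E -> E}) :
  continuous S -> exists2 C : R, 0 < C & forall x, rn (S x) <= C * rn x.
Proof.
move=> Sc; have [|||C C0 H] := @within_continuous_bounded R k E E setT S I.
- exact: linear0.
- exact: continuous_subspaceT.
- by move=> c x _; split => //; exact: linearZ.
by exists C => // x; exact: H.
Qed.

Lemma hform_tri n (w : nat -> nat) q :
  hform n (fun (t : 'I_p.+1) j => tri_ q t (p.+1 * w j + t)%N : K) =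
  hform n (fun (t : 'I_p.+1) j => ((if t == ord0 then w j == q else w j < q)%N)%:R).
Proof. by apply: hform_ext => t j _; rewrite tri_eval eqxx. Qed.

Lemma hform_tri_perm n (w : nat -> nat) q (sg : 'S_(p.+1)) : sg != 1%g ->
  hform n (fun (t : 'I_p.+1) j => tri_ q (sg t) (p.+1 * w j + t)%N : K) = 0.
Proof.
move=> sg1; have [t /eqP sgt] : exists t, sg t <> t.
  apply/existsNP => h; move/eqP: sg1; apply; apply/permP => t; by rewrite perm1.
apply: (@hform_zero _ _ _ _ _ t) => j; rewrite tri_eval eq_sym (negPf sgt).
by [].
Qed.

(** General weights on the permutations treat the symmetrization and the identity together. Only the
    weight at the identity enters the estimate, because the test form annihilates all permuted
    terms. *)
Theorem projective_obstruction (TN TM : completeNormedModType K)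
    (thN : ('I_p.+1 -> c0 R k) -> TN) (thM : ('I_M -> c0 R k) -> TM)
    (S : {linear TN -> TN}) (w : 'S_(p.+1) -> K) :
  (0 < M)%N -> (M <= p)%N -> projective_tensor thN -> projective_tensor thM ->
  continuous S -> w 1%g != 0 ->
  (forall x, S (thN x) = \sum_sg w sg *: thN (fun i => x (sg i))) ->
  ~ isomorphic_to_subspace_of_quotient (range S) TM.
Proof.
move=> M0 Mp NP MP Sc w1 SE [Z [Q [q [_ Zq [B [_ [f [g [[fAB gBA] [fK gK] flin [fc gc]]]]]]]]]].
have [A0 Alin] := range_linear_submod S.
have [Ci Ci0 Hf] := submod_isomorphism_bounds A0 Alin fAB gBA fK gK flin fc gc.
have [CS CS0 HS] := continuous_linear_rn_bound Sc.
pose x i := S (thN (tri_ i)).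
have x1 i : rn (x i) <= CS.
  apply: le_trans (HS _) _; rewrite -[leRHS]mulr1 ler_wpM2l ?(ltW CS0) //.
  apply: le_trans (projective_elementary NP _) _.
  by apply: prodr_ile1 => t _; rewrite rn_ge0 rn_tri.
have Ax i : range S (x i) by exists (thN (tri_ i)).
pose C := Ci * CS + 1; have C0 : 0 <= C by rewrite addr_ge0 // mulr_ge0 // ltW.
have /choice[z zP] : forall i, exists z, q z = f (x i) /\ rn z <= C.
  move=> i; have [_ [z qz zB]] := quotient_lift (f (x i)) Zq; exists z; split => //.
  apply: le_trans zB _; rewrite lerD2r; have [h _] := Hf _ (Ax i).
  by apply: le_trans h _; rewrite ler_wpM2l // ltW.
have [A A_ge0 HA] := hform_bound R k p.
have rw : 0 < rn (w 1%g).
  by rewrite lt_def rn_ge0 andbT; apply: contra w1 => /eqP/rn0_eq0 h; apply/eqP; exact: h.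
(* The factor 2 is the ratio between the 2^(L+1) terms of the sum and the 2^L that [hil_triangle]
   counts. *)
pose D : R := 2 * A * Ci * (2 * (C + 1) + 3) / rn (w 1%g).
have D0 : 0 <= D.
  by rewrite divr_ge0 ?rn_ge0 // !mulr_ge0 ?(ltW Ci0) // addr_ge0 // mulr_ge0 // addr_ge0.
have [L HL] := growth M0 Mp D0.
have [a [b [amono [ab H]]]] := differences_bound MP M0 L.+1 C0 (fun i => (zP i).2).
set n := (2 ^ L.+1)%N in amono ab H.
set G := (_ + 1) in H HL.
have Hx : rn (\sum_(i < n) (x (a i) - x (b i))) <= Ci * ((2 * (C + 1) + 3) * G).
  pose c (y : bool) : K := if y then -1 else 1.
  pose ix2 (I : 'I_n * bool) := if I.2 then b I.1 else a I.1.
  have toI (V : lmodType K) (F : nat -> V) : \sum_(i < n) (F (a i) - F (b i)) =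
      \sum_(I : 'I_n * bool) c I.2 *: F (ix2 I).
    rewrite -(pair_bigA _ (fun i y => c y *: F (ix2 (i, y)))) /=; apply: eq_bigr => i _.
    by rewrite big_bool /= scaleN1r scale1r addrC.
  have [Asum fsum] := additive_on_sum (index_enum _) (fun I : 'I_n * bool => c I.2)
    A0 Alin flin (fun I => Ax (ix2 I)).
  rewrite (toI _ x); have [_ h] := Hf _ Asum; apply: le_trans h _.
  rewrite ler_wpM2l ?(ltW Ci0) // fsum -(toI _ (fun i => f (x i))).
  under eq_bigr do rewrite -(zP (a _)).1 -(zP (b _)).1 -linearB.
  rewrite -linear_sum; have [h1 _] := quotient_lift 0 Zq.
  exact: le_trans (h1 _) H.
(* Slot t is read on its own residue class, and the j-th index of the form stands for a_j. The
   sequence a thus plays the part of the integers in the Hilbert form. *)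
pose Phi (y : 'I_p.+1 -> c0 R k) : K^o := hform n (fun t j => y t (p.+1 * a j + t)%N : K).
have Phil : mlin Phi.
  by apply: (@mlin_hform _ _ _ _ n (fun t j (y : c0 R k) => y (p.+1 * a j + t)%N)).
have Phib y : rn (Phi y : K) <= A * n%:R * \prod_t rn (y t).
  exact: (@hform_norm_bound _ _ _ (A * n%:R) n y (fun t j => (p.+1 * a j + t)%N) (HA n)).
pose idx : finType := ('I_n * (bool * 'S_(p.+1)))%type.
pose c (I : idx) : K := (if I.2.1 then -1 else 1) * w I.2.2.
pose y (I : idx) (t : 'I_p.+1) := tri_ (if I.2.1 then b I.1 else a I.1) (I.2.2 t).
have toI (V : lmodType K) (F : ('I_p.+1 -> c0 R k) -> V) :
   \sum_(i < n) (\sum_sg w sg *: F (fun t => tri_ (a i) (sg t)) -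
      \sum_sg w sg *: F (fun t => tri_ (b i) (sg t))) =
   \sum_(I : idx) c I *: F (y I).
  rewrite -(pair_bigA _ (fun i J => c (i, J) *: F (y (i, J)))) /=; apply: eq_bigr => i _.
  rewrite -(pair_bigA _ (fun be sg => c (i, (be, sg)) *: F (y (i, (be, sg))))) /= big_bool /=.
  rewrite addrC -sumrN; congr (_ + _); apply: eq_bigr => sg _; rewrite /c /=.
    by rewrite mul1r.
  by rewrite mulN1r scaleNr.
have := @projective_form_weighted _ _ _ _ _ thN Phi (A * n%:R) _ (index_enum idx) c y (ltn0Sn _) NP
   (mulr_ge0 A_ge0 (ler0n _ _)) Phil Phib.
rewrite -(toI _ thN); under [X in _ <= _ * rn X -> _]eq_bigr do rewrite -!SE.
(* Permuted terms vanish by residues, and terms at b_i vanish because b_i is none of the a_j. As a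
   is increasing, the term at a_i gives the truncated row sum at i. *)
have -> : \sum_(I : idx) c I * Phi (y I) = w 1%g * \sum_(i < n) ofR k ((\sum_(j < i) hil R i j) ^+ p).
  rewrite -[LHS]/(\sum_(I : idx) c I *: Phi (y I)) -toI mulr_sumr; apply: eq_bigr => i _.
  have one r : \sum_sg w sg *: Phi (fun t => tri_ r (sg t)) = w 1%g * Phi (tri_ r).
    rewrite (bigD1 1%g) //= big1 => [|sg sg1]; last first.
      by rewrite /Phi hform_tri_perm // scaler0.
    by rewrite addr0; congr (_ * Phi _); apply/funext => t; rewrite perm1.
  rewrite !one /Phi !hform_tri.
  rewrite [X in _ * X - _](_ : _ = ofR k ((\sum_(j < i) hil R i j) ^+ p)); last first.
    rewrite -(hform_triangle R k p (ltn_ord i)); apply: hform_ext => t j jn.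
    congr (_%:R); congr nat_of_bool; case: (t == ord0).
      apply/idP/idP => [/eqP h|/eqP -> //]; have [h'|h'|//] := ltngtP j i.
        by have := amono _ _ h' (ltn_ord i); rewrite h ltnn.
      by have := amono _ _ h' jn; rewrite h ltnn.
    apply/idP/idP => h; last exact: amono.
    rewrite ltnNge leq_eqVlt; apply/negP => /predU1P[h'|h'].
      by rewrite -h' ltnn in h.
    by have := ltn_trans h (amono _ _ h' jn); rewrite ltnn.
  rewrite [X in _ - _ * X](_ : _ = 0) ?mulr0 ?subr0 //.
  by rewrite hformE big1 // => j _; rewrite /= (negPf (ab j i _ _)) ?mul0r.
rewrite -raddf_sum /= rnM rn_ofR.
have tr := hil_triangle R p L; rewrite -/n in tr.
rewrite ger0_norm; last by apply: le_trans tr; rewrite mulr_ge0 // exprn_ge0 // divr_ge0.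
move=> main.
have n2 : n%:R = 2 * (2 ^ L)%:R :> R by rewrite /n expnS natrM.
have P0 : 0 < (2 ^ L)%:R :> R by rewrite ltr0n expn_gt0.
have : rn (w 1%g) * ((2 ^ L)%:R * (L%:R / 2) ^+ p) <= A * n%:R * (Ci * ((2 * (C + 1) + 3) * G)).
  apply: le_trans (ler_wpM2l (ltW rw) tr) _; apply: le_trans main _.
  by rewrite ler_wpM2l // mulr_ge0.
apply/negP; rewrite -ltNge n2.
have -> : A * (2 * (2 ^ L)%:R) * (Ci * ((2 * (C + 1) + 3) * G)) = rn (w 1%g) * ((2 ^ L)%:R * (D * G)).
  by rewrite /D; field; rewrite gt_eqF.
by rewrite ltr_pM2l // ltr_pM2l.
Qed.

End projective_obstruction.

(** * Approximating functionals by averages of tuples *)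

Section measure_lift.
Variables (R : realType) (k : scalar_kind) (M : nat).
Local Notation K := (scalars R k).
Local Notation vec := (nat -> K^o).

Lemma reS_conjM (d v : K) : reS (conjS d * v) = reS d * reS v + imS d * imS v.
Proof.
move: d v; rewrite /conjS /reS /imS; case: k => /= [d v|[a b] [c e] /=]; ring.
Qed.

Lemma rn_sqrB (d v : K) (t : R) :
  rn (d - ofR k t * v) ^+ 2 = rn d ^+ 2 - 2 * t * reS (conjS d * v) + t ^+ 2 * rn v ^+ 2.
Proof.
rewrite !rn_sqr !raddfB /= reS_ofRM imS_ofRM reS_conjM; ring.
Qed.

Lemma conjS_normal (z : K) : exists2 u : K, rn u <= 1 & u * z = ofR k (rn z).
Proof.
have [->|z0] := eqVneq z 0; first by exists 0; rewrite rn0 ?mulr0 ?ofR0.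
have rz : 0 < rn z.
  by rewrite lt_def rn_ge0 andbT; apply: contra z0 => /eqP/(@rn0_eq0 _ _ K^o)/eqP.
exists (ofR k (rn z)^-1 * conjS z).
  by rewrite rnM rn_ofR gtr0_norm ?invr_gt0 // rn_conjS mulVf // gt_eqF.
have e : conjS z * z = ofR k (rn z ^+ 2).
  rewrite rn_sqr; move: (z); rewrite /conjS /ofR /reS /imS; case: k => /= [y|[a b]].
    by rewrite expr0n addr0 expr2.
  by apply/eqP; rewrite eq_complex /=; apply/andP; split; apply/eqP; ring.
by rewrite -mulrA e -ofRM expr2 mulKf // gt_eqF.
Qed.

Lemma measure_mix (mu : pmeasure R k M) (a : 'I_M -> vec) (t : R) :
  0 <= t <= 1 -> (forall s, bnd1 (a s)) ->
  exists mu' : pmeasure R k M, forall (V : lmodType K) (F : ('I_M -> vec) -> V),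
    mint mu' F = ofR k (1 - t) *: mint mu F + ofR k t *: F a.
Proof.
move=> /andP[t0 t1] a1.
pose wt l := if (l < msize mu)%N then (1 - t) * mwt mu l else t.
pose pt l := if (l < msize mu)%N then mpt mu l else a.
have wt0 l : (l < (msize mu).+1)%N -> 0 <= wt l.
  by move=> _; rewrite /wt; case: ifP => // lm; rewrite mulr_ge0 ?subr_ge0 ?mwt_ge0.
have wt1 : \sum_(l < (msize mu).+1) wt l = 1.
  rewrite big_ord_recr /= {2}/wt ltnn; under eq_bigr do rewrite /wt ltn_ord.
  by rewrite -mulr_sumr mwt_sum mulr1 subrK.
have pt1 l s : (l < (msize mu).+1)%N -> bnd1 (pt l s).
  by move=> _; rewrite /pt; case: ifP => // lm; exact: mpt_bnd1.
exists (PMeasure wt0 wt1 pt1) => V F; rewrite /mint /= big_ord_recr /=.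
rewrite /wt /pt ltnn; congr (_ + _); rewrite scaler_sumr; apply: eq_bigr => l _.
by rewrite ltn_ord scalerA -ofRM.
Qed.

Lemma measure_inhabited : exists mu : pmeasure R k M, True.
Proof.
have w1 : \sum_(l < 1) (fun=> 1 : R) (l : nat) = 1 by rewrite big_ord1.
by exists (@PMeasure R k M 1 (fun=> 1) (fun _ _ _ => 0) (fun _ _ => ler01) w1
  (fun _ _ _ => @bnd1_0 R k)).
Qed.

(* A Frank-Wolfe step towards a point a does not improve a near-minimizer of the quadratic
   distance from x to C * mint mu Y + (error of size C * e), and the hypothesis applied to
   the conjugate of the residual then bounds that residual. *)
Lemma measure_lift (I : finType) (x : I -> K) (Y : I -> ('I_M -> vec) -> K^o) (C e Bd : R) :
  (0 < M)%N -> 0 < C -> 0 < e -> (forall r, mlin (Y r)) ->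
  (forall r a, (forall t, bnd1 (a t)) -> rn (Y r a : K) <= Bd) ->
  (forall (b : I -> K) B,
     (forall a, (forall t, bnd1 (a t)) -> rn (\sum_r b r * Y r a) <= B) ->
     rn (\sum_r b r * x r) <= C * (B + e * \sum_r rn (b r))) ->
  exists mu : pmeasure R k M, forall r, rn (x r - ofR k C * mint mu (Y r)) <= 2 * (C * e).
Proof.
move=> M0 C0 e0 Yl YB H.
(* The slack z ranges over the unit ball for the maximum norm, whose dual norm produces the term e *
   sum of [rn (b r)] in the hypothesis. *)
pose y (mu : pmeasure R k M) (z : I -> K) r : K := mint mu (Y r) + ofR k e * z r.
pose En mu z := \sum_r rn (x r - ofR k C * y mu z r) ^+ 2.
pose EE := [set v | exists mu z, (forall r, rn (z r) <= 1) /\ v = En mu z].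
have [mu0 _] := measure_inhabited.
have En0 mu z : 0 <= En mu z by apply: sumr_ge0 => r _; rewrite sqr_ge0.
have EEinf : has_inf EE.
  split; first by exists (En mu0 (fun=> 0)), mu0, (fun=> 0); split => // r; rewrite rn0.
  by exists 0 => _ [mu [z [_ ->]]].
pose Dv := 2 * C * (`|Bd| + e).
pose D2 : R := #|I|%:R * Dv ^+ 2.
have D20 : 0 <= D2 by rewrite mulr_ge0 // sqr_ge0.
pose kap := (C * e) ^+ 2; have kap0 : 0 < kap by rewrite exprn_gt0 // mulr_gt0.
(* The step length. Being within del^2 of the infimum, and with curvature term at most del^2 D2, a
   step can gain at most del (1 + D2) / 2 <= kap to first order; the minimum with 1 keeps it a
   convex combination. *)
pose del := Num.min 1 (2 * kap / (1 + D2)).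
have del0 : 0 < del by rewrite lt_min ltr01 divr_gt0 ?mulr_gt0 //; lra.
have del1 : del <= 1 by rewrite ge_min lexx.
have delk : del * (1 + D2) <= 2 * kap.
  by rewrite -ler_pdivlMr ?ge_min ?lexx ?orbT //; lra.
have [_ [mu [z [z1 ->]]] near] := inf_adherent (exprn_gt0 2 del0) EEinf.
exists mu => r0.
pose d r := x r - ofR k C * y mu z r.
pose b r := conjS (d r).
have step a z' : (forall t, bnd1 (a t)) -> (forall r, rn (z' r) <= 1) ->
    reS (\sum_r b r * (ofR k C * (Y r a + ofR k e * z' r))) <=
    reS (\sum_r b r * (ofR k C * y mu z r)) + kap.
  move=> a1 z'1.
  have dl : 0 <= del <= 1 by rewrite ltW.
  have [mu' muE] := measure_mix mu dl a1.
  pose z'' r := ofR k (1 - del) * z r + ofR k del * z' r.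
  have z''1 r : rn (z'' r) <= 1.
    apply: le_trans (rnD _ _) _; rewrite !rnM !rn_ofR !ger0_norm ?subr_ge0 ?(ltW del0) //.
    have := z1 r; have := z'1 r; have := rn_ge0 (z r); have := rn_ge0 (z' r); nra.
  pose v r := ofR k C * (Y r a + ofR k e * z' r) - ofR k C * y mu z r.
  have dE r : x r - ofR k C * y mu' z'' r = d r - ofR k del * v r.
    have e1 : ofR k (1 - del) = 1 - ofR k del by rewrite raddfB /= ofR1.
    rewrite /d /v /y /z'' muE e1.
    rewrite -![_ *: _]/(_ * _); ring.
  have vB r : rn (v r) <= Dv.
    have h1 : rn (Y r a + ofR k e * z' r) <= `|Bd| + e.
      apply: le_trans (rnD _ _) _; apply: lerD.
        exact: le_trans (YB r a a1) (ler_norm _).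
      by rewrite rnM rn_ofR gtr0_norm // ler_piMr // ltW.
    have h2 : rn (y mu z r) <= `|Bd| + e.
      apply: le_trans (rnD _ _) _; apply: lerD.
        apply: rn_mint => a' a'1; exact: le_trans (YB r a' a'1) (ler_norm _).
      by rewrite rnM rn_ofR gtr0_norm // ler_piMr // ltW.
    apply: le_trans (rnB _ _) _; rewrite !rnM rn_ofR gtr0_norm //.
    have := ler_wpM2l (ltW C0) h1; have := ler_wpM2l (ltW C0) h2; rewrite /Dv; lra.
  have lb : inf EE <= En mu' z'' by apply: ge_inf; [exact: EEinf.2|exists mu', z''].
  have EnE : En mu' z'' = En mu z - 2 * del * reS (\sum_r b r * v r) +
      del ^+ 2 * \sum_r rn (v r) ^+ 2.
    rewrite /En raddf_sum /= !mulr_sumr -sumrB -big_split /=; apply: eq_bigr => r _.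
    by rewrite dE rn_sqrB.
  have vS : \sum_r rn (v r) ^+ 2 <= D2.
    rewrite /D2 -sum1_card natr_sum mulr_suml; apply: ler_sum => r _; rewrite mul1r.
    by rewrite lerXn2r ?nnegrE ?rn_ge0 // (le_trans (rn_ge0 (v r))).
  have vR : reS (\sum_r b r * v r) <= kap.
    have : 2 * del * reS (\sum_r b r * v r) <= del ^+ 2 + del ^+ 2 * D2.
      have := ler_wpM2l (sqr_ge0 del) vS; move: near lb; rewrite EnE; lra.
    rewrite [del ^+ 2]expr2 -mulrA -[del * del * D2]mulrA -mulrDr.
    rewrite mulrCA ler_pM2l // => h; move: delk; lra.
  have : reS (\sum_r b r * v r) = reS (\sum_r b r * (ofR k C * (Y r a + ofR k e * z' r))) -
      reS (\sum_r b r * (ofR k C * y mu z r)).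
    by rewrite -raddfB -sumrB; congr reS; apply: eq_bigr => r _; rewrite /v mulrBr.
  by move: vR; lra.
pose B0 := reS (\sum_r b r * (ofR k C * y mu z r)) + kap.
have key a : (forall t, bnd1 (a t)) ->
    rn (\sum_r b r * Y r a) <= B0 / C - e * \sum_r rn (b r).
  move=> a1.
  (* Rotating slot 0 of a by u and aligning the slack with b turns the real parts controlled by
     [step] into absolute values. *)
  have [u u1 uE] := conjS_normal (\sum_r b r * Y r a).
  have /choice[z' z'P] : forall r, exists w : K, rn w <= 1 /\ w * b r = ofR k (rn (b r)).
    by move=> r; have [w w1 wE] := conjS_normal (b r); exists w.
  pose t0 := Ordinal M0; pose a' := dfwith a t0 (u *: a t0).
  have a'1 t : bnd1 (a' t).
    rewrite /a'; case: dfwithP => [|t' _]; last exact: a1.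
    by move=> j; rewrite -[_ j]/(u * a t0 j) rnM mulr_ile1 ?rn_ge0 //; exact: a1.
  have := step a' z' a'1 (fun r => (z'P r).1); rewrite -/B0.
  have -> : \sum_r b r * (ofR k C * (Y r a' + ofR k e * z' r)) =
      ofR k C * (ofR k (rn (\sum_r b r * Y r a)) + ofR k e * \sum_r ofR k (rn (b r))).
    rewrite -uE !mulr_sumr -big_split mulr_sumr /=; apply: eq_bigr => r _.
    rewrite -(z'P r).2 /a' (mlinZ (Yl r)) dfwith_self -[u *: _]/(u * _); ring.
  rewrite -raddf_sum /= -ofRM -ofRD -ofRM ofRK => h.
  by rewrite lerBrDr ler_pdivlMr // mulrC.
(* The slack term cancels the e-term of H. Since b is the conjugate of the residual d, subtracting
   the pairing of b with C y leaves the sum of |d|^2, hence at most kap. *)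
have := H b _ key; rewrite subrK mulrC divfK ?gt_eqF // => h.
have dS : \sum_r rn (d r) ^+ 2 <= kap.
  have : reS (\sum_r b r * x r) <= B0 by apply: le_trans (reS_le_rn _) h.
  have -> : \sum_r rn (d r) ^+ 2 = reS (\sum_r b r * x r) - reS (\sum_r b r * (ofR k C * y mu z r)).
    rewrite -raddfB -sumrB raddf_sum /=; apply: eq_bigr => r _.
    by rewrite -mulrBr /b conjSE -rn_sqr.
  by rewrite /B0; lra.
have d0 : rn (d r0) <= C * e.
  rewrite -(@ler_pXn2r _ 2) ?nnegrE ?rn_ge0 ?mulr_ge0 ?(ltW C0) ?(ltW e0) //.
  apply: le_trans dS; rewrite (bigD1 r0) //= lerDl; apply: sumr_ge0 => r _; exact: sqr_ge0.
have -> : x r0 - ofR k C * mint mu (Y r0) = d r0 + ofR k C * (ofR k e * z r0).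
  by rewrite /d /y; ring.
apply: le_trans (rnD _ _) _; rewrite mulr2n mulrDl mul1r; apply: lerD => //.
by rewrite !rnM !rn_ofR !gtr0_norm // ler_pM2l // ler_piMr // ltW.
Qed.

End measure_lift.

(** * Truncation and duality in l_1 *)

Section summable_sequences.
Variables (R : realType) (k : scalar_kind).
Local Notation K := (scalars R k).
Local Notation vec := (nat -> K^o).

Lemma rn_series (a : vec) n : series (fun i => `|a i| : K^o) n = ofR k (\sum_(i < n) rn (a i : K)).
Proof.
rewrite seriesEnat /= big_mkord raddf_sum /=; apply: eq_bigr => i _.
exact: (rnE (a i : K)).
Qed.

Lemma sum_rn_cutv_le (a : vec) m n :
  \sum_(i < n) rn (cutv m a i : K) <= \sum_(i < m) rn (a i : K).
Proof.
have [h|/ltnW h] := leqP n m.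
  move: (subnKC h); move: (m - n)%N => d <-; rewrite [leRHS]big_split_ord /=.
  apply: ler_wpDr; first by apply: sumr_ge0 => i _; exact: rn_ge0.
  by apply: ler_sum => i _; rewrite /cutv ltn_addr.
move: (subnKC h); move: (n - m)%N => d <-; rewrite big_split_ord /=.
rewrite [X in _ + X]big1 ?addr0 => [|i _]; last by rewrite /cutv ltnNge leq_addr rn0.
by apply: ler_sum => i _; rewrite /cutv ltn_ord.
Qed.

Lemma l1cut_subproof m (a : vec) : cutv m a \in @l1_seq R k.
Proof.
apply/l1_seqP; exists (ofR k (\sum_(i < m) rn (a i : K))) => n.
by rewrite rn_series ler_ofR sum_rn_cutv_le.
Qed.

Definition l1cut m a : l1 R k := L1 (l1cut_subproof m a).

Lemma l1E (x : K) (u v : l1 R k) j : (x *: u + v) j = x * u j + v j.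
Proof. by []. Qed.

Lemma rn_l1_ge (x : l1 R k) n : \sum_(i < n) rn (x i : K) <= rn x.
Proof. by rewrite -(@ler_ofR R k) -rn_series -rnE; exact: l1_norm_ge. Qed.

Lemma rn_l1_le (x : l1 R k) B : (forall n, \sum_(i < n) rn (x i : K) <= B) -> rn x <= B.
Proof.
move=> xB; rewrite -(@ler_ofR R k) -rnE; apply: l1_norm_le => n.
by rewrite rn_series ler_ofR.
Qed.

Lemma rn_l1cut m (a : vec) : rn (l1cut m a) <= \sum_(i < m) rn (a i : K).
Proof. by apply: rn_l1_le => n; exact: sum_rn_cutv_le. Qed.

Lemma rn_l1cut_le m (x : l1 R k) : rn (l1cut m (l1_val x)) <= rn x.
Proof. exact: le_trans (rn_l1cut _ _) (rn_l1_ge _ _). Qed.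

(** The norm is the supremum of the partial sums: once a partial sum comes within e of it, at most e
    is left beyond. *)
Lemma l1cut_approx (x : l1 R k) e : 0 < e -> exists m0, forall m, (m0 <= m)%N ->
  rn (x - l1cut m (l1_val x)) <= e.
Proof.
move=> e0.
have [m0 Hm0] : exists m0, rn x - e < \sum_(i < m0) rn (x i : K).
  apply: contrapT => /forallNP h; have : rn x <= rn x - e; last by lra.
  by apply: rn_l1_le => n; rewrite leNgt; apply/negP.
exists m0 => m m0m; apply: rn_l1_le => n.
set z := x - _; pose zr (i : nat) := rn (z i : K); pose xr (i : nat) := rn (x i : K).
have zE i : zr i = if (i < m)%N then 0 else xr i.
  rewrite /zr (_ : z i = x i - cutv m (l1_val x) i) // /cutv.
  by case: ifP => _; rewrite ?subrr ?rn0 // subr0.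
have w q (F : nat -> R) : (q <= maxn n m0)%N ->
    \sum_(i < q) F i = \sum_(i < maxn n m0) (if (i < q)%N then F i else 0).
  by move=> qn; rewrite (big_ord_widen (maxn n m0) F qn) big_mkcond.
have H : \sum_(i < n) zr i + \sum_(i < m0) xr i <= \sum_(i < maxn n m0) xr i.
  rewrite (w n zr) ?leq_maxl // (w m0 xr) ?leq_maxr // -big_split /=.
  apply: ler_sum => i _; rewrite zE; have [im0|im0] := ltnP i m0.
    by rewrite (leq_trans im0 m0m); case: ifP; rewrite add0r.
  by rewrite addr0; case: ifP => _; [case: ifP => _ //|]; exact: rn_ge0.
by have := rn_l1_ge x (maxn n m0); rewrite -/(xr _); move: Hm0 H; rewrite /zr /xr; lra.
Qed.

Definition l1form (m : nat) (a : vec) (x : l1 R k) : K := \sum_(j < m) a j * x j.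

Lemma l1form_is_scalar m a : scalar (l1form m a).
Proof.
move=> c u v; rewrite /l1form mulr_sumr -big_split; apply: eq_bigr => j _.
by rewrite l1E /=; ring.
Qed.

HB.instance Definition _ m a := GRing.isLinear.Build K (l1 R k) K *%R (l1form m a)
  (l1form_is_scalar m a).

Lemma l1form_ball m a : bnd1 a -> dual_unit_ball (l1form m a : {scalar l1 R k}).
Proof.
move=> a1 x; rewrite rn_le; apply: le_trans (rn_sum _ _ _) _.
apply: le_trans (rn_l1_ge x m); apply: ler_sum => j _.
by rewrite rnM ler_piMl ?rn_ge0 //; exact: a1.
Qed.

Lemma l1form_l1cut m m' a v : (m <= m')%N ->
  l1form m' a (l1cut m v) = \sum_(j < m) v j * a j.
Proof.
move=> mm'; rewrite /l1form /= (big_ord_widen m' (fun j => v j * a j) mm').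
rewrite [RHS]big_mkcond; apply: eq_bigr => j _; rewrite /cutv.
by case: ifP => _; rewrite ?mulr0 // mulrC.
Qed.

Definition l1basis j : l1 R k := l1cut j.+1 (evec R k j).

Lemma l1basisE j i : l1basis j i = (i == j)%:R.
Proof.
rewrite /l1basis /= /cutv /evec; case: eqP => [->|_]; first by rewrite ltnSn.
by case: ifP.
Qed.

Lemma rn_l1basis j : rn (l1basis j) <= 1.
Proof.
apply: le_trans (rn_l1cut _ _) _; rewrite big_ord_recr /= /evec eqxx rn1 big1 ?add0r // => i _.
by rewrite ltn_eqF // rn0.
Qed.

Lemma l1cutE m v : l1cut m v = \sum_(j < m) v j *: l1basis j.
Proof.
apply/val_inj/funext => x /=; rewrite cutvE sum_vecE.
have E (r : seq 'I_m) (F : 'I_m -> l1 R k) : l1_val (\sum_(j <- r) F j) x = \sum_(j <- r) l1_val (F j) x.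
  by elim: r => [|j r IH]; rewrite ?big_nil // !big_cons -IH.
rewrite E; apply: eq_bigr => j _.
by rewrite -[RHS]/(v j * l1basis j x) l1basisE.
Qed.

Lemma dual_l1cut (f : {scalar l1 R k}) m v :
  f (l1cut m v) = \sum_(j < m) v j * f (l1basis j).
Proof. by rewrite l1cutE linear_sum; apply: eq_bigr => j _; rewrite linearZ. Qed.

Lemma dual_basis_bnd1 (f : {scalar l1 R k}) : dual_unit_ball f -> @bnd1 R k (fun j => f (l1basis j)).
Proof.
move=> fb j; apply: le_trans (rn_l1basis j); rewrite -rn_le; exact: fb.
Qed.

Section injective_weighted.
Variables (X : normedModType K) (N : nat) (T : completeNormedModType K) (th : ('I_N -> X) -> T).
Hypotheses (thP : injective_tensor th) (N0 : (0 < N)%N).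
Variables (I : Type) (r : seq I) (c : I -> K) (x : I -> 'I_N -> X).

Let y i := dfwith (x i) (Ordinal N0) (c i *: x i (Ordinal N0)).

Let thE : \sum_(z <- [seq y i | i <- r]) th z = \sum_(i <- r) c i *: th (x i).
Proof.
have [thl _ _] := thP; rewrite big_map; apply: eq_bigr => i _.
by rewrite /y mlinZ // dfwith_self.
Qed.

Let fE (f : 'I_N -> {scalar X}) : \sum_(z <- [seq y i | i <- r]) \prod_t f t (z t) =
  \sum_(i <- r) c i * \prod_t f t (x i t).
Proof.
rewrite big_map; apply: eq_bigr => i _; rewrite /y (bigD1 (Ordinal N0)) //= dfwithin linearZ /=.
rewrite [in RHS](bigD1 (Ordinal N0)) //= -mulrA; congr (_ * (_ * _)); apply: eq_bigr => t ti.
by rewrite dfwithout // eq_sym.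
Qed.

Lemma injective_weighted_le B :
  (forall f : 'I_N -> {scalar X}, (forall i, dual_unit_ball (f i)) ->
     rn (\sum_(i <- r) c i * \prod_t f t (x i t)) <= B) ->
  rn (\sum_(i <- r) c i *: th (x i)) <= B.
Proof. by move=> H; rewrite -thE; apply: (injective_norm_le thP) => f fb; rewrite fE H. Qed.

Lemma injective_weighted_ge (f : 'I_N -> {scalar X}) : (forall i, dual_unit_ball (f i)) ->
  rn (\sum_(i <- r) c i * \prod_t f t (x i t)) <= rn (\sum_(i <- r) c i *: th (x i)).
Proof. by move=> fb; rewrite -thE -fE; exact: (injective_norm_ge thP). Qed.

End injective_weighted.

Lemma injective_elementary (X : normedModType K) N (T : completeNormedModType K)
    (th : ('I_N -> X) -> T) (x : 'I_N -> X) :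
  injective_tensor th -> rn (th x) <= \prod_t rn (x t).
Proof.
move=> thP; have := injective_norm_le thP (s := [:: x]) (B := \prod_t rn (x t)).
rewrite big_seq1; apply => f fb; rewrite big_seq1 rn_prod.
by apply: ler_prod => t _; rewrite rn_ge0 /= -rn_le; exact: fb.
Qed.

(* The dual unit ball of l1 is the unit ball of l_infinity, so the vectors of the injective
   tensor power are modelled, norm included, by multilinear maps on tuples in that ball. *)
Lemma l1_model M (T : completeNormedModType K) (th : ('I_M -> l1 R k) -> T)
    (J : Type) (y : J -> T) (e : R) :
  (0 < M)%N -> injective_tensor th -> 0 < e ->
  exists (Y : J -> ('I_M -> vec) -> K^o) (m : J -> nat),
  [/\ forall j, mlin (Y j),
      forall j m' a, (m j <= m')%N -> Y j (fun t => cutv m' (a t)) = Y j a,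
      forall (I : finType) (r : I -> J) (b : I -> K) B,
        (forall a, (forall t, bnd1 (a t)) -> rn (\sum_i b i * Y (r i) a) <= B) ->
        rn (\sum_i b i *: y (r i)) <= B + e * \sum_i rn (b i) &
      forall (I : finType) (r : I -> J) (b : I -> K) a, (forall t, bnd1 (a t)) ->
        rn (\sum_i b i * Y (r i) a) <= rn (\sum_i b i *: y (r i)) + e * \sum_i rn (b i)].
Proof.
move=> M0 thP e0; have [thl _ dn] := thP.
have /choice[m /choice[s sP]] : forall j, exists m (s : seq ('I_M -> vec)),
    rn (y j - \sum_(v <- s) th (fun t => l1cut m (v t))) <= e.
  move=> j; have e2 : 0 < e / 2 by lra.
  have [_ [s _ <-] s1] := dense_approx (y j) dn e2.
  have [m /(_ m (leqnn m)) H] := mlin_list_approx thl (fun x => injective_elementary x thP)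
    (cut := fun m (x : l1 R k) => l1cut m (l1_val x)) rn_l1cut_le l1cut_approx s e2.
  exists m, [seq (fun t => l1_val (x t)) | x <- s]; rewrite big_map.
  rewrite -[y j](subrK (\sum_(x <- s) th x)) -addrA; apply: le_trans (rnD _ _) _.
  by apply: le_trans (lerD s1 H) _; lra.
pose Y j (a : 'I_M -> vec) : K^o := \sum_(v <- s j) \prod_t \sum_(i < m j) v t i * a t i.
pose yt j := \sum_(v <- s j) th (fun t => l1cut (m j) (v t)).
have yB (I : finType) (r : I -> J) (b : I -> K) :
    rn (\sum_i b i *: (y (r i) - yt (r i))) <= e * \sum_i rn (b i).
  apply: le_trans (rn_sum _ _ _) _; rewrite mulr_sumr; apply: ler_sum => i _.
  by rewrite rnZ mulrC ler_wpM2r ?rn_ge0.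
have ytE (I : finType) (r : I -> J) (b : I -> K) :
    \sum_i b i *: yt (r i) = \sum_i b i *: y (r i) - \sum_i b i *: (y (r i) - yt (r i)).
  by rewrite -sumrB; apply: eq_bigr => i _; rewrite -scalerBr subKr.
have flat (I : finType) (r : I -> J) (b : I -> K) (V : lmodType K) (G : J -> ('I_M -> vec) -> V) :
    \sum_(z <- [seq (i, v) | i <- index_enum I, v <- s (r i)]) b z.1 *: G (r z.1) z.2 =
    \sum_i b i *: \sum_(v <- s (r i)) G (r i) v.
  by rewrite big_allpairs_dep /=; apply: eq_bigr => i _; rewrite scaler_sumr.
exists Y, m; split.
- move=> j i x c u v; have E0 (z : K^o) : c *: z = c * z by [].
  rewrite E0 /Y mulr_sumr -big_split; apply: eq_bigr => w _ /=.
  have E z : \prod_t \sum_(l < m j) w t l * dfwith x i z t l =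
      (\sum_(l < m j) w i l * z l) * \prod_(t | t != i) \sum_(l < m j) w t l * x t l.
    rewrite (bigD1 i) //= dfwithin; congr (_ * _); apply: eq_bigr => t ti.
    by rewrite dfwithout // eq_sym.
  rewrite !E mulrA -mulrDl mulr_sumr -big_split; congr (_ * _); apply: eq_bigr => l _ /=.
  by rewrite -[(c *: u + v) l]/(c * u l + v l); ring.
- move=> j m' a mm'; apply: eq_bigr => v _; apply: eq_bigr => t _; apply: eq_bigr => l _.
  by rewrite /cutv (leq_trans (ltn_ord l) mm').
- move=> I r b B H.
  have -> : \sum_i b i *: y (r i) = \sum_i b i *: yt (r i) + \sum_i b i *: (y (r i) - yt (r i)).
    by rewrite ytE subrK.
  apply: le_trans (rnD _ _) _; apply: lerD (yB _ _ _).
  rewrite /yt -(flat _ _ _ _ (fun j v => th (fun t => l1cut (m j) (v t)))).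
  apply: (injective_weighted_le thP M0 (x := fun z t => l1cut (m (r z.1)) (z.2 t))) => f fb.
  have := H (fun t j => f t (l1basis j)) (fun t => dual_basis_bnd1 (fb t)).
  have -> : \sum_(i : I) b i * Y (r i) (fun t j => f t (l1basis j)) =
     \sum_(z <- [seq (i, v) | i <- index_enum I, v <- s (r i)])
       b z.1 *: (\prod_t f t (l1cut (m (r z.1)) (z.2 t)) : K^o).
    rewrite (flat _ _ _ _ (fun j v => \prod_t f t (l1cut (m j) (v t)) : K^o)).
    apply: eq_bigr => i _; congr (_ * _); apply: eq_bigr => v _; apply: eq_bigr => t _.
    by rewrite dual_l1cut.
  exact.
- move=> I r b a a1.
  (* A common truncation length turns a into one tuple of functionals that serves all i. *)
  pose mb := (\max_i m (r i))%N.
  have fb t := l1form_ball mb (a1 t).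
  have := injective_weighted_ge thP M0 [seq (i, v) | i <- index_enum I, v <- s (r i)]
    (fun z => b z.1) (fun z t => l1cut (m (r z.1)) (z.2 t)) fb.
  rewrite (flat _ _ _ _ (fun j v => th (fun t => l1cut (m j) (v t)))).
  have -> : \sum_(z <- [seq (i, v) | i <- index_enum I, v <- s (r i)])
       b z.1 * \prod_t l1form mb (a t) (l1cut (m (r z.1)) (z.2 t)) = \sum_(i : I) b i * Y (r i) a.
    rewrite big_allpairs_dep /=; apply: eq_bigr => i _; rewrite mulr_sumr.
    apply: eq_bigr => v _; congr (_ * _); apply: eq_bigr => t _.
    by rewrite l1form_l1cut // /mb (leq_bigmax i).
  move=> h; apply: le_trans h _; rewrite -/(yt _).
  have := ytE I r b; rewrite /yt => ->.
  by apply: le_trans (rnB _ _) _; rewrite lerD2l yB.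
Qed.

End summable_sequences.

(** * Basis tensors and blocks of index pairs *)

Section blocks.
Variables (R : realType) (k : scalar_kind) (M p : nat).
Local Notation K := (scalars R k).
Local Notation vec := (nat -> K^o).

Section basis_tensors.
Variables (TN : completeNormedModType K) (thN : ('I_p.+1 -> l1 R k) -> TN).
Hypothesis NP : injective_tensor thN.
Variables (I : finType) (b : I -> K) (r : I -> 'I_p.+1 -> nat).

Lemma basis_upper B :
  (forall u : 'I_p.+1 -> vec, (forall t, bnd1 (u t)) ->
     rn (\sum_i b i * \prod_t (u t (r i t) : K)) <= B) ->
  rn (\sum_i b i *: thN (fun t => l1basis R k (r i t))) <= B.
Proof.
move=> H; apply: (injective_weighted_le NP (ltn0Sn p) (x := fun i t => l1basis R k (r i t))) => f fb.
exact: (H (fun t j => f t (l1basis R k j)) (fun t => dual_basis_bnd1 (fb t))).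
Qed.

(** Each functional u_t is supported on the residue class of its slot. A nontrivially permuted basis
    tensor has some index in a wrong class, so only the weight at the identity contributes. *)
Lemma basis_lower (S : {linear TN -> TN}) (w : {perm 'I_p.+1} -> K) (u : 'I_p.+1 -> vec) :
  (forall x, S (thN x) = \sum_sg w sg *: thN (fun i => x (sg i))) ->
  (forall t, bnd1 (u t)) -> (forall t j, u t j != 0 -> (j %% p.+1)%N = t) ->
  (forall i t, (r i t %% p.+1)%N = t) ->
  rn (w 1%g) * rn (\sum_i b i * \prod_t (u t (r i t) : K)) <=
  rn (S (\sum_i b i *: thN (fun t => l1basis R k (r i t)))).
Proof.
move=> SE u1 ur rr.
pose mb := (\max_i \max_t (r i t).+1)%N.
have rmb i t : (r i t < mb)%N.
  by apply: leq_trans (leq_bigmax i); apply: (leq_bigmax (F := fun t => (r i t).+1)).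
have fb t := l1form_ball mb (u1 t).
have fE t i t' : l1form mb (u t) (l1basis R k (r i t')) = u t (r i t').
  rewrite l1form_l1cut ?rmb // big_ord_recr /= /evec eqxx mul1r big1 ?add0r // => j _.
  by rewrite ltn_eqF ?mul0r.
pose idx : finType := (I * {perm 'I_p.+1})%type.
have := injective_weighted_ge NP (ltn0Sn p) (index_enum idx) (fun z => b z.1 * w z.2)
  (fun z t => l1basis R k (r z.1 (z.2 t))) fb.
have -> : \sum_(z : idx) (b z.1 * w z.2) *: thN (fun t => l1basis R k (r z.1 (z.2 t))) =
    S (\sum_i b i *: thN (fun t => l1basis R k (r i t))).
  rewrite linear_sum.
  rewrite -(pair_bigA _ (fun i sg => (b i * w sg) *: thN (fun t => l1basis R k (r i (sg t))))) /=.
  apply: eq_bigr => i _; rewrite linearZ /= SE scaler_sumr; apply: eq_bigr => sg _.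
  by rewrite scalerA.
have -> : \sum_(z : idx) (b z.1 * w z.2) * \prod_t l1form mb (u t) (l1basis R k (r z.1 (z.2 t))) =
    w 1%g * \sum_i b i * \prod_t (u t (r i t) : K).
  rewrite -(pair_bigA _
    (fun i sg => (b i * w sg) * \prod_t l1form mb (u t) (l1basis R k (r i (sg t))))) /=.
  rewrite mulr_sumr; apply: eq_bigr => i _.
  rewrite (bigD1 1%g) //= [X in _ + X]big1 ?addr0 => [|sg sg1].
    rewrite [b i * w _]mulrC -mulrA; congr (_ * (_ * _)); apply: eq_bigr => t _.
    by rewrite perm1 fE.
  have [t /eqP sgt] : exists t, sg t <> t.
    by apply/existsNP => h; move/eqP: sg1; apply; apply/permP => t; rewrite perm1.
  rewrite (bigD1 t) //= fE; have [->|h] := eqVneq (u t (r i (sg t))) 0; first by rewrite mul0r mulr0.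
  by move: sgt; rewrite -val_eqE /= -(ur _ _ h) rr eqxx.
by rewrite rnM.
Qed.

End basis_tensors.

Section vertices.
Variables A B : nat -> 'I_p.+1 -> nat.

(* [vert] and [vsgn] index the terms in the expansion of the elementary tensor whose slots
   are e_(A (kap t) t) - e_(B (kap t) t). *)
Definition vert (kap : 'I_p.+1 -> nat) (eps : {ffun 'I_p.+1 -> bool}) (t : 'I_p.+1) : nat :=
  if eps t then B (kap t) t else A (kap t) t.

Definition vsgn (eps : {ffun 'I_p.+1 -> bool}) : K := \prod_t (if eps t then -1 else 1).

Lemma rn_vsgn eps : rn (vsgn eps) = 1.
Proof.
rewrite rn_prod big1 // => t _; case: ifP; rewrite ?rnN rn1 //.
Qed.

Lemma vert_prod (u : 'I_p.+1 -> vec) kap :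
  \sum_eps vsgn eps * \prod_t (u t (vert kap eps t) : K) =
  \prod_t (u t (A (kap t) t) - u t (B (kap t) t) : K).
Proof.
have E t : (u t (A (kap t) t) - u t (B (kap t) t) : K) =
    \sum_(y : bool) (if y then -1 else 1) * u t (if y then B (kap t) t else A (kap t) t).
  by rewrite big_bool /= mulN1r mul1r addrC.
under [RHS]eq_bigr do rewrite E.
rewrite bigA_distr_bigA; apply: eq_bigr => eps _.
by rewrite /vsgn -big_split /=; apply: eq_bigr => t _.
Qed.

Definition vsum (V : lmodType K) (F : ('I_p.+1 -> nat) -> V) kap : V :=
  \sum_eps vsgn eps *: F (vert kap eps).

Lemma vsum_flip (V : lmodType K) (F : ('I_p.+1 -> nat) -> V) kap t0 :
  let flip (eps : {ffun 'I_p.+1 -> bool}) := [ffun t => if t == t0 then ~~ eps t else eps t] in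
  vsum F kap = \sum_(eps : {ffun 'I_p.+1 -> bool} | ~~ eps t0)
     vsgn eps *: (F (vert kap eps) - F (vert kap (flip eps))).
Proof.
move=> flip.
have flipK : involutive flip.
  by move=> eps; apply/ffunP => t; rewrite !ffunE; case: eqP => // _; rewrite negbK.
have flip0 eps : flip eps t0 = ~~ eps t0 by rewrite ffunE eqxx.
have flips eps : vsgn (flip eps) = - vsgn eps.
  rewrite /vsgn (bigD1 t0) //= [in RHS](bigD1 t0) //= flip0 -mulNr; congr (_ * _).
    by case: (eps t0); rewrite ?opprK.
  by apply: eq_bigr => t /negPf tt; rewrite ffunE tt.
rewrite /vsum (bigID (fun eps : {ffun 'I_p.+1 -> bool} => ~~ eps t0)) /=.
rewrite [X in _ + X](reindex_inj (inv_inj flipK)) /=.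
rewrite [X in _ + X](eq_bigl (fun eps : {ffun 'I_p.+1 -> bool} => ~~ eps t0)); last first.
  by move=> eps; rewrite flip0 negbK.
by rewrite -big_split /=; apply: eq_bigr => eps _; rewrite flips scaleNr scalerBr.
Qed.

End vertices.

(* The indices are chosen so that exchanging A and B in one slot hardly changes Y on the
   coordinates used by the earlier blocks; grouping the terms of [vsum] two by two along
   the slot with the largest [kap t] gives the last bound. *)
Lemma block_sequence (Y : ('I_p.+1 -> nat) -> ('I_M -> vec) -> K^o) (m : ('I_p.+1 -> nat) -> nat)
    (Cb eta : R) :
  (forall j, mlin (Y j)) ->
  (forall j a, (forall t, bnd1 (a t)) -> rn (Y j a : K) <= Cb) -> 0 < eta ->
  exists (A B : nat -> 'I_p.+1 -> nat) (mcut : nat -> nat),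
  [/\ forall i t, (A i t %% p.+1)%N = t /\ (B i t %% p.+1)%N = t,
      forall i j t, (i < j)%N -> (B i t < A j t)%N,
      forall i t, (A i t < B i t)%N,
      {homo mcut : i j / (i <= j)%N} &
      (forall kap eps l, (forall t, kap t <= l)%N -> (m (vert A B kap eps) <= mcut l)%N) /\
      (forall kap l a, (exists t, l < kap t)%N -> (forall t, bnd1 (a t)) ->
         rn (vsum A B (fun j => Y j (fun t => cutv (mcut l) (a t))) kap : K) <= eta)].
Proof.
move=> Yl YC eta0; set N := p.+1.
pose mm q := (\max_(h : {ffun 'I_N -> 'I_q.+1}) m (fun t => h t))%N.
have mm_ge q (j : 'I_N -> nat) : (forall t, j t <= q)%N -> (m j <= mm q)%N.
  move=> jq; pose h := [ffun t => Ordinal (jq t : (j t < q.+1)%N)] : {ffun 'I_N -> 'I_q.+1}.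
  have -> : j = fun t => h t by apply/funext => t; rewrite ffunE.
  exact: (leq_bigmax (F := fun h : {ffun 'I_N -> 'I_q.+1} => m (fun t => h t))).
have mm_mono : {homo mm : i j / (i <= j)%N}.
  move=> i j ij; apply/bigmax_leqP => h _; apply: mm_ge => t.
  by rewrite (leq_trans _ ij) // -ltnS.
pose nE : R := #|{ffun 'I_N -> bool}|%:R.
have nE0 : 0 <= nE by [].
have del0 q : 0 < eta / ((nE + 1) * ((mm q)%:R ^+ M + 1)).
  by rewrite divr_gt0 // mulr_gt0 ?ltr_wpDl // exprn_ge0.
(* The pairs form a single sequence: number N i + t belongs to slot t of block i and has members
   congruent to t. It is tested with all smaller indices in the other slots and on all coordinates
   these can occupy. *)
pose sl i : 'I_N := inord (i %% N).
pose g_ (i q x : nat) (c : {ffun 'I_N -> 'I_q.+1} * {ffun 'I_M -> 'I_(mm q)}) : K :=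
  Y (fun t => if t == sl i then x else c.1 t) (fun s => evec R k (c.2 s)).
have gC i q x c : rn (g_ i q x c) <= Cb by apply: YC => t; exact: bnd1_evec.
have Pinf i : infin (fun x => (x %% N)%N = (i %% N)%N).
  move=> q; exists (N * q + i %% N)%N; first by rewrite (leq_trans (leq_pmull q (ltn0Sn p))) // leq_addr.
  by rewrite mulnC modnMDl modn_mod.
have [ps [a [b abP]]] := @pair_sequence R k _ (fun i x => (x %% N)%N = (i %% N)%N) g_
  (fun _ _ => Cb) (fun _ q => eta / ((nE + 1) * ((mm q)%:R ^+ M + 1))) Pinf gC (fun _ => del0).
have a_ltp i : (a i < ps i.+1)%N.
  by have [[/andP[_ h1] h2] _ _ _] := abP i; exact: ltn_trans h1 h2.
have b_ltp i : (b i < ps i.+1)%N by have [[_ h] _ _ _] := abP i.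
have a_ltb i : (a i < b i)%N by have [[/andP[_ h1] h2] _ _ _] := abP i.
have p_lea i : (ps i <= a i)%N by have [[/andP[h _] _] _ _ _] := abP i.
have ps_mono : {homo ps : i j / (i <= j)%N}.
  apply: homo_leq => [//|y x w|i]; first exact: leq_trans.
  exact: leq_trans (p_lea i) (ltnW (a_ltp i)).
have tau_mod i (t : 'I_N) : ((N * i + t) %% N)%N = t by rewrite mulnC modnMDl modn_small.
pose A i (t : 'I_N) := a (N * i + t)%N; pose B i (t : 'I_N) := b (N * i + t)%N.
(* The pairs of the blocks up to l are exactly those numbered below N (l + 1), so this cut contains
   everything built from them. *)
pose mcut l := mm (ps (N * l.+1)%N).
have vlt kap eps t : (vert A B kap eps t < ps (N * kap t + t).+1)%N.
  by rewrite /vert; case: ifP => _; [exact: b_ltp|exact: a_ltp].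
exists A, B, mcut; split.
- move=> i t; have [_ h1 h2 _] := abP (N * i + t)%N.
  by rewrite /A /B h1 h2 tau_mod.
- move=> i j t ij; apply: leq_trans (b_ltp _) (leq_trans (ps_mono _ _ _) (p_lea _)).
  by rewrite ltn_add2r ltn_mul2l.
- by move=> i t; exact: a_ltb.
- by move=> i j ij; apply/mm_mono/ps_mono; rewrite leq_mul2l ltnS ij orbT.
split=> [kap eps l kl|kap l x [t1 lt1] x1].
  apply: mm_ge => t; apply/ltnW/(leq_trans (vlt _ _ _))/ps_mono.
  rewrite mulnS [(N + _)%N]addnC -addnS leq_add ?leq_mul2l ?kl ?orbT //.
pose tau (t : 'I_N) := (N * kap t + t)%N.
(* The slot whose pair was chosen last, ties within a block being broken by the enumeration: all
   other slots then hold indices below [ps (tau ts)], as the tests [g_] require. *)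
case: (@arg_maxnP _ t1 xpredT tau isT) => ts _ tsmax.
have {}tsmax t : (tau t <= tau ts)%N by exact: tsmax.
have tau_lt t : t != ts -> (tau t < tau ts)%N.
  move=> tts; rewrite ltn_neqAle tsmax // andbT; apply: contra tts => /eqP h.
  by apply/eqP/val_inj; have := tau_mod (kap t) t; rewrite -/(tau t) h tau_mod => /esym.
have sls : sl (tau ts) = ts by apply/val_inj; rewrite /= inordK tau_mod // ltn_ord.
set q := ps (tau ts).
have mle : (mcut l <= mm q)%N.
  apply/mm_mono/ps_mono; apply: leq_trans (tsmax t1).
  by rewrite /tau (leq_trans _ (leq_addr _ _)) // leq_mul2l lt1 orbT.
have Vl : mlin (fun y : 'I_M -> vec => vsum A B (fun j => Y j y) kap : K^o).
  move=> i y c u v; rewrite /vsum scaler_sumr -big_split; apply: eq_bigr => eps _ /=.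
  by rewrite Yl scalerDr scalerA [vsgn eps * c]mulrC -scalerA.
have := @mlin_coordinates_bound R k K^o M _ (mcut l) [:: x] (eta / ((mm q)%:R ^+ M + 1)) Vl.
rewrite big_seq1 => h; apply: le_trans (h _) _ => {h} [g gm|].
  rewrite big_seq1 rnZ -[leRHS]mul1r; apply: ler_pM; rewrite ?rn_ge0 //.
    rewrite rn_prod; apply: prodr_ile1 => t _; rewrite rn_ge0; exact: x1.
  rewrite (vsum_flip A B _ kap ts); apply: le_trans (rn_sum _ _ _) _.
  apply: (@le_trans _ _ (\sum_(eps : {ffun 'I_N -> bool} | ~~ eps ts)
      eta / ((nE + 1) * ((mm q)%:R ^+ M + 1)))).
    apply: ler_sum => eps /negPf epst; rewrite rnZ rn_vsgn mul1r.
    have [_ _ _ H] := abP (tau ts).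
    pose c1 := [ffun t => inord (vert A B kap eps t)] : {ffun 'I_N -> 'I_q.+1}.
    pose c2 := [ffun t => Ordinal (leq_trans (gm t) mle)] : {ffun 'I_M -> 'I_(mm q)}.
    have := H (c1, c2); rewrite /g_ /= sls.
    have -> : (fun s => evec R k (c2 s)) = fun s => evec R k (g s).
      by apply/funext => s; rewrite ffunE.
    have c1E t : t != ts -> c1 t = vert A B kap eps t :> nat.
      move=> tts; rewrite ffunE inordK // ltnS ltnW //.
      by apply: leq_trans (vlt _ _ _) _; apply: ps_mono; exact: tau_lt.
    rewrite (_ : (fun t => if t == ts then a (tau ts) else c1 t) = vert A B kap eps); last first.
      apply/funext => t; have [->|tts] := eqVneq t ts; first by rewrite /vert epst.
      exact: c1E.
    rewrite [X in _ - Y X _](_ : _ = vert A B kap [ffun t => if t == ts then ~~ eps t else eps t]) //.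
    apply/funext => t; have [->|tts] := eqVneq t ts.
      by rewrite /vert ffunE eqxx epst.
    by rewrite c1E // /vert ffunE (negPf tts).
  rewrite sumr_const -[leLHS]mulr_natl.
  apply: (@le_trans _ _ (nE * (eta / ((nE + 1) * ((mm q)%:R ^+ M + 1))))).
    by rewrite ler_wpM2r ?(ltW (del0 _)) // ler_nat; exact: max_card.
  have P0 : 0 < (mm q)%:R ^+ M + 1 :> R by rewrite ltr_wpDl // exprn_ge0.
  have nE1 : 0 < nE + 1 by rewrite ltr_wpDl.
  rewrite (_ : nE * _ = (nE / (nE + 1)) * (eta / ((mm q)%:R ^+ M + 1))); last first.
    by field; rewrite !gt_eqF.
  rewrite ler_piMl ?divr_ge0 ?(ltW eta0) ?(ltW P0) // ler_pdivrMr // mul1r; lra.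
rewrite -mulrA ler_piMr ?(ltW eta0) // mulrC ler_pdivrMr ?mul1r ?ltr_wpDl ?exprn_ge0 //.
by rewrite ler_wpDr // lerXn2r ?nnegrE // ler_nat.
Qed.

End blocks.

(** * The obstruction for injective powers of l_1 *)

Section injective_case.
Variables (R : realType) (k : scalar_kind) (M p : nat).
Local Notation K := (scalars R k).
Local Notation vec := (nat -> K^o).

Lemma mint_sum (mu : pmeasure R k M) (I : finType) (c : I -> K)
    (F : I -> ('I_M -> vec) -> K^o) :
  mint mu (fun a => \sum_i c i * F i a : K^o) = \sum_i c i * mint mu (F i).
Proof.
rewrite /mint; under eq_bigr do rewrite scaler_sumr.
rewrite exchange_big; apply: eq_bigr => i _; rewrite mulr_sumr; apply: eq_bigr => l _.
by rewrite -[LHS]/(_ * (c i * _)) -[in RHS]/(_ * F i _) mulrCA.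
Qed.

Lemma mintB (mu : pmeasure R k M) (F G : ('I_M -> vec) -> K^o) :
  mint mu (fun a => F a - G a) = mint mu F - mint mu G.
Proof. by rewrite /mint -sumrB; apply: eq_bigr => l _; rewrite scalerBr. Qed.

(** Needed for differences of two entries of modulus at most 1; each of the p + 1 slots contributes
    a factor 2. *)
Lemma hform_bound_scaled A n (y : 'I_p.+1 -> nat -> K) :
  (forall y : 'I_p.+1 -> nat -> K, (forall t j, (j < n)%N -> rn (y t j) <= 1) ->
     rn (hform n y) <= A) ->
  (forall t j, (j < n)%N -> rn (y t j) <= 2) -> rn (hform n y) <= 2 ^+ p.+1 * A.
Proof.
move=> HA y2.
have -> : hform n y = ofR k (2 ^+ p.+1) * hform n (fun t j => ofR k 2^-1 * y t j).
  rewrite /hform mulr_sumr; apply: eq_bigr => I _; rewrite mulrCA; congr (_ * _).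
  rewrite rmorphXn /= -[X in _ ^+ X]card_ord -prodr_const -big_split /=.
  apply: eq_bigr => t _; rewrite mulrA -ofRM divff ?ofR1 ?mul1r //.
rewrite rnM rn_ofR ger0_norm ?exprn_ge0 // ler_wpM2l ?exprn_ge0 //.
apply: HA => t j jn; rewrite rnM rn_ofR ger0_norm // mulrC ler_pdivrMr // mul1r; exact: y2.
Qed.

(** Vectors and functionals exchange roles with respect to the projective case: the Hilbert
    coefficients form a vector of injective norm O(n), and the triangular functionals are the
    sequence to which [spreading_bound] applies. *)
Theorem injective_obstruction (TN TM : completeNormedModType K)
    (thN : ('I_p.+1 -> l1 R k) -> TN) (thM : ('I_M -> l1 R k) -> TM)
    (S : {linear TN -> TN}) (w : {perm 'I_p.+1} -> K) :
  (0 < M)%N -> (M <= p)%N -> injective_tensor thN -> injective_tensor thM ->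
  continuous S -> w 1%g != 0 ->
  (forall x, S (thN x) = \sum_sg w sg *: thN (fun i => x (sg i))) ->
  ~ isomorphic_to_subspace (range S) TM.
Proof.
move=> M0 Mp NP MP Sc w1 SE [BB [_ [f [g [[fAB gBA] [fK gK] flin [fc gc]]]]]].
have [A0 Alin] := range_linear_submod S.
have [Ci Ci0 Hf] := submod_isomorphism_bounds A0 Alin fAB gBA fK gK flin fc gc.
have [CS CS0 HS] := continuous_linear_rn_bound Sc.
have rS z : range S (S z) by exists z.
pose bt (j : 'I_p.+1 -> nat) := thN (fun t => l1basis R k (j t)).
pose y j := f (S (bt j)).
have fS (I : finType) (b : I -> K) (r : I -> 'I_p.+1 -> nat) :
    \sum_i b i *: y (r i) = f (S (\sum_i b i *: bt (r i))).
  have [_ h] := additive_on_sum (index_enum I) b A0 Alin flin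
    (fun i => rS (bt (r i))).
  rewrite linear_sum -h; congr f; apply: eq_bigr => i _; rewrite linearZ //.
have upY (I : finType) (b : I -> K) (r : I -> 'I_p.+1 -> nat) :
    rn (\sum_i b i *: y (r i)) <= Ci * CS * rn (\sum_i b i *: bt (r i)).
  rewrite fS; have [h _] := Hf _ (rS (\sum_i b i *: bt (r i))).
  by apply: le_trans h _; rewrite -mulrA ler_wpM2l ?(ltW Ci0) // HS.
have loY (I : finType) (b : I -> K) (r : I -> 'I_p.+1 -> nat) :
    rn (S (\sum_i b i *: bt (r i))) <= Ci * rn (\sum_i b i *: y (r i)).
  by rewrite fS; have [_ h] := Hf _ (rS (\sum_i b i *: bt (r i))).
have [A A_ge0 HA] := hform_bound R k p.
have rw : 0 < rn (w 1%g).
  by rewrite lt_def rn_ge0 andbT; apply: contra w1 => /eqP/rn0_eq0 h; apply/eqP; exact: h.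
pose Cl := Ci / rn (w 1%g); have Cl0 : 0 < Cl by rewrite divr_gt0.
pose b1 := Ci * CS * (2 ^+ p.+1 * A).
have b10 : 0 <= b1 by rewrite !mulr_ge0 ?(ltW Ci0) ?(ltW CS0) // exprn_ge0.
pose D := Cl * (2 * b1 + 1) + 1.
have D0 : 0 <= D by rewrite addr_ge0 // mulr_ge0 ?(ltW Cl0) // addr_ge0 // mulr_ge0.
have [L HL] := growth M0 Mp D0.
set n := (2 ^ L.+1)%N; set G := (_ + 1) in HL.
have n1 : 1 <= n%:R :> R by rewrite ler1n expn_gt0.
pose nI : R := #|{: midx p n}|%:R; have nI0 : 0 <= nI by [].
pose nE : R := #|{ffun 'I_p.+1 -> bool}|%:R.
have nE0 : 0 < nE by rewrite ltr0n card_ffun card_bool expn_gt0.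
(* The form has nI coefficients of modulus at most 1 and is compared with n increments: [tol] keeps
   both nI tol and 4 Cl n nI tol at most 1. *)
pose tol := ((4 * Cl + 1) * (n%:R * nI + 1))^-1.
have t1 : 0 < 4 * Cl + 1 by rewrite addr_gt0 // mulr_gt0.
have t2 : 0 < n%:R * nI + 1 by rewrite ltr_wpDl // mulr_ge0.
have tol0 : 0 < tol by rewrite invr_gt0 mulr_gt0.
have tolE : tol * ((4 * Cl + 1) * (n%:R * nI + 1)) = 1 by rewrite mulVf // gt_eqF // mulr_gt0.
have tolI : tol * nI <= 1.
  rewrite -[leRHS]tolE ler_wpM2l ?(ltW tol0) //.
  have h1 : nI <= n%:R * nI by rewrite ler_peMl.
  have h2 : 0 <= 4 * Cl * (n%:R * nI + 1) by apply: mulr_ge0 (ltW t2); apply: mulr_ge0 (ltW Cl0).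
  by rewrite mulrDl mul1r; lra.
have tolN : n%:R * (nI * (4 * Cl * tol)) <= 1.
  rewrite -[leRHS]tolE [leLHS](_ : _ = tol * (4 * Cl * (n%:R * nI))); last by ring.
  rewrite ler_wpM2l ?(ltW tol0) //; have h1 : 0 <= n%:R * nI by rewrite mulr_ge0.
  have := Cl0; lra.
(* A [vsum] has nE terms with unit coefficients, so this error per vector adds up to [tol] per
   block. *)
have e00 : 0 < tol / nE by rewrite divr_gt0.
have [Y [m [Yl Ym Y1 Y2]]] := l1_model y M0 MP e00.
pose Cb := Ci * CS + tol / nE.
have YC j a : (forall t, bnd1 (a t)) -> rn (Y j a : K) <= Cb.
  move=> a1; have := Y2 'I_1 (fun=> j) (fun=> 1) a a1; rewrite !big_ord1 mul1r scale1r rn1 mulr1.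
  move=> h; apply: le_trans h _; rewrite lerD2r.
  have := upY 'I_1 (fun=> 1) (fun=> j); rewrite !big_ord1 !scale1r => h; apply: le_trans h _.
  rewrite -[leRHS]mulr1 ler_wpM2l ?mulr_ge0 ?(ltW Ci0) ?(ltW CS0) //.
  apply: le_trans (injective_elementary _ NP) _; apply: prodr_ile1 => t _.
  by rewrite rn_ge0 rn_l1basis.
have [av [bv [mcut [res ba ab mcut_mono [mvert small]]]]] := block_sequence m Yl YC tol0.
pose Yv kap (a : 'I_M -> vec) : K^o := vsum av bv (fun j => Y j a) kap.
pose yv := vsum av bv y.
have flat (V : lmodType K) (F : ('I_p.+1 -> nat) -> V) (I : finType)
    (b : I -> K) (kap : I -> 'I_p.+1 -> nat) :
    \sum_(z : I * {ffun 'I_p.+1 -> bool}) (b z.1 * vsgn R k z.2) *: F (vert av bv (kap z.1) z.2) =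
    \sum_i b i *: vsum av bv F (kap i).
  rewrite -(pair_bigA _ (fun i e => (b i * vsgn R k e) *: F (vert av bv (kap i) e))) /=.
  by apply: eq_bigr => i _; rewrite scaler_sumr; apply: eq_bigr => e _; rewrite scalerA.
have flatn (I : finType) (b : I -> K) :
    \sum_(z : I * {ffun 'I_p.+1 -> bool}) rn (b z.1 * vsgn R k z.2) = nE * \sum_i rn (b i).
  rewrite -(pair_bigA _ (fun i e => rn (b i * vsgn R k e))) /= mulr_sumr.
  apply: eq_bigr => i _; under eq_bigr do rewrite rnM rn_vsgn mulr1.
  by rewrite sumr_const -[LHS]mulr_natl.
have Y1v (I : finType) (b : I -> K) (kap : I -> 'I_p.+1 -> nat) B :
    (forall a, (forall t, bnd1 (a t)) -> rn (\sum_i b i * Yv (kap i) a) <= B) ->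
    rn (\sum_i b i *: yv (kap i)) <= B + tol * \sum_i rn (b i).
  move=> H; rewrite -flat.
  have := Y1 _ (fun z : I * {ffun 'I_p.+1 -> bool} => vert av bv (kap z.1) z.2)
    (fun z => b z.1 * vsgn R k z.2) B; rewrite flatn mulrA divfK ?gt_eqF //; apply => a a1.
  have := H a a1; rewrite -[\sum_i _]/(\sum_i b i *: vsum av bv (fun j => Y j a) (kap i)).
  by rewrite -flat.
have Y2v (I : finType) (b : I -> K) (kap : I -> 'I_p.+1 -> nat) a :
    (forall t, bnd1 (a t)) -> rn (\sum_i b i * Yv (kap i) a) <=
    rn (\sum_i b i *: yv (kap i)) + tol * \sum_i rn (b i).
  move=> a1; rewrite -[\sum_i b i * _]/(\sum_i b i *: vsum av bv (fun j => Y j a) (kap i)) -!flat.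
  have := Y2 _ (fun z : I * {ffun 'I_p.+1 -> bool} => vert av bv (kap z.1) z.2)
    (fun z => b z.1 * vsgn R k z.2) a a1.
  by rewrite flatn mulrA divfK ?gt_eqF.
have Yvl kap : mlin (Yv kap).
  move=> i z c u v; rewrite /Yv /vsum scaler_sumr -big_split; apply: eq_bigr => eps _ /=.
  by rewrite Yl scalerDr !scalerA [vsgn _ _ eps * c]mulrC.
have YvC kap a : (forall t, bnd1 (a t)) -> rn (Yv kap a : K) <= nE * Cb.
  move=> a1; apply: le_trans (rn_sum _ _ _) _.
  rewrite /nE mulr_natl -sumr_const; apply: ler_sum => e _.
  by rewrite rnZ rn_vsgn mul1r YC.
pose xf (l : nat) (kap : 'I_p.+1 -> nat) : K :=
  \prod_t ((if t == ord0 then kap t == l else kap t < l)%N)%:R.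
have av_inj i j t : av i t = av j t -> i = j.
  move=> h; have [lt|lt|//] := ltngtP i j.
    by have := ltn_trans (ab i t) (ba _ _ t lt); rewrite h ltnn.
  by have := ltn_trans (ab j t) (ba _ _ t lt); rewrite h ltnn.
have av_bv i j t : av i t != bv j t.
  have [lt|lt|->] := ltngtP i j; last by rewrite neq_ltn ab.
    by rewrite neq_ltn (ltn_trans (ltn_trans (ab i t) (ba _ _ t lt)) (ab j t)).
  by rewrite neq_ltn orbC ba.
have /choice[mu muP] : forall l, exists mu : pmeasure R k M,
    forall kap : {ffun 'I_p.+1 -> 'I_l.+1},
    rn (xf l (fun t => kap t) - ofR k Cl * mint mu (Yv (fun t => kap t))) <= 2 * (Cl * tol).
  move=> l; apply: (@measure_lift R k M _
    (fun kap : {ffun 'I_p.+1 -> 'I_l.+1} => xf l (fun t => kap t))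
    (fun kap => Yv (fun t => kap t)) Cl tol (nE * Cb)) => //.
  - by move=> kap a; exact: YvC.
  move=> b B HB; have h := Y1v _ b (fun (kap : {ffun 'I_p.+1 -> 'I_l.+1}) t => kap t) B HB.
  (* This tuple realises [xf] on the N-fold power. It reads only A-indices, which never coincide
     with B-indices, so on a block it gives the indicator of the condition on kap, and the
     isomorphism bounds apply. *)
  pose u (t : 'I_p.+1) : vec := fun j => (if t == ord0 then j == av l t
    else [exists i : 'I_l, j == av i t])%:R.
  have u1 t : bnd1 (u t) by move=> j; rewrite /u; case: (if _ then _ else _); rewrite ?rn1 ?rn0.
  have ures t j : u t j != 0 -> (j %% p.+1)%N = t.
    rewrite /u; case: (t == ord0).
      by case: (j =P av l t) => [-> _|_]; [have [] := res l t|rewrite eqxx].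
    by case: existsP => [[i /eqP ->] _|_]; [have [] := res i t|rewrite eqxx].
  have vres (z : {ffun 'I_p.+1 -> 'I_l.+1} * {ffun 'I_p.+1 -> bool}) t :
      (vert av bv (fun t => z.1 t) z.2 t %% p.+1)%N = t.
    by rewrite /vert; have [h1 h2] := res (z.1 t) t; case: ifP.
  have := @basis_lower R k p TN thN NP _ (fun z => b z.1 * vsgn R k z.2)
    (fun z => vert av bv (fun t => z.1 t) z.2) S w u SE u1 ures vres.
  move=> low; have := le_trans low (loY _ _ _).
  rewrite (flat _ y _ b (fun (kap : {ffun 'I_p.+1 -> 'I_l.+1}) t => kap t)) => {}low.
  have := le_trans low (ler_wpM2l (ltW Ci0) h).
  have -> : \sum_(z : {ffun 'I_p.+1 -> 'I_l.+1} * {ffun 'I_p.+1 -> bool})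
      b z.1 * vsgn R k z.2 * \prod_t (u t (vert av bv (fun t => z.1 t) z.2 t) : K) =
      \sum_kap b kap * xf l (fun t => kap t).
    rewrite -(pair_bigA _ (fun (i : {ffun 'I_p.+1 -> 'I_l.+1}) e => b i * vsgn R k e *
       \prod_t (u t (vert av bv (fun t => i t) e t) : K))) /=.
    apply: eq_bigr => kap _; under eq_bigr do rewrite -mulrA.
    rewrite -mulr_sumr vert_prod; congr (_ * _); apply: eq_bigr => t _; rewrite /u.
    case: eqP => [->|_].
      rewrite [(bv _ _ == _)]eq_sym (negPf (av_bv _ _ _)) subr0; congr (_%:R).
      congr nat_of_bool; apply/eqP/eqP => [/av_inj //|-> //].
    have -> : [exists i : 'I_l, bv (kap t) t == av i t] = false.
      by apply/negbTE/existsPn => i; rewrite eq_sym.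
    rewrite subr0; congr (_%:R); congr nat_of_bool; apply/existsP/idP => [[i /eqP/av_inj ->] //|lt].
    by exists (Ordinal lt).
  by rewrite /Cl mulrAC ler_pdivlMr // mulrC.
have [s [sinc sU]] := spreading_bound mu L.+1 mcut_mono.
have slt := increasing_upto sinc; rewrite -/n in sinc sU slt.
pose kI (I : midx p n) (t : 'I_p.+1) := s (ix I t).+1.
pose th (a : 'I_M -> vec) : K^o := \sum_I hcoef R k I * Yv (kI I) a.
have thl : mlin th.
  move=> i z c u v; have E0 (x : K^o) : c *: x = c * x by [].
  rewrite E0 /th mulr_sumr -big_split; apply: eq_bigr => I _ /=.
  by rewrite (Yvl (kI I)) E0; ring.
pose beta := b1 * n%:R + 1.
(* Transported back to the N-fold power, the norm of this vector is a supremum of Hilbert forms over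
   bounded tuples, evaluated at differences of two entries. *)
have thb a : (forall t, bnd1 (a t)) -> rn (th a : K) <= beta.
  move=> a1; apply: le_trans (Y2v _ _ _ _ a1) _; apply: lerD; last first.
    apply: le_trans tolI; rewrite ler_wpM2l ?(ltW tol0) // /nI -sum1_card natr_sum.
    by apply: ler_sum => I _; exact: rn_hcoef.
  rewrite -flat; apply: le_trans (upY _ _ _) _.
  rewrite /b1 -[leRHS]mulrA; apply: ler_wpM2l; first by rewrite mulr_ge0 ?(ltW Ci0) ?(ltW CS0).
  apply: (basis_upper NP) => u u1.
  rewrite -(pair_bigA _ (fun (I : midx p n) e => hcoef R k I * vsgn R k e *
       \prod_t (u t (vert av bv (kI I) e t) : K))) /=.
  rewrite [X in rn X](_ : _ = hform n (fun t j => u t (av (s j.+1) t) - u t (bv (s j.+1) t) : K)).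
    rewrite -mulrA; apply: hform_bound_scaled => [z z1|t j jn]; first exact: HA.
    by apply: le_trans (rnB _ _) _; apply: le_trans (lerD (u1 _ _) (u1 _ _)) _.
  apply: eq_bigr => I _; under eq_bigr do rewrite -mulrA.
  by rewrite -mulr_sumr vert_prod.
have := sU K^o th beta thl thb; rewrite -/G => H.
pose X (i : nat) (I : midx p n) : K :=
    \prod_t ((if t == ord0 then ix I t == i :> nat else ix I t < i)%N)%:R.
pose Df (i : nat) (I : midx p n) : K := mint (mu (s i.+1)) (fun a =>
  Yv (kI I) (fun t => cutv (mcut (s i.+1)) (a t)) - Yv (kI I) (fun t => cutv (mcut (s i)) (a t))).
(* If some block index exceeds s (i+1), both cuts see almost nothing and X is 0. If all are at most
   s i, the cuts agree and X is 0 since slot 0 cannot have index i. Otherwise the outer cut is the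
   full value, given by [muP] within 2 Cl tol, and the inner one contributes at most Cl tol. *)
have near (i : nat) (I : midx p n) : (i < n)%N -> rn (ofR k Cl * Df i I - X i I) <= 4 * Cl * tol.
  move=> iN.
  have slt' j j' : (j < n)%N -> (j' < n)%N -> (s j.+1 < s j'.+1)%N = (j < j')%N.
    move=> jn jn'; apply/idP/idP => [h|h]; last exact: slt.
    rewrite ltnNge leq_eqVlt; apply/negP => /predU1P[e|e]; first by rewrite e ltnn in h.
    by have := ltn_trans h (slt _ _ (e : (j'.+1 < j.+1)%N) jn); rewrite ltnn.
  have sle j j' : (j < n)%N -> (j' < n)%N -> (s j.+1 <= s j'.+1)%N = (j <= j')%N.
    by move=> jn jn'; rewrite leqNgt slt' // -leqNgt.
  have seq j j' : (j < n)%N -> (j' < n)%N -> (s j.+1 == s j'.+1)%N = (j == j')%N.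
    by move=> jn jn'; rewrite !eqn_leq !sle.
  have Clt : 0 <= Cl * tol by rewrite mulr_ge0 ?(ltW Cl0) ?(ltW tol0).
  have low l (mu' : pmeasure R k M) : (exists t, l < kI I t)%N ->
      rn (mint mu' (fun a => Yv (kI I) (fun t => cutv (mcut l) (a t)))) <= tol.
    by move=> h; apply: rn_mint => a a1; exact: small.
  have [hi|hi] := pselect (exists t, s i.+1 < kI I t)%N.
    have hi' : (exists t, s i < kI I t)%N.
      by have [t ht] := hi; exists t; apply: ltn_trans ht; exact: sinc.
    have -> : X i I = 0.
      have [t] := hi; rewrite /kI slt' // => it; rewrite /X (bigD1 t) //=.
      case: (t == ord0); first by rewrite gtn_eqF // mul0r.
      by rewrite ltnNge (ltnW it) mul0r.
    rewrite subr0 rnM rn_ofR gtr0_norm // /Df mintB.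
    have := ler_wpM2l (ltW Cl0) (rnB
      (mint (mu (s i.+1)) (fun a => Yv (kI I) (fun t => cutv (mcut (s i.+1)) (a t))))
      (mint (mu (s i.+1)) (fun a => Yv (kI I) (fun t => cutv (mcut (s i)) (a t))))).
    have := ler_wpM2l (ltW Cl0) (low _ (mu (s i.+1)) hi).
    have := ler_wpM2l (ltW Cl0) (low _ (mu (s i.+1)) hi').
    move: Clt; rewrite !mulrDr; lra.
  have {}hi t : (kI I t <= s i.+1)%N by rewrite leqNgt; apply/negP => h; apply: hi; exists t.
  have full l a : (forall t, kI I t <= l)%N -> Yv (kI I) (fun t => cutv (mcut l) (a t)) = Yv (kI I) a.
    by move=> h; apply: eq_bigr => e _; rewrite Ym // mvert.
  pose kap := [ffun t => Ordinal (hi t : (kI I t < (s i.+1).+1)%N)].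
  have kapE : (fun t => nat_of_ord (kap t)) = kI I by apply/funext => t; rewrite ffunE.
  have := muP (s i.+1) kap; rewrite kapE.
  have -> : xf (s i.+1) (kI I) = X i I.
    by apply: eq_bigr => t _; rewrite /kI seq // slt'.
  rewrite -rnN opprB => close.
  have DfE : Df i I = mint (mu (s i.+1)) (Yv (kI I)) -
      mint (mu (s i.+1)) (fun a => Yv (kI I) (fun t => cutv (mcut (s i)) (a t))).
    by rewrite /Df mintB; congr (mint _ _ - _); apply/funext => a; exact: full.
  have [lo|lo] := pselect (exists t, s i < kI I t)%N.
    rewrite DfE mulrBr addrAC; apply: le_trans (rnB _ _) _.
    have := ler_wpM2l (ltW Cl0) (low _ (mu (s i.+1)) lo).
    rewrite rnM rn_ofR gtr0_norm //; move: close Clt; lra.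
  have {}lo t : (kI I t <= s i)%N by rewrite leqNgt; apply/negP => h; apply: lo; exists t.
  have -> : Df i I = 0.
    rewrite DfE; apply/eqP; rewrite subr_eq0; apply/eqP; congr mint.
    by apply/esym/funext => a; exact: full.
  have -> : X i I = 0.
    rewrite /X (bigD1 ord0) //= (_ : (ix I ord0 == i :> nat) = false) ?mul0r //.
    apply/negbTE/eqP => h; have := leq_ltn_trans (lo ord0) (sinc _ iN).
    by rewrite /kI h ltnn.
  by rewrite mulr0 subr0 rn0; move: Clt; lra.
have HE (i : nat) : mint (mu (s i.+1)) (fun a => th (fun t => cutv (mcut (s i.+1)) (a t)) -
      th (fun t => cutv (mcut (s i)) (a t))) = \sum_I hcoef R k I * Df i I.
  rewrite -(mint_sum (mu (s i.+1)) (fun J : midx p n => hcoef R k J) (fun I a =>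
    Yv (kI I) (fun t => cutv (mcut (s i.+1)) (a t)) - Yv (kI I) (fun t => cutv (mcut (s i)) (a t)))).
  congr mint; apply/funext => a; rewrite /th -sumrB; apply: eq_bigr => I _.
  by rewrite mulrBr.
have triE (i : 'I_n) : \sum_I hcoef R k I * X i I = ofR k ((\sum_(j < i) hil R i j) ^+ p).
  by rewrite -(hform_triangle R k p (ltn_ord i)).
have tr := hil_triangle R p L; rewrite -/n in tr.
have : rn (\sum_(i < n) ofR k ((\sum_(j < i) hil R i j) ^+ p)) <= Cl * (beta * G) + 1.
  rewrite [X in rn X](_ : _ = ofR k Cl * (\sum_(i < n) \sum_I hcoef R k I * Df i I) -
      \sum_(i < n) \sum_I hcoef R k I * (ofR k Cl * Df i I - X i I)); last first.
    rewrite mulr_sumr -sumrB; apply: eq_bigr => i _; rewrite -triE mulr_sumr -sumrB.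
    by apply: eq_bigr => I _; ring.
  apply: le_trans (rnB _ _) _; apply: lerD.
    rewrite rnM rn_ofR gtr0_norm // ler_wpM2l ?(ltW Cl0) //.
    apply: le_trans H; rewrite le_eqVlt; apply/orP; left; apply/eqP; congr rn.
    by apply: eq_bigr => i _; rewrite HE.
  apply: le_trans tolN; apply: le_trans (rn_sum _ _ _) _.
  have -> : n%:R * (nI * (4 * Cl * tol)) = \sum_(i < n) nI * (4 * Cl * tol).
    by rewrite sumr_const card_ord -[RHS]mulr_natl.
  apply: ler_sum => i _; apply: le_trans (rn_sum _ _ _) _.
  have -> : nI * (4 * Cl * tol) = \sum_(I : midx p n) (4 * Cl * tol).
    by rewrite sumr_const -[RHS]mulr_natl.
  apply: ler_sum => I _; rewrite rnM -[leRHS]mul1r; apply: ler_pM; rewrite ?rn_ge0 ?rn_hcoef //.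
  exact: near.
rewrite -raddf_sum /= rn_ofR.
rewrite ger0_norm; last by apply: le_trans tr; rewrite mulr_ge0 // exprn_ge0 // divr_ge0.
move=> /(le_trans tr).
have n2 : n%:R = 2 * (2 ^ L)%:R :> R by rewrite /n expnS natrM.
have P1 : 1 <= (2 ^ L)%:R :> R by rewrite ler1n expn_gt0.
have G1 : 1 <= G by rewrite /G lerDr mulr_ge0 // exprn_ge0.
move=> main.
have : (2 ^ L)%:R * (L%:R / 2) ^+ p <= (2 ^ L)%:R * (D * G).
  apply: le_trans main _; rewrite /beta n2; move: (2 ^ L)%:R P1 => P P1.
  have h1 : 1 <= P * G by rewrite -[1]mulr1 ler_pM.
  have h2 : Cl * (1 * G) <= Cl * (P * G).
    by rewrite ler_wpM2l ?(ltW Cl0) // ler_wpM2r // (le_trans ler01).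
  rewrite (_ : P * (D * G) = Cl * (b1 * (2 * P) * G) + Cl * (P * G) + P * G); last by rewrite /D; ring.
  rewrite mulrDl mulrDr; lra.
by rewrite ler_pM2l ?(lt_le_trans ltr01) // leNgt HL.
Qed.

End injective_case.

(** * Symmetrization and identity as weighted sums over permutations *)

Lemma symmetrization_weights (R : realType) (k : scalar_kind) (X : normedModType (scalars R k))
    (p : nat) (T : normedModType (scalars R k)) (th : ('I_p.+1 -> X) -> T) (S : {linear T -> T}) :
  symmetrization th S -> forall x,
  S (th x) = \sum_(sg : 'S_p.+1) ((p.+1)`!%:R^-1 : scalars R k) *: th (fun i => x (sg i)).
Proof. by move=> [_ SE] x; rewrite SE scaler_sumr. Qed.

Lemma identity_weights (R : realType) (k : scalar_kind) (X : Type)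
    (p : nat) (T : normedModType (scalars R k)) (th : ('I_p.+1 -> X) -> T) x :
  th x = \sum_(sg : 'S_p.+1) ((sg == 1%g)%:R : scalars R k) *: th (fun i => x (sg i)).
Proof.
rewrite (bigD1 1%g) //= eqxx scale1r big1 ?addr0; last first.
  by move=> sg /negbTE ->; rewrite scale0r.
by congr th; apply/funext => i; rewrite perm1.
Qed.

Theorem corollary7p3 (R : realType) (k : scalar_kind) (M N : nat)
    (M_gt0 : (0 < M)%N) (ltMN : (M < N)%N) :
  [/\ (* (i) *)
      forall (TN : completeNormedModType (scalars R k))
        (thetaN : ('I_N -> c0 R k) -> TN) (SN : {linear TN -> TN})
        (TM : completeNormedModType (scalars R k))
        (thetaM : ('I_M -> c0 R k) -> TM),
        projective_tensor thetaN -> symmetrization thetaN SN ->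
        projective_tensor thetaM ->
        ~ isomorphic_to_subspace_of_quotient (range SN) TM,
      (* (ii) *)
      forall (TN : completeNormedModType (scalars R k))
        (thetaN : ('I_N -> c0 R k) -> TN)
        (TM : completeNormedModType (scalars R k))
        (thetaM : ('I_M -> c0 R k) -> TM),
        projective_tensor thetaN -> projective_tensor thetaM ->
        ~ isomorphic_to_subspace_of_quotient [set: TN] TM,
      (* (iii) *)
      forall (TN : completeNormedModType (scalars R k))
        (thetaN : ('I_N -> l1 R k) -> TN) (SN : {linear TN -> TN})
        (TM : completeNormedModType (scalars R k))
        (thetaM : ('I_M -> l1 R k) -> TM),
        injective_tensor thetaN -> symmetrization thetaN SN ->
        injective_tensor thetaM ->
        ~ isomorphic_to_subspace (range SN) TM
    & (* (iv) *)
      forall (TN : completeNormedModType (scalars R k))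
        (thetaN : ('I_N -> l1 R k) -> TN)
        (TM : completeNormedModType (scalars R k))
        (thetaM : ('I_M -> l1 R k) -> TM),
        injective_tensor thetaN -> injective_tensor thetaM ->
        ~ isomorphic_to_subspace [set: TN] TM].
Proof.
case: N ltMN => [//|p] Mp.
have fact0 : ((p.+1)`!%:R : scalars R k)^-1 != 0 by rewrite invr_eq0 pnatr_eq0 -lt0n fact_gt0.
have one0 : ((1%g == 1%g :> 'S_p.+1)%:R : scalars R k) != 0 by rewrite eqxx oner_eq0.
(* The full tensor power is the range of the identity, which corresponds to the point mass at the
   trivial permutation. *)
have rid (E : completeNormedModType (scalars R k)) : [set: E] = range (idfun : {linear E -> E}).
  by apply/seteqP; split => // x _; exists x.
split.
- move=> TN thN SN TM thM NP Sy MP.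
  exact: (projective_obstruction M_gt0 Mp NP MP Sy.1 fact0 (symmetrization_weights Sy)).
- move=> TN thN TM thM NP MP; rewrite rid.
  apply: (@projective_obstruction _ _ _ _ _ _ _ _ idfun
    (fun sg => (sg == 1%g)%:R) M_gt0 Mp NP MP _ one0).
    by move=> x; exact: cvg_id.
  exact: identity_weights.
- move=> TN thN SN TM thM NP Sy MP.
  exact: (injective_obstruction M_gt0 Mp NP MP Sy.1 fact0 (symmetrization_weights Sy)).
- move=> TN thN TM thM NP MP; rewrite rid.
  apply: (@injective_obstruction _ _ _ _ _ _ _ _ idfun
    (fun sg => (sg == 1%g)%:R) M_gt0 Mp NP MP _ one0).
    by move=> x; exact: cvg_id.
  exact: identity_weights.
Qed.
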